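(* Let $\Lambda$ be a two-sided noetherian ring, $M$ a finitely generated $\Lambda$-module and $n\ge 0$ an integer. Consider the following conditions. (1) $\operatorname{grade}_{\Lambda^{\mathrm{op}}}\operatorname{Ext}^i_\Lambda(M,\Lambda)\ge i$ for all $1\le i\le n$. (2) $\operatorname{grade}_{\Lambda^{\mathrm{op}}}\operatorname{Ext}^i_\Lambda(M,\Lambda)\ge i-1$, and the morphism $\underline{\psi^i_M}:\operatorname{Tr}\Omega^i\operatorname{Tr}\Omega^iM\to M$ is represented by monomorphisms, for all $1\le i\le n$. (3) There exists a filtration $M_n\subset M_{n-1}\subset\cdots\subset M_1\subset M_0=M\oplus P$ with $P$ finitely generated projective such that for every $1\le k\le n$: $\operatorname{Ext}^i_\Lambda(M_k,\Lambda)=0$ for all $1\le i\le k$, the quotient $M_{k-1}/M_k$ is $k$-spherical, and the $\Lambda$-dual map $M_{k-1}^*\to M_k^*$ is surjective. (4) $M$ is an object of $\mathscr{E}_n(\Lambda)$, i.e., $M$ has an $n$-origin extension. (5) $M$ has an $n$-origin extension $0\to X\to M\oplus P\to Y\to 0$ such that the $\Lambda$-dual sequence $0\to Y^*\to(M\oplus P)^*\to X^*\to 0$ is also exact. (6) $M$ is an object of $\mathscr{A}_n(\Lambda)$, and there exists an $n$-AB approximation $0\to Z\to X\xrightarrow{f}M\to 0$ such that the homomorphism $f:X\to M$ is represented by monomorphisms. Then the implications $(1)\Longleftrightarrow(2)\Longleftrightarrow(3)\Longrightarrow(4)\Longleftrightarrow(5)\Longleftrightarrow(6)$ hold. When the equivalent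 conditions (4)–(6) hold, for any $n$-AB approximation $0\to Z\to X\xrightarrow{f}M\to 0$ of $M$ with $f$ represented by monomorphisms, and for any left $\operatorname{proj}\Lambda$-approximation $s:X\to P$ of $X$, the homomorphism $\binom{f}{s}:X\to M\oplus P$ is injective and the short exact sequence $$0\to X\xrightarrow{\binom{f}{s}}M\oplus P\to Y\to 0,\qquad Y=\operatorname{Coker}\tbinom{f}{s},$$ is an $n$-origin extension of $M$. Moreover, if $\Lambda$ satisfies the $(\ast_n)$-condition, then all the conditions (1)–(6) are equivalent. In particular, when $\Lambda$ is commutative, all the conditions are equivalent.
   Context: Modules are right modules; $\operatorname{mod}\Lambda$ (resp. $\operatorname{proj}\Lambda$) is the category of finitely generated (resp. finitely generated projective) $\Lambda$-modules, and $(-)^*=\operatorname{Hom}_\Lambda(-,\Lambda)$. All modules are finitely generated. A module of projective dimension at most $-1$ is zero. The stable category $\underline{\operatorname{mod}}\Lambda$ has the objects of $\operatorname{mod}\Lambda$ and morphism groups $\underline{\operatorname{Hom}}_\Lambda(X,Y)$, the quotient of $\operatorname{Hom}_\Lambda(X,Y)$ by the subgroup of homomorphisms factoring through a projective module; $\underline f$ denotes the class of $f$. For a projective presentation $P_1\xrightarrow{\partial}P_0\to M\to 0$ by finitely generated projectives, $\Omega M=\operatorname{Im}\partial$ (syzygy) and $\operatorname{Tr}M=\operatorname{Coker}(\partial^* )$ (Auslander transpose); both are unique up to projective summands and define a functor $\Omega:\underline{\operatorname{mod}}\Lambda\to\underline{\operatorname{mod}}\Lambda$ and an anti-equivalence $\operatorname{Tr}:\underline{\operatorname{mod}}\Lambda\to\underline{\operatorname{mod}}\Lambda^{\mathrm{op}}$.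 $\Omega^i$ is the $i$-fold iterate. The pair $(\operatorname{Tr}\Omega^i\operatorname{Tr},\Omega^i)$ of endofunctors of $\underline{\operatorname{mod}}\Lambda$ is an adjoint pair, $\operatorname{Tr}\Omega^i\operatorname{Tr}$ being left adjoint to $\Omega^i$; $\underline{\psi^i_M}:\operatorname{Tr}\Omega^i\operatorname{Tr}\Omega^iM\to M$ denotes its counit at $M$. The grade of a module $N$ is the smallest $i\ge 0$ with $\operatorname{Ext}^i(N,\Lambda)\ne 0$ ($\infty$ if none exists); for a $\Lambda^{\mathrm{op}}$-module, Ext is taken over $\Lambda^{\mathrm{op}}$. A homomorphism $f:X\to Y$ in $\operatorname{mod}\Lambda$ is represented by monomorphisms if there are $P,Q\in\operatorname{proj}\Lambda$ and homomorphisms $s,t,u$ such that $\begin{pmatrix}f&s\\t&u\end{pmatrix}:X\oplus P\to Y\oplus Q$ is a monomorphism; equivalently, there are $Q\in\operatorname{proj}\Lambda$ and $t:X\to Q$ with $\binom{f}{t}:X\to Y\oplus Q$ injective. This depends only on the class $\underline f$, and a morphism of $\underline{\operatorname{mod}}\Lambda$ is said to be represented by monomorphisms if a representing homomorphism is. For $k>0$, a finitely generated module $C$ is $k$-spherical if $\operatorname{pd}_\Lambda C\le k$ and $\operatorname{Ext}^i_\Lambda(C,\Lambda)=0$ for all $1\le i\le k-1$. An $n$-AB approximation of $M$ is an exact sequence $0\to Y\to X\to M\to 0$ in $\operatorname{mod}\Lambda$ with $\operatorname{pd}_\Lambda Y\le n-1$ and $\operatorname{Ext}^i_\Lambda(X,\Lambda)=0$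 for $1\le i\le n$. An $n$-origin extension of $M$ is an exact sequence $0\to X\to M\oplus P\to Y\to 0$ in $\operatorname{mod}\Lambda$ with $P$ projective, $\operatorname{pd}_\Lambda Y\le n$ and $\operatorname{Ext}^i_\Lambda(X,\Lambda)=0$ for $1\le i\le n$. $\mathscr{A}_n(\Lambda)$ (resp. $\mathscr{E}_n(\Lambda)$) is the subcategory of $\operatorname{mod}\Lambda$ of modules having an $n$-AB approximation (resp. an $n$-origin extension). A left $\operatorname{proj}\Lambda$-approximation of $X$ is a homomorphism $s:X\to P$ with $P\in\operatorname{proj}\Lambda$ through which every homomorphism from $X$ to an object of $\operatorname{proj}\Lambda$ factors; equivalently, $s^*:P^*\to X^*$ is surjective. $\Lambda$ satisfies the $(\ast_n)$-condition if every finitely generated $\Lambda$-module $Z$ with $\operatorname{pd}_\Lambda Z\le n$ satisfies $\operatorname{grade}_{\Lambda^{\mathrm{op}}}\operatorname{Ext}^i_\Lambda(Z,\Lambda)\ge i$ for all $1\le i\le n$. *)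

(* Defs.v *)
From HB Require Import structures.
From mathcomp Require Import all_boot all_algebra.
From mathcomp Require Import boolp classical_sets.

Set Implicit Arguments.
Unset Strict Implicit.
Unset Printing Implicit Defensive.

Import GRing.Theory.
Local Open Scope ring_scope.

(* [lmodType A] is the type of left A-modules; right A-modules are left       *)
(* modules over the converse ring, [lmodType A^c].  The operations [syz],     *)
(* [tr] and [ext] below are total on [lmodType A]; they have their usual      *)
(* meaning for finitely generated modules over a noetherian ring.             *)

(* Through an anti-isomorphism B -> A left B-modules are right A-modules, so  *)
(* that the dual of an A-module is defined once for both sides.               *)
Record antiiso (B A : pzRingType) := AntiIso {
  anti_fun :> B -> A;
  antiD : {morph anti_fun : x y / x + y};
  antiM : forall x y, anti_fun (x * y) = anti_fun y * anti_fun x;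
  anti1 : anti_fun 1 = 1;
  anti_bij : bijective anti_fun }.

Definition anti_right (L : pzRingType) : antiiso L L^c :=
  @AntiIso L L^c (fun x => x) (fun x y => erefl) (fun x y => erefl) erefl
    (inv_bij (fun x => erefl)).

Definition anti_left (L : pzRingType) : antiiso L^c L :=
  @AntiIso L^c L (fun x => x) (fun x y => erefl) (fun x y => erefl) erefl
    (inv_bij (fun x => erefl)).

Section Submodule.
Variables (A : pzRingType) (V : lmodType A) (D : submodClosed V).

Definition submod : Type := {x : V | x \in D}.

HB.instance Definition _ := SubChoice.on submod.
HB.instance Definition _ :=
  GRing.SubChoice_isSubLmodule.Build A V _ submod (GRing.subsemimodClosedP D).

Definition subincl (x : submod) : V := val x.

Fact subincl_is_linear : linear subincl.
Proof. by move=> a x y; rewrite /subincl linearP. Qed.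
HB.instance Definition _ :=
  GRing.isLinear.Build A submod V *:%R subincl subincl_is_linear.

End Submodule.

Section Quotient.
Variables (A : pzRingType) (V : lmodType A) (D : submodClosed V).

Local Open Scope quotient_scope.

Definition zmod_pred : {pred V} := [pred x | x \in D].
Fact zmod_pred_closed : zmod_closed zmod_pred.
Proof. exact: GRing.submod_closedB (GRing.submodClosedP D). Qed.
HB.instance Definition _ :=
  GRing.isZmodClosed.Build V zmod_pred zmod_pred_closed.

Definition quotmod : Type := Quotient.quot zmod_pred.

HB.instance Definition _ := GRing.Zmodule.on quotmod.

Definition quotproj (x : V) : quotmod := \pi_(Quotient.quot zmod_pred) x.

Definition quot_scale (a : A) (u : quotmod) : quotmod :=
  quotproj (a *: repr (u : Quotient.quot zmod_pred)).

Fact quotprojD : {morph quotproj : x y / x + y}.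
Proof. by move=> x y; rewrite /quotproj raddfD. Qed.

Fact quotproj_eq x y : (quotproj x == quotproj y) = (x - y \in D).
Proof. by rewrite -Quotient.idealrBE. Qed.

Fact quotprojZ a x : quot_scale a (quotproj x) = quotproj (a *: x).
Proof.
apply/eqP; rewrite quotproj_eq -scalerBr rpredZ// -quotproj_eq.
by rewrite /quotproj reprK.
Qed.

Fact quotprojP (u : quotmod) : {x | u = quotproj x}.
Proof. by exists (repr (u : Quotient.quot zmod_pred)); rewrite /quotproj reprK. Qed.

Fact quot_scaleA a b u : quot_scale a (quot_scale b u) = quot_scale (a * b) u.
Proof. by case: (quotprojP u) => x ->; rewrite !quotprojZ scalerA. Qed.
Fact quot_scale1 : left_id 1 quot_scale.
Proof. by move=> u; case: (quotprojP u) => x ->; rewrite quotprojZ scale1r. Qed.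
Fact quot_scaleDr : right_distributive quot_scale +%R.
Proof.
move=> a u v; case: (quotprojP u) (quotprojP v) => x -> [y ->].
by rewrite -quotprojD !quotprojZ -quotprojD scalerDr.
Qed.
Fact quot_scaleDl u : {morph quot_scale^~ u : a b / a + b}.
Proof.
move=> a b; case: (quotprojP u) => x ->.
by rewrite !quotprojZ -quotprojD scalerDl.
Qed.
HB.instance Definition _ := GRing.Zmodule_isLmodule.Build A quotmod
  quot_scaleA quot_scale1 quot_scaleDr quot_scaleDl.

Fact quotproj_is_linear : linear quotproj.
Proof. by move=> a x y; rewrite quotprojD -quotprojZ. Qed.
HB.instance Definition _ :=
  GRing.isLinear.Build A V quotmod *:%R quotproj quotproj_is_linear.

End Quotient.

Section KernelImage.
Variables (A : pzRingType) (U V : lmodType A) (f : {linear U -> V}).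

Definition linker : {pred U} := [pred x | f x == 0].
Fact linker_closed : submod_closed linker.
Proof.
split=> [|a x y]; first by rewrite inE linear0.
by rewrite !inE linearP => /eqP-> /eqP->; rewrite scaler0 addr0.
Qed.
HB.instance Definition _ := GRing.isSubmodClosed.Build A U linker linker_closed.

Definition linimg : {pred V} := [pred y | `[< exists x, f x = y >]].
Fact linimg_closed : submod_closed linimg.
Proof.
split=> [|a x y]; first by apply/asboolP; exists 0; rewrite linear0.
move=> /asboolP[u <-] /asboolP[v <-]; apply/asboolP.
by exists (a *: u + v); rewrite linearP.
Qed.
HB.instance Definition _ := GRing.isSubmodClosed.Build A V linimg linimg_closed.

Definition preim_sub (D : submodClosed V) : {pred U} := [pred x | f x \in D].
Fact preim_closed (D : submodClosed V) : submod_closed (preim_sub D).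
Proof.
split=> [|a x y]; first by rewrite inE linear0 rpred0.
by rewrite !inE linearP => xD yD; rewrite rpredD ?rpredZ.
Qed.
HB.instance Definition _ (D : submodClosed V) :=
  GRing.isSubmodClosed.Build A U (preim_sub D) (preim_closed D).

End KernelImage.

(* For nested submodules, E <= D, this is the quotient D / E. *)
Definition subquot (A : pzRingType) (V : lmodType A) (D E : submodClosed V) :
    lmodType A :=
  quotmod (preim_sub (@subincl A V D) E).

Section PairMap.
Variables (A : pzRingType) (X M P : lmodType A).
Variables (f : {linear X -> M}) (s : {linear X -> P}).

Definition pair_map (x : X) : (M * P)%type := (f x, s x).
Fact pair_map_is_linear : linear pair_map.
Proof. by move=> a x y; rewrite /pair_map !linearP. Qed.
HB.instance Definition _ :=
  GRing.isLinear.Build A X (M * P)%type *:%R pair_map pair_map_is_linear.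
End PairMap.

(* The B-module Hom_A(M, A), with (b f)(m) = f(m) b. *)
Definition dual (A B : pzRingType) of antiiso B A := fun M : lmodType A =>
  {linear M -> A^o} : Type.

Section Dual.
Variables (A B : pzRingType) (o : antiiso B A).
Notation dual := (dual o).

Section DualModule.
Variable M : lmodType A.
Implicit Types f g : dual M.

HB.instance Definition _ := gen_eqMixin (dual M).
HB.instance Definition _ := gen_choiceMixin (dual M).

Fact dual_ext f g : (forall x, f x = g x) -> f = g.
Proof.
case: f g => [f [[fA] [fZ]]] [g [[gA] [gZ]]] /= fg.
have {}fg : f = g by apply: funext.
rewrite fg in fA fZ *.
by congr GRing.Linear.Pack; congr GRing.Linear.Class; congr (_ _);
  exact: Prop_irrelevance.
Qed.

Definition dual_zero : dual M := \0.
Definition dual_opp f : dual M := \- f.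
Definition dual_add f g : dual M := f \+ g.

Fact dual_addA : associative dual_add.
Proof. by move=> f g h; apply: dual_ext => x /=; rewrite addrA. Qed.
Fact dual_addC : commutative dual_add.
Proof. by move=> f g; apply: dual_ext => x /=; rewrite addrC. Qed.
Fact dual_add0 : left_id dual_zero dual_add.
Proof. by move=> f; apply: dual_ext => x /=; rewrite add0r. Qed.
Fact dual_addN : left_inverse dual_zero dual_opp dual_add.
Proof. by move=> f; apply: dual_ext => x /=; rewrite addNr. Qed.
HB.instance Definition _ :=
  GRing.isZmodule.Build (dual M) dual_addA dual_addC dual_add0 dual_addN.

Definition dual_scale_fun (b : B) f (x : M) : A^o := (f x : A) * o b.
Fact dual_scale_is_linear b f : linear (dual_scale_fun b f).
Proof.
by move=> a x y; rewrite /dual_scale_fun linearP /= mulrDl [a *: f x]/(a * _) -mulrA.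
Qed.
HB.instance Definition _ b f :=
  GRing.isLinear.Build A M A^o *:%R (dual_scale_fun b f)
    (dual_scale_is_linear b f).
Definition dual_scale (b : B) f : dual M := dual_scale_fun b f.

Fact dual_scaleA a b f : dual_scale a (dual_scale b f) = dual_scale (a * b) f.
Proof.
by apply: dual_ext => x /=; rewrite /dual_scale_fun /= antiM mulrA.
Qed.
Fact dual_scale1 : left_id 1 dual_scale.
Proof. by move=> f; apply: dual_ext => x /=; rewrite /dual_scale_fun anti1 mulr1. Qed.
Fact dual_scaleDr : right_distributive dual_scale +%R.
Proof.
by move=> b f g; apply: dual_ext => x /=; rewrite /dual_scale_fun /= mulrDl.
Qed.
Fact dual_scaleDl f : {morph dual_scale^~ f : a b / a + b}.
Proof.
by move=> a b; apply: dual_ext => x /=; rewrite /dual_scale_fun antiD mulrDr.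
Qed.
HB.instance Definition _ := GRing.Zmodule_isLmodule.Build B (dual M)
  dual_scaleA dual_scale1 dual_scaleDr dual_scaleDl.

End DualModule.

Definition dualmap (M N : lmodType A) (f : {linear M -> N}) (u : dual N) :
  dual M := u \o f.

Fact dualmap_is_linear (M N : lmodType A) (f : {linear M -> N}) :
  linear (dualmap f).
Proof. by move=> a u v; apply: dual_ext. Qed.
HB.instance Definition _ (M N : lmodType A) (f : {linear M -> N}) :=
  GRing.isLinear.Build B (dual N) (dual M) *:%R (dualmap f)
    (dualmap_is_linear f).

End Dual.

Arguments dualmap {A B} o {M N} f u.

Section Modules.
Variable A : pzRingType.
Implicit Types M N P X Y Z : lmodType A.

Definition span_of M (s : seq M) : Prop :=
  forall x : M, exists c : 'I_(size s) -> A, x = \sum_i c i *: s`_i.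

Definition fg M : Prop := exists s : seq M, span_of s.

Definition projective P : Prop :=
  forall X Y (g : {linear X -> Y}) (f : {linear P -> Y}),
    (forall y, exists x, g x = y) ->
    exists h : {linear P -> X}, forall p, g (h p) = f p.

Definition fgproj P : Prop := fg P /\ projective P.

Definition ses X Y Z (f : {linear X -> Y}) (g : {linear Y -> Z}) : Prop :=
  [/\ injective f, (forall y, g y = 0 <-> exists x, f x = y)
    & forall z, exists y, g y = z].

(* pd M <= k - 1 *)
Fixpoint pd_lt (k : nat) M : Prop :=
  match k with
  | 0 => forall x : M, x = 0
  | k'.+1 => exists (K P : lmodType A) (i : {linear K -> P})
      (p : {linear P -> M}), [/\ fgproj P, ses i p & pd_lt k' K]
  end.

Definition pd_le (k : nat) M : Prop := pd_lt k.+1 M.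

(* The left ideals of A are the submodules of A^o. *)
Definition left_noetherian : Prop :=
  forall I : submodClosed A^o, fg (submod I).

(* The chosen presentation                                                    *)
(*   freecover (syz M) -> freecover M -> M -> 0                               *)
(* by finitely generated free modules; its first map has image syz M.         *)
Definition gens M : seq M := xget [::] [set s | span_of s]%classic.

Definition freecover M : lmodType A := 'rV[A]_(size (gens M)).

Definition freecover_map M (v : freecover M) : M :=
  \sum_i (v : 'rV[A]__) 0 i *: (gens M)`_i.

Fact freecover_map_is_linear M : linear (@freecover_map M).
Proof.
move=> a u v; rewrite /freecover_map scaler_sumr -big_split /=.
by apply: eq_bigr => i _; rewrite !mxE scalerDl scalerA.
Qed.
HB.instance Definition _ M :=
  GRing.isLinear.Build A (freecover M) M *:%R (@freecover_map M)
    (@freecover_map_is_linear M).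

Definition syz M : lmodType A := submod (linker (@freecover_map M)).

Definition syzn (i : nat) M : lmodType A := iter i syz M.

Definition pres_map M : {linear freecover (syz M) -> freecover M} :=
  @subincl _ _ (linker (@freecover_map M)) \o @freecover_map (syz M).

End Modules.

Section ExtTr.
Variables (A B : pzRingType) (o : antiiso B A).
Implicit Types M : lmodType A.

Definition tr M : lmodType B := quotmod (linimg (dualmap o (pres_map M))).

(* The degree i part of Hom(P, A) for the free resolution P of M obtained by  *)
(* splicing the chosen presentations of the syzygies of M.                    *)
Definition cochain (i : nat) M : lmodType B := dual o (freecover (syzn i M)).

Definition codiff (i : nat) M : {linear cochain i M -> cochain i.+1 M} :=
  dualmap o (pres_map (syzn i M)).

Definition coboundary (i : nat) M : submodClosed (cochain i M) :=
  match i return submodClosed (cochain i M) with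
  | 0 => linimg (\0 : {linear cochain 0 M -> cochain 0 M})
  | j.+1 => linimg (codiff j M)
  end.

Definition ext (i : nat) M : lmodType B :=
  subquot (linker (codiff i M)) (coboundary i M).

Definition ext_zero (i : nat) M : Prop := forall x : ext i M, x = 0.

Definition grade_ge (k : nat) M : Prop :=
  forall j : nat, ~ ext_zero j M -> (k <= j)%N.

Definition spherical (k : nat) (C : lmodType A) : Prop :=
  [/\ fg C, pd_le k C
    & forall i : nat, (1 <= i)%N -> (i < k)%N -> ext_zero i C].

Definition ext_vanish (n : nat) (X : lmodType A) : Prop :=
  forall i : nat, (1 <= i <= n)%N -> ext_zero i X.

Definition AB_approx (n : nat) M (Y X : lmodType A) (g : {linear Y -> X})
    (f : {linear X -> M}) : Prop :=
  [/\ fg Y, fg X, ses g f, pd_lt n Y & ext_vanish n X].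

Definition origin_ext (n : nat) M (X P Y : lmodType A)
    (f : {linear X -> (M * P)%type}) (g : {linear (M * P)%type -> Y}) : Prop :=
  [/\ fg X, fgproj P, fg Y, ses f g & pd_le n Y /\ ext_vanish n X].

Definition has_AB_approx (n : nat) M : Prop :=
  exists (Y X : lmodType A) (g : {linear Y -> X}) (f : {linear X -> M}),
    AB_approx n g f.

Definition has_origin_ext (n : nat) M : Prop :=
  exists (X P Y : lmodType A) (f : {linear X -> (M * P)%type})
    (g : {linear (M * P)%type -> Y}), origin_ext n f g.

End ExtTr.

Section Stable.
Variable A : pzRingType.
Implicit Types M N P Q X Y : lmodType A.

(* Equality of the classes of f and g in the stable category. *)
Definition stable_eq X Y (f g : {linear X -> Y}) : Prop :=
  exists P (a : {linear X -> P}) (b : {linear P -> Y}),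
    fgproj P /\ forall x, f x - g x = b (a x).

Definition choose_linear X Y (Q : {linear X -> Y} -> Prop) : {linear X -> Y} :=
  match pselect (exists g, Q g) with
  | left h => projT1 (cid h)
  | right _ => \0
  end.

(* The functors are given on representatives of stable morphisms, as chosen   *)
(* maps induced on the presentations.                                         *)
Definition syz_hom M N (f : {linear M -> N}) : {linear syz M -> syz N} :=
  choose_linear (fun g : {linear syz M -> syz N} =>
    exists h : {linear freecover M -> freecover N},
      (forall x, freecover_map (h x) = f (freecover_map x)) /\
      (forall x, subincl (g x) = h (subincl x))).

Fixpoint syzn_hom (i : nat) M N (f : {linear M -> N}) :
    {linear syzn i M -> syzn i N} :=
  match i return {linear syzn i M -> syzn i N} with
  | 0 => f
  | j.+1 => syz_hom (syzn_hom j f)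
  end.

Definition left_proj_approx X P (s : {linear X -> P}) : Prop :=
  fgproj P /\
  forall Q (h : {linear X -> Q}), fgproj Q ->
    exists k : {linear P -> Q}, forall x, h x = k (s x).

Definition rep_by_monos X Y (f : {linear X -> Y}) : Prop :=
  exists (P Q : lmodType A) (s : {linear P -> Y}) (t : {linear X -> Q})
    (u : {linear P -> Q}),
    [/\ fgproj P, fgproj Q
      & injective (fun z : X * P => (f z.1 + s z.2, t z.1 + u z.2))].

Definition stable_rep_by_monos X Y (f : {linear X -> Y}) : Prop :=
  exists f' : {linear X -> Y}, stable_eq f f' /\ rep_by_monos f'.

(* An adjunction L -| R between endofunctors of the stable category, as a     *)
(* natural family of bijections on classes of morphisms.                      *)
Record stable_adjunction
    (L R : lmodType A -> lmodType A)
    (Lhom : forall X Y, {linear X -> Y} -> {linear L X -> L Y})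
    (Rhom : forall X Y, {linear X -> Y} -> {linear R X -> R Y}) := {
  adj : forall X Y, {linear L X -> Y} -> {linear X -> R Y};
  adj_eq : forall X Y (f g : {linear L X -> Y}), fg X -> fg Y ->
    stable_eq f g <-> stable_eq (adj f) (adj g);
  adj_surj : forall X Y (h : {linear X -> R Y}), fg X -> fg Y ->
    exists f : {linear L X -> Y}, stable_eq (adj f) h;
  adj_natl : forall X' X Y (u : {linear X' -> X}) (f : {linear L X -> Y}),
    fg X' -> fg X -> fg Y ->
    stable_eq (adj (f \o Lhom _ _ u)) (adj f \o u);
  adj_natr : forall X Y Y' (f : {linear L X -> Y}) (v : {linear Y -> Y'}),
    fg X -> fg Y -> fg Y' ->
    stable_eq (adj (v \o f)) (Rhom _ _ v \o adj f) }.

(* The class of psi is the component at M of the counit. *)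
Definition is_counit L R Lhom Rhom (a : @stable_adjunction L R Lhom Rhom)
    M (psi : {linear L (R M) -> M}) : Prop :=
  stable_eq (adj a psi) idfun.

End Stable.

Definition tr_hom (A B : pzRingType) (o : antiiso B A) (M N : lmodType A)
    (f : {linear M -> N}) : {linear tr o N -> tr o M} :=
  choose_linear (fun g : {linear tr o N -> tr o M} =>
    exists (h0 : {linear freecover M -> freecover N})
      (h1 : {linear freecover (syz M) -> freecover (syz N)}),
      [/\ forall x, freecover_map (h0 x) = f (freecover_map x),
          forall x, pres_map N (h1 x) = h0 (pres_map M x)
        & forall u : dual o (freecover (syz N)),
            g (quotproj _ u) = quotproj _ (dualmap o h1 u)]).

Section Counit.
Variables (A B : pzRingType) (o : antiiso B A) (o' : antiiso A B) (i : nat).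

Definition tr_syz_tr (M : lmodType A) : lmodType A :=
  tr o' (syzn i (tr o M)).

Definition tr_syz_tr_hom (M N : lmodType A) (f : {linear M -> N}) :
    {linear tr_syz_tr M -> tr_syz_tr N} :=
  tr_hom o' (syzn_hom i (tr_hom o f)).

(* A representative of the counit at M of the adjunction of Tr Omega^i Tr and *)
(* Omega^i; changing the adjunction composes it with a stable automorphism.   *)
Definition psi (M : lmodType A) : {linear tr_syz_tr (syzn i M) -> M} :=
  choose_linear (fun f => exists a : stable_adjunction tr_syz_tr_hom
    (fun X Y => @syzn_hom A i X Y), is_counit a f).

End Counit.

Section Conditions.
Variables (A B : pzRingType) (o : antiiso B A) (o' : antiiso A B).
Variables (n : nat) (M : lmodType A).

Definition cond1 : Prop :=
  forall i : nat, (1 <= i <= n)%N -> grade_ge o' i (ext o i M).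

Definition cond2 : Prop :=
  forall i : nat, (1 <= i <= n)%N ->
    grade_ge o' i.-1 (ext o i M) /\ stable_rep_by_monos (psi o o' i M).

Definition cond3 : Prop :=
  exists (P : lmodType A) (F : nat -> submodClosed (M * P)%type),
    [/\ fgproj P, F 0 =i predT,
        forall k, (k < n)%N -> {subset F k.+1 <= F k}
      & forall k, (1 <= k <= n)%N ->
        [/\ ext_vanish o k (submod (F k)),
            spherical o k (subquot (F k.-1) (F k))
          & forall u : dual o (submod (F k)),
              exists v : dual o (submod (F k.-1)),
                forall x y, subincl x = subincl y -> v x = u y]].

Definition cond4 : Prop := has_origin_ext o n M.

Definition cond5 : Prop :=
  exists (X P Y : lmodType A) (f : {linear X -> (M * P)%type})
    (g : {linear (M * P)%type -> Y}),
    origin_ext o n f g /\ ses (dualmap o g) (dualmap o f).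

Definition cond6 : Prop :=
  has_AB_approx o n M /\
  exists (Z X : lmodType A) (g : {linear Z -> X}) (f : {linear X -> M}),
    AB_approx o n g f /\ rep_by_monos f.

End Conditions.

Definition star_condition (A B : pzRingType) (o : antiiso B A)
    (o' : antiiso A B) (n : nat) : Prop :=
  forall Z : lmodType A, fg Z -> pd_le n Z ->
    forall i : nat, (1 <= i <= n)%N -> grade_ge o' i (ext o i Z).

(* Main.v *)
Require Import Defs.
From HB Require Import structures.
From mathcomp Require Import all_boot all_algebra.
From mathcomp Require Import perm boolp classical_sets.

Set Implicit Arguments.
Unset Strict Implicit.
Unset Printing Implicit Defensive.

Import GRing.Theory.
Local Open Scope ring_scope.

(** Why the theorem is true.

Let [f : X -> M] be an AB approximation with kernel [Z], and [s : X -> P] a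
left projective approximation.  Every map from [X] to a projective factors
through [s], so [f] is represented by monomorphisms exactly when [(f, s)] is
injective.  The cokernel [Y] of [(f, s)] then fits into
[0 -> Z -> P -> Y -> 0], which bounds its projective dimension
([origin_of_approx]).  Conversely, an origin extension pulled back along a map
from a projective onto [Y] gives an approximation that embeds in the sum of
[M] and a projective ([approx_of_origin]), and adding a left projective
approximation of [X] to the middle term makes the dual sequence exact
([origin_dual]).  This settles the equivalence of [cond4], [cond5] and
[cond6].

The grade conditions yield such approximations by induction on [n], through
[syz M], whose Ext groups are those of [M] shifted by one
([grade_good_approx]).  An approximation [X -> syz M] represented by
monomorphisms embeds [X] in a projective [Q]; the pushout of this embedding
along [X -> syz M -> F], with [F] the free cover of [M], gives an
approximation of [M] whose kernel [Z'] is [Q / Z] ([approx_step]).  To see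
that it is again represented by monomorphisms, take an element of [Z'] killed
by every map from the middle term to a projective.  Evaluation at it is a
functional on Ext^1 of [M], hence zero ([mono_criterion]), so the element is
killed by all functionals; but [Z'] is torsionless, because Ext^j of [Z'] is
Ext^(j+1) of [M] and has grade above [j] ([torsionless_of_grade]).

Grades enter through two sequences, [0 -> ext 1 W -> tr W -> D -> 0] and
[0 -> D -> Q -> tr (syz W) -> 0] with [Q] projective ([tr_seq]).  They give
the vanishing of Ext of transposes of syzygies ([ext_tr_syzn], after Auslander
and Bridger), the criterion for torsionless modules just used, and the fact
behind all returns to the grade conditions ([grade_top]): if [Y] has
projective dimension at most [i] and Ext^j of [Y] has grade at least [j - 1]
for [j < i], then Ext^i of [Y] has grade at least [i].

From the grade conditions to a filtration ([filtration_ex]): the [k]-th step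
is a dual-exact origin extension of order [k] of the previous module, whose
lower Ext groups already vanish; its cokernel is therefore spherical, and the
higher Ext groups do not change.  Back from a filtration, Ext^k of [M] is
Ext^k of the [k]-th quotient, to which [grade_top] applies ([filtered_grade]).
The quotient of the whole module by the last term is an iterated extension of
the spherical ones, so it has projective dimension at most [n]
([filtered_origin]).

For the counit, transposing a syzygy amounts to taking the cokernel of a left
projective approximation ([approx_trs], [rex_trs]).  So Tr Omega^i Tr is a
chain of cosyzygies where Omega^i is a chain of syzygies, and lifting
morphisms of sequences back and forth gives the adjunction ([linked],
[syz_adjunction]).  Omega^i is full and faithful on maps out of modules with
vanishing Ext^1, ..., Ext^i, where the counit is thus a stable isomorphism
([counit_iso]).  The approximations of [approx_step] become stable
isomorphisms after [i] syzygies, so the counit at [M] is such an approximation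
up to a stable isomorphism of sources ([psi_rep_by_monos]).  Being represented
by monomorphisms then yields origin extensions and, by [grade_top], the grades
([cond21]).

With the star condition the cokernel [Y] of a dual-exact origin extension has
the required grades, and Ext^j of [Y] is Ext^j of [M] ([cond5_1]).  Over a
commutative ring the star condition holds ([commutative_star]): the resolution
of a module [Z] of finite projective dimension splits, after inverting one
element, at any associated prime of a quotient of the ring over which it stays
exact in high degrees.  So the annihilator of Ext^k of [Z] lies in none of
these primes, and it contains a regular sequence of length [k], which forces
Ext^j of Ext^k of [Z] to vanish for [j < k]. *)

(** * Linear maps, kernels and cokernels *)

Section LinearMaps.
Variable A : pzRingType.
Implicit Types U V W X Y Z P Q K M N : lmodType A.

Definition onto (X Y : Type) (f : X -> Y) : Prop := forall y, exists x, f x = y.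

Lemma ex_linear U V (f : U -> V) :
  linear f -> exists g : {linear U -> V}, forall x, g x = f x.
Proof.
move=> fL.
pose g : {linear U -> V} := HB.pack f (GRing.isLinear.Build A U V *:%R f fL).
by exists g.
Qed.

Lemma linear_inj0 U V (f : {linear U -> V}) :
  (forall x, f x = 0 -> x = 0) -> injective f.
Proof.
by move=> f0 x y fxy; apply/subr0_eq/f0; rewrite linearB fxy subrr.
Qed.

Lemma factor_onto X Y N (g : {linear X -> Y}) (f : {linear X -> N}) :
  onto g -> (forall x, g x = 0 -> f x = 0) ->
  exists h : {linear Y -> N}, forall x, h (g x) = f x.
Proof.
move=> /choice[s sK] gf.
have fE x y : g x = g y -> f x = f y.
  by move=> gxy; apply/subr0_eq; rewrite -linearB gf// linearB gxy subrr.
have [|h hE] := @ex_linear Y N (f \o s); last first.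
  by exists h => x; rewrite hE /=; apply: fE; rewrite sK.
by move=> a x y /=; rewrite -linearP; apply: fE; rewrite linearP !sK.
Qed.

Lemma factor_inj K P N (i : {linear K -> P}) (f : {linear N -> P}) :
  injective i -> (forall n, exists k, i k = f n) ->
  exists h : {linear N -> K}, forall n, i (h n) = f n.
Proof.
move=> i_inj /choice[s sE].
have [|h hE] := @ex_linear N K s; last by exists h => n; rewrite hE.
by move=> a x y; apply: i_inj; rewrite linearP !sE linearP.
Qed.

Lemma linear_inverse X Y (f : {linear X -> Y}) : injective f -> onto f ->
  exists g : {linear Y -> X}, cancel f g /\ cancel g f.
Proof.
move=> fI fO.
have [g gE] : exists g : {linear Y -> X}, forall n, f (g n) = idfun n.
  by apply: factor_inj => // n; have [x xE] := fO n; exists x.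
by exists g; split=> x; rewrite ?gE//; apply: fI; rewrite gE.
Qed.

Definition copair X Y N (f : {linear X -> N}) (g : {linear Y -> N})
  : {linear (X * Y)%type -> N} := (f \o fst) \+ (g \o snd).

Definition inl_map X Y : {linear X -> (X * Y)%type} := pair_map idfun \0.
Definition inr_map X Y : {linear Y -> (X * Y)%type} := pair_map \0 idfun.

Lemma copair_decomp X Y N (h : {linear (X * Y)%type -> N}) x y :
  h (x, y) = h (x, 0) + h (0, y).
Proof. by rewrite -linearD; congr (h (_, _)); rewrite /= ?addr0 ?add0r. Qed.

(** Exactness of [X -> Y -> Z -> 0], which is what remains of a projective
    presentation after dualizing, and enough to define maps out of [Z]. *)
Definition rex X Y Z (f : {linear X -> Y}) (g : {linear Y -> Z}) : Prop :=
  (forall y, g y = 0 <-> exists x, f x = y) /\ onto g.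

Lemma ses_rex X Y Z (f : {linear X -> Y}) (g : {linear Y -> Z}) :
  ses f g -> rex f g.
Proof. by case. Qed.

Lemma rex0 X Y Z (f : {linear X -> Y}) (g : {linear Y -> Z}) :
  rex f g -> forall x, g (f x) = 0.
Proof. by move=> [fg _] x; apply/fg; exists x. Qed.

Lemma mem_linker U V (f : {linear U -> V}) x : (x \in linker f) = (f x == 0).
Proof. by []. Qed.

Lemma mem_linimg U V (f : {linear U -> V}) y :
  reflect (exists x, f x = y) (y \in linimg f).
Proof. exact: asboolP. Qed.

Lemma subincl_inj U (D : submodClosed U) : injective (@subincl A U D).
Proof. exact: val_inj. Qed.

Lemma subincl_mem U (D : submodClosed U) (x : submod D) : subincl x \in D.
Proof. exact: valP x. Qed.

Lemma subinclP U (D : submodClosed U) x :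
  reflect (exists y : submod D, subincl y = x) (x \in D).
Proof.
apply: (iffP idP) => [xD|[y <-]]; last exact: subincl_mem.
by exists (exist _ x xD).
Qed.

Lemma ses_linker U V (f : {linear U -> V}) :
  onto f -> ses (@subincl A U (linker f)) f.
Proof.
move=> fO; split=> //; first exact: subincl_inj.
by move=> y; split=> [/eqP fy|/subinclP/eqP//]; apply/subinclP.
Qed.

Lemma quotproj_onto V (D : submodClosed V) : onto (@quotproj A V D).
Proof. by move=> u; case: (quotprojP u) => x ->; exists x. Qed.

Lemma quotproj0 V (D : submodClosed V) x : quotproj D x = 0 <-> x \in D.
Proof.
rewrite -(linear0 (quotproj D)); split=> [/eqP|xD]; last apply/eqP.
  by rewrite quotproj_eq subr0.
by rewrite quotproj_eq subr0.
Qed.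

Lemma rex_quot U V (f : {linear U -> V}) : rex f (quotproj (linimg f)).
Proof.
split; last exact: quotproj_onto.
by move=> y; rewrite quotproj0; split => /mem_linimg.
Qed.

Lemma ses_subquot V (D : submodClosed V) :
  ses (@subincl A V D) (quotproj D).
Proof.
split; [exact: subincl_inj | | exact: quotproj_onto].
by move=> y; rewrite quotproj0; split => /subinclP.
Qed.

Lemma ker_ex U V (f : {linear U -> V}) : onto f ->
  exists (K : lmodType A) (i : {linear K -> U}), ses i f.
Proof. by move=> fO; exists _, (@subincl A U (linker f)); exact: ses_linker. Qed.

Lemma img_ex U V (f : {linear U -> V}) :
  exists (D : lmodType A) (q : {linear U -> D}) (i : {linear D -> V}),
    [/\ onto q, injective i & forall x, i (q x) = f x].
Proof.
have [q qE] : exists q : {linear U -> submod (linimg f)},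
    forall x, @subincl A V (linimg f) (q x) = f x.
  apply: factor_inj => [|x]; first exact: subincl_inj.
  by apply/subinclP/mem_linimg; exists x.
exists _, q, (@subincl A V (linimg f)); split=> //; last exact: subincl_inj.
move=> z; have /mem_linimg[y yE] := subincl_mem z; exists y.
by apply: subincl_inj; rewrite qE.
Qed.

Lemma coker_ex U V (f : {linear U -> V}) : injective f ->
  exists (Z : lmodType A) (g : {linear V -> Z}), ses f g.
Proof.
move=> fI; exists _, (quotproj (linimg f)).
by have [fE fO] := rex_quot f; split.
Qed.

End LinearMaps.

(** * Finitely generated projective modules *)

Section Projectives.
Variable A : pzRingType.
Implicit Types U V W X Y Z P Q K M N : lmodType A.

Lemma fg_onto M N (f : {linear M -> N}) : onto f -> fg M -> fg N.
Proof.
move=> fO [s sP]; exists (map f s) => y.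
have [x <-] := fO y; have [c ->] := sP x.
exists (fun i => c (cast_ord (size_map f s) i)).
rewrite linear_sum /= (reindex (cast_ord (esym (size_map f s)))) /=; last first.
  by exists (cast_ord (size_map f s)) => i _; apply: val_inj.
apply: eq_bigr => i _; rewrite linearZ /=; congr (c _ *: _).
  exact: val_inj.
by rewrite (nth_map 0).
Qed.

Lemma fg_family M n (x : 'I_n -> M) :
  (forall y, exists c : 'I_n -> A, y = \sum_i c i *: x i) -> fg M.
Proof.
move=> xP; exists [seq x i | i <- enum 'I_n] => y; have [c ->] := xP y.
have sz : size [seq x i | i <- enum 'I_n] = n by rewrite size_map size_enum_ord.
exists (fun i => c (cast_ord sz i)).
rewrite (reindex (cast_ord (esym sz))) /=; last first.
  by exists (cast_ord sz) => i _; apply: val_inj.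
apply: eq_bigr => i _; congr (c _ *: _); first exact: val_inj.
rewrite (nth_map i) ?size_enum_ord//; congr (x _); apply: val_inj => /=.
by rewrite nth_enum_ord.
Qed.

Definition cover M : {linear freecover M -> M} := @freecover_map A M.

Definition syzi M : {linear syz M -> freecover M} :=
  @subincl A _ (linker (@freecover_map A M)).

Lemma freecover_onto M : fg M -> onto (cover M).
Proof.
move=> [s sP] x.
have gP : span_of (gens M).
  exact: (@xgetPex _ [::] [set s | span_of s]%classic (ex_intro _ s sP)).
have [c ->] := gP x; exists (\row_i c i).
by apply: eq_bigr => i _; rewrite mxE.
Qed.

Lemma ses_syz M : fg M ->
  ses (syzi M) (cover M).
Proof. by move=> /freecover_onto/ses_linker. Qed.

(** The finite form of being finitely generated and projective
    ([dual_basis_fgproj], [fgproj_basis]).  It is symmetric under duality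
    ([dual_basis_dual]), which gives projectivity of duals and reflexivity at
    one stroke. *)
Definition dual_basis P n (x : 'I_n -> P) (u : 'I_n -> {linear P -> A^o}) :=
  forall y, y = \sum_i (u i y : A) *: x i.

Lemma dual_basis_fgproj P n (x : 'I_n -> P) (u : 'I_n -> {linear P -> A^o}) :
  dual_basis x u -> fgproj P.
Proof.
move=> xu; split; first by apply: (fg_family (x := x)) => y; exists (u^~ y).
move=> X Y g f gO.
have [t tE] := choice (fun i => gO (f (x i))).
have [|h hE] := @ex_linear A P X (fun y => \sum_i (u i y : A) *: t i).
  move=> a y z; rewrite scaler_sumr -big_split /=; apply: eq_bigr => i _.
  by rewrite linearP scalerDl scalerA.
exists h => p; rewrite hE linear_sum [in RHS](xu p) linear_sum.
by apply: eq_bigr => i _; rewrite !linearZ tE.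
Qed.

Lemma row_coord_linear n (i : 'I_n) : linear (fun v : 'rV[A]_n => v 0 i : A^o).
Proof. by move=> a u v; rewrite !mxE. Qed.

Lemma row_dual_basis n : exists (u : 'I_n -> {linear 'rV[A]_n -> A^o}),
  (forall i v, u i v = v 0 i) /\ dual_basis (fun i => 'e_i) u.
Proof.
have [u uE] := choice (fun i => ex_linear (@row_coord_linear n i)).
exists u; split=> // v; rewrite [LHS]row_sum_delta.
by apply: eq_bigr => i _; rewrite uE.
Qed.

Lemma fgproj_row n : fgproj 'rV[A]_n.
Proof. by have [u [_ /dual_basis_fgproj]] := row_dual_basis n. Qed.

Lemma fgproj_freecover M : fgproj (freecover M).
Proof. exact: fgproj_row. Qed.

Lemma fgproj_basis P : fgproj P ->
  exists n (x : 'I_n -> P) (u : 'I_n -> {linear P -> A^o}), dual_basis x u.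
Proof.
move=> [Pfg Pproj].
have [h hE] := Pproj _ _ (cover P) idfun (freecover_onto Pfg).
have [u [_ uE]] := row_dual_basis (size (gens P)).
exists _, (fun i => cover P ('e_i : freecover P)), (fun i => u i \o h).
move=> y; rewrite -[LHS](hE y) [h y in LHS]uE linear_sum.
by apply: eq_bigr => i _; rewrite linearZ.
Qed.

Lemma fgproj_retract P Q (r : {linear Q -> P}) (s : {linear P -> Q}) :
  cancel s r -> fgproj Q -> fgproj P.
Proof.
move=> sr /fgproj_basis[n [x [u xu]]].
apply: (@dual_basis_fgproj P n (fun i => r (x i)) (fun i => u i \o s)) => y.
rewrite -[LHS]sr [s y in LHS]xu linear_sum.
by apply: eq_bigr => i _; rewrite linearZ.
Qed.

Lemma fgproj_prod P Q : fgproj P -> fgproj Q -> fgproj (P * Q)%type.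
Proof.
move=> [[s sP] Pp] [[t tP] Qp]; split.
  apply: (@fg_family (P * Q)%type (size s + size t)
    (fun i => match fintype.split i with inl j => (s`_j, 0) | inr j => (0, t`_j) end)).
  move=> [y z]; have [c ->] := sP y; have [d ->] := tP z.
  exists (fun i => match fintype.split i with inl j => c j | inr j => d j end).
  have -> : (\sum_i c i *: s`_i, \sum_i d i *: t`_i) =
    inl_map P Q (\sum_i c i *: s`_i) + inr_map P Q (\sum_i d i *: t`_i).
    by rewrite /= /pair_map /=; congr (_, _); rewrite /= ?addr0 ?add0r.
  rewrite big_split_ord !linear_sum; congr (_ + _); apply: eq_bigr => i _.
    rewrite (_ : fintype.split _ = inl i); last exact: (unsplitK (inl i)).
    by rewrite linearZ.
  rewrite (_ : fintype.split _ = inr i); last exact: (unsplitK (inr i)).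
  by rewrite linearZ.
move=> X Y g f gO.
have [h hE] := Pp X Y g (f \o inl_map P Q) gO.
have [k kE] := Qp X Y g (f \o inr_map P Q) gO.
exists (copair h k) => -[y z] /=.
by rewrite linearD hE kE /= /pair_map/= -copair_decomp.
Qed.

Lemma proj_lift P X Y (g : {linear X -> Y}) (f : {linear P -> Y}) :
  fgproj P -> onto g -> exists h : {linear P -> X}, forall p, g (h p) = f p.
Proof. by move=> [_ Pp] gO; apply: Pp. Qed.

(** The cover of a projective splits, and a complement of the section is a
    retraction onto the kernel. *)
Lemma fgproj_syz_split P : fgproj P ->
  exists r : {linear freecover P -> syz P}, cancel (syzi P) r.
Proof.
move=> Pp; have [Pfg _] := Pp; have sP := ses_syz Pfg; have [iI ip pO] := sP.
have [s sE] := proj_lift idfun Pp pO.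
have [r rE] : exists r : {linear freecover P -> syz P},
    forall x, syzi P (r x) = (idfun \- (s \o cover P)) x.
  by apply: factor_inj => // x; apply/ip; rewrite /= linearB /= sE subrr.
by exists r => k; apply: iI; rewrite rE /= (rex0 (ses_rex sP)) linear0 subr0.
Qed.

Lemma fg_prod M N : fg M -> fg N -> fg (M * N)%type.
Proof.
move=> Mfg Nfg.
have [fgP _] := fgproj_prod (fgproj_freecover M) (fgproj_freecover N).
apply: fg_onto fgP.
apply: (_ : onto (pair_map (cover M \o fst) (cover N \o snd))).
move=> [x y]; have [u uE] := freecover_onto Mfg x.
by have [v vE] := freecover_onto Nfg y; exists (u, v); rewrite /pair_map /= uE vE.
Qed.

End Projectives.

(** * Noetherian modules *)

Section Noetherian.
Variable A : pzRingType.
Implicit Types U V W X Y Z P Q K M N : lmodType A.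

Definition noeth M : Prop := forall N (i : {linear N -> M}), injective i -> fg N.

Lemma fg_trivial M : (forall x : M, x = 0) -> fg M.
Proof. by move=> M0; exists [::] => x; exists (fun=> 0); rewrite big_ord0. Qed.

Lemma fg_rex X Y Z (f : {linear X -> Y}) (g : {linear Y -> Z}) :
  rex f g -> fg X -> fg Z -> fg Y.
Proof.
move=> [fg gO] Xfg Zfg.
have [h hE] := proj_lift (cover Z) (fgproj_freecover Z) gO.
have [Ffg _] := fgproj_prod (fgproj_freecover X) (fgproj_freecover Z).
apply: (@fg_onto _ _ _ (copair (f \o @freecover_map A X) h)) Ffg => y.
have [v vE] := freecover_onto Zfg (g y).
have /fg[x xE] : g (y - h v) = 0 by rewrite linearB hE vE subrr.
have [u uE] := freecover_onto Xfg x.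
by exists (u, v); rewrite /= uE xE subrK.
Qed.

Lemma noeth_ring : left_noetherian A -> noeth A^o.
Proof.
move=> AN N i iI.
have [h hE] : exists h : {linear submod (linimg i) -> N},
    forall y, i (h y) = subincl y.
  by apply: factor_inj => // y; apply/mem_linimg/subincl_mem.
apply: (@fg_onto _ _ _ h); last exact: AN.
move=> n; have /subinclP[y yE] : i n \in linimg i by apply/mem_linimg; exists n.
by exists y; apply: iI; rewrite hE.
Qed.

(** The kernel of [g i] embeds in [X] and its image in [Z]; [N] is an
    extension of the two. *)
Lemma noeth_ext X Y Z (f : {linear X -> Y}) (g : {linear Y -> Z}) :
  injective f -> (forall y, g y = 0 -> exists x, f x = y) ->
  noeth X -> noeth Z -> noeth Y.
Proof.
move=> fI fg Xn Zn N i iI.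
have [h hE] : exists h : {linear submod (linker (g \o i)) -> X},
    forall y, f (h y) = (i \o @subincl _ _ (linker (g \o i))) y.
  by apply: factor_inj => // y; apply/fg/eqP/(subincl_mem y).
have [q qE] : exists q : {linear N -> submod (linimg (g \o i))},
    forall y, subincl (q y) = (g \o i) y.
  by apply: factor_inj => [|n]; [exact: subincl_inj | apply/subinclP/mem_linimg; exists n].
apply: (@fg_rex _ _ _ (@subincl _ _ (linker (g \o i))) q).
- split=> [y|z].
    have -> : (q y = 0) <-> (y \in linker (g \o i)).
      split=> [qy0|/eqP qy0].
        by apply/eqP; have := qE y; rewrite qy0 linear0 => ->.
      by apply: subincl_inj; rewrite qE linear0.
    by split=> /subinclP.
  have /mem_linimg[y yE] := subincl_mem z; exists y.
  by apply: subincl_inj; rewrite qE.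
- apply: (Xn _ h) => y z hyz; apply: subincl_inj; apply: iI.
  by rewrite -[LHS]hE -[RHS]hE hyz.
- by apply: (Zn _ (@subincl _ _ _)); exact: subincl_inj.
Qed.

Lemma noeth_row n : left_noetherian A -> noeth 'rV[A]_n.
Proof.
move=> AN; elim: n => [|n IHn].
  move=> N i iI; apply: fg_trivial => x; apply: iI.
  by rewrite [LHS]thinmx0 [RHS]thinmx0.
have [g gE] := ex_linear (@row_coord_linear A n.+1 ord0).
pose F (u : 'rV[A]_n) : 'rV[A]_n.+1 := \row_i oapp (u 0) 0 (unlift ord0 i).
have [|f fE] := @ex_linear A _ _ F.
  move=> a u v; apply/rowP => i; rewrite !mxE; case: unlift => [j|] /=.
    exact: row_coord_linear.
  by rewrite mulr0 addr0.
apply: (noeth_ext (f := f) (g := g)) => //; last exact: noeth_ring.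
  move=> u v; rewrite !fE => /rowP fuv; apply/rowP => i.
  by have := fuv (lift ord0 i); rewrite !mxE liftK.
move=> y; rewrite gE => y0; exists (\row_i y 0 (lift ord0 i)); rewrite fE.
apply/rowP => i; rewrite mxE; case: unliftP => [j ->|->] /=; last exact/esym.
by rewrite mxE.
Qed.

Lemma noeth_fg M : left_noetherian A -> fg M -> noeth M.
Proof.
move=> AN Mfg N i iI.
have MO := freecover_onto Mfg.
pose g := quotproj (linimg i) \o cover M.
have [q qE] : exists q : {linear submod (linker g) -> N},
    forall y, i (q y) = (cover M \o @subincl _ _ (linker g)) y.
  apply: factor_inj => // y; have /eqP := subincl_mem y.
  by move=> /quotproj0/mem_linimg.
apply: (@fg_onto _ _ _ q).
  move=> n; have [v vE] := MO (i n).
  have /subinclP[y yE] : v \in linker g.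
    by rewrite mem_linker; apply/eqP/quotproj0/mem_linimg; exists n.
  by exists y; apply: iI; rewrite qE /= yE.
by apply: (@noeth_row (size (gens M)) AN _ (@subincl _ _ (linker g))); exact: subincl_inj.
Qed.

Lemma fg_inj M N (i : {linear N -> M}) :
  left_noetherian A -> injective i -> fg M -> fg N.
Proof. by move=> AN iI Mfg; apply: noeth_fg iI. Qed.

Lemma fg_syz M : left_noetherian A -> fg (syz M).
Proof.
move=> AN; apply: (fg_inj (i := syzi M)) => //; first exact: subincl_inj.
by case: (fgproj_freecover M).
Qed.

Lemma fg_syzn i M : left_noetherian A -> fg M -> fg (syzn i M).
Proof. by move=> AN Mfg; case: i => //= i; exact: fg_syz. Qed.

Lemma ses_fgl X Y Z (f : {linear X -> Y}) (g : {linear Y -> Z}) :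
  left_noetherian A -> ses f g -> fg Y -> fg X.
Proof. by move=> AN [fI _ _]; apply: (@fg_inj _ _ f). Qed.

End Noetherian.

(** * Stable maps and morphisms of sequences *)

Section StableMaps.
Variable A : pzRingType.
Implicit Types U V W X Y Z P Q K M N : lmodType A.

(** The maps that vanish in the stable category.  The type of [f] is a bare
    function type so that sums and differences of linear maps are covered
    without rebundling. *)
Definition null X Y (f : X -> Y) : Prop :=
  exists P (a : {linear X -> P}) (b : {linear P -> Y}),
    fgproj P /\ forall x, f x = b (a x).

Lemma null_ext X Y (f g : X -> Y) : (forall x, f x = g x) -> null f -> null g.
Proof.
by move=> fg [P [a [b [Pp fE]]]]; exists P, a, b; split=> // x; rewrite -fg.
Qed.

Lemma null0 X Y : null (fun _ : X => 0 : Y).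
Proof. by exists 'rV[A]_0, \0, \0; split=> //; exact: fgproj_row. Qed.

Lemma nullD X Y (f g : X -> Y) : null f -> null g -> null (fun x => f x + g x).
Proof.
move=> [P [a [b [Pp fE]]]] [Q [c [d [Qp gE]]]].
exists (P * Q)%type, (pair_map a c), (copair b d).
by split=> [|x /=]; [exact: fgproj_prod | rewrite fE gE].
Qed.

Lemma nullN X Y (f : X -> Y) : null f -> null (fun x => - f x).
Proof.
move=> [P [a [b [Pp fE]]]]; exists P, a, (\- b).
by split=> // x /=; rewrite fE.
Qed.

Lemma null_precomp X Y Z (f : {linear X -> Y}) (g : Y -> Z) :
  null g -> null (g \o f).
Proof.
move=> [P [a [b [Pp gE]]]]; exists P, (a \o f), b; split=> // x /=.
by rewrite gE.
Qed.

Lemma null_postcomp X Y Z (f : X -> Y) (g : {linear Y -> Z}) :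
  null f -> null (g \o f).
Proof.
move=> [P [a [b [Pp fE]]]]; exists P, a, (g \o b); split=> // x /=.
by rewrite fE.
Qed.

Lemma steq_ext X Y (f g : {linear X -> Y}) : f =1 g -> stable_eq f g.
Proof.
by move=> fg; apply: null_ext (null0 X Y) => x; rewrite /= fg subrr.
Qed.

Lemma steq_refl X Y (f : {linear X -> Y}) : stable_eq f f.
Proof. exact: steq_ext. Qed.

Lemma steq_sym X Y (f g : {linear X -> Y}) : stable_eq f g -> stable_eq g f.
Proof. by move=> /nullN; apply: null_ext => x /=; rewrite opprB. Qed.

Lemma steq_trans X Y (g f h : {linear X -> Y}) :
  stable_eq f g -> stable_eq g h -> stable_eq f h.
Proof.
move=> fg gh; apply: null_ext (nullD fg gh) => x /=.
by rewrite addrA subrK.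
Qed.

Lemma steq_comp X Y Z (f f' : {linear Y -> Z}) (g g' : {linear X -> Y}) :
  stable_eq f f' -> stable_eq g g' -> stable_eq (f \o g) (f' \o g').
Proof.
move=> ff gg; have := nullD (null_precomp g ff) (null_postcomp f' gg).
by apply: null_ext => x /=; rewrite linearB addrA subrK.
Qed.

Definition stable_iso X Y (f : {linear X -> Y}) : Prop :=
  exists g : {linear Y -> X}, stable_eq (g \o f) idfun /\ stable_eq (f \o g) idfun.

Lemma stable_iso_comp X Y Z (f : {linear Y -> Z}) (g : {linear X -> Y}) :
  stable_iso f -> stable_iso g -> stable_iso (f \o g).
Proof.
move=> [f' [f'f ff']] [g' [g'g gg']]; exists (g' \o f'); split.
  apply: steq_trans g'g.
  exact: (steq_comp (steq_refl g') (steq_comp f'f (steq_refl g))).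
apply: steq_trans ff'.
exact: (steq_comp (steq_refl f) (steq_comp gg' (steq_refl f'))).
Qed.

Lemma stable_iso_steq X Y (f g : {linear X -> Y}) :
  stable_eq f g -> stable_iso f -> stable_iso g.
Proof.
move=> fg [f' [f'f ff']]; exists f'; split.
  exact: steq_trans (steq_comp (steq_refl f') (steq_sym fg)) f'f.
exact: steq_trans (steq_comp (steq_sym fg) (steq_refl f')) ff'.
Qed.

Lemma iso_stable_iso X Y (f : {linear X -> Y}) :
  injective f -> onto f -> stable_iso f.
Proof.
move=> fI fO; have [g [fK gK]] := linear_inverse fI fO.
by exists g; split; apply: steq_ext.
Qed.

(** Maps of sequences [U -> Q -> V] to [K -> P -> N] with the middle component
    left out.  When [Q] is projective, [f] determines [g] stably
    ([seqmap_exl], [seqmap_steql]): this is how syzygies act on maps.  When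
    [s] is a left projective approximation and [P] is projective, [g]
    determines [f] ([seqmap_exr], [seqmap_steqr]): this is how transposes of
    syzygies act.  Adjunction and full faithfulness of syzygies come from
    combining the two. *)
Definition seqmap U Q V K P N (s : {linear U -> Q}) (r : {linear Q -> V})
    (i : {linear K -> P}) (p : {linear P -> N})
    (g : {linear U -> K}) (f : {linear V -> N}) : Prop :=
  exists c : {linear Q -> P},
    (forall q, p (c q) = f (r q)) /\ (forall u, c (s u) = i (g u)).

Section SeqMap.
Variables (U Q V K P N : lmodType A).
Variables (s : {linear U -> Q}) (r : {linear Q -> V}).
Variables (i : {linear K -> P}) (p : {linear P -> N}).

Lemma seqmap_exl : fgproj Q -> rex s r -> ses i p ->
  forall f, exists g, seqmap s r i p g f.
Proof.
move=> Qp sr [iI ip pO] f; have [c cE] := proj_lift (f \o r) Qp pO.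
have [g gE] : exists g : {linear U -> K}, forall u, i (g u) = (c \o s) u.
  by apply: factor_inj => // u; apply/ip; rewrite /= cE /= (rex0 sr) linear0.
by exists g, c; split=> [q|u]; rewrite ?cE ?gE.
Qed.

Lemma seqmap_exr : left_proj_approx s -> rex s r -> fgproj P -> rex i p ->
  forall g, exists f, seqmap s r i p g f.
Proof.
move=> [_ sA] [sr rO] Pp ip g.
have [c cE] := sA P (i \o g) Pp.
have [f fE] : exists f : {linear V -> N}, forall q, f (r q) = (p \o c) q.
  apply: factor_onto => // q /sr[u <-] /=.
  by rewrite /= -cE /= (rex0 ip).
by exists f, c; split=> [q|u]; rewrite ?fE -?cE.
Qed.

(** Lift the factorization of [f] through a projective to [P] and subtract it
    from the middle map: what is left vanishes in [N], so it takes values in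
    [K]. *)
Lemma seqmap_factl : rex s r -> ses i p ->
  forall g f, seqmap s r i p g f -> null f ->
  exists d : {linear Q -> K}, forall u, g u = d (s u).
Proof.
move=> sr [iI ip pO] g f [c [cf cg]] [S [a [b [Sp fE]]]].
have [b' b'E] := proj_lift b Sp pO.
have [d dE] : exists d : {linear Q -> K}, forall q, i (d q) = (c \- (b' \o a \o r)) q.
  apply: factor_inj => // q; apply/ip.
  by rewrite /= linearB cf b'E fE subrr.
exists d => u; apply: iI.
by rewrite dE /= cg (rex0 sr) !linear0 addr0.
Qed.

Lemma seqmap_nulll : fgproj Q -> rex s r -> ses i p ->
  forall g f, seqmap s r i p g f -> null f -> null g.
Proof.
move=> Qp sr ip g f gf f0; have [d dE] := seqmap_factl sr ip gf f0.
by exists Q, s, d.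
Qed.

(** Dual to the preceding argument: extend the factorization of [g] along [s]
    and subtract it from the middle map, which then descends to [V]. *)
Lemma seqmap_nullr : left_proj_approx s -> rex s r -> fgproj P -> rex i p ->
  forall g f, seqmap s r i p g f -> null g -> null f.
Proof.
move=> [_ sA] [sr rO] Pp ip g f [c [cf cg]] [S [a [b [Sp gE]]]].
have [a' a'E] := sA S a Sp.
have [d dE] : exists d : {linear V -> P}, forall q, d (r q) = (c \- (i \o b \o a')) q.
  apply: factor_onto => // q /sr[u <-].
  by rewrite /= cg gE -a'E subrr.
exists P, d, p; split=> // v; have [q <-] := rO v.
by rewrite dE /= linearB cf (rex0 ip) subr0.
Qed.

Lemma seqmap_sub g f g' f' : seqmap s r i p g f -> seqmap s r i p g' f' ->
  seqmap s r i p (g \- g') (f \- f').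
Proof.
move=> [c [cf cg]] [c' [cf' cg']]; exists (c \- c').
by split=> [q|u] /=; rewrite linearB ?cf ?cf' ?cg ?cg'.
Qed.

Lemma seqmap_steql : fgproj Q -> rex s r -> ses i p ->
  forall g f g' f', seqmap s r i p g f -> seqmap s r i p g' f' ->
  stable_eq f f' -> stable_eq g g'.
Proof.
move=> Qp sr ip g f g' f' gf gf'; have := seqmap_sub gf gf'.
exact: seqmap_nulll.
Qed.

Lemma seqmap_steqr : left_proj_approx s -> rex s r -> fgproj P -> rex i p ->
  forall g f g' f', seqmap s r i p g f -> seqmap s r i p g' f' ->
  stable_eq g g' -> stable_eq f f'.
Proof.
move=> sA sr Pp ip g f g' f' gf gf'; have := seqmap_sub gf gf'.
exact: seqmap_nullr.
Qed.

End SeqMap.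

Lemma seqmap_id U Q V (s : {linear U -> Q}) (r : {linear Q -> V}) :
  seqmap s r s r idfun idfun.
Proof. by exists idfun. Qed.

Lemma seqmap_comp U Q V U' Q' V' K P N
    (s : {linear U -> Q}) (r : {linear Q -> V})
    (s' : {linear U' -> Q'}) (r' : {linear Q' -> V'})
    (i : {linear K -> P}) (p : {linear P -> N}) g f g' f' :
  seqmap s' r' i p g f -> seqmap s r s' r' g' f' ->
  seqmap s r i p (g \o g') (f \o f').
Proof.
move=> [c [cf cg]] [c' [cf' cg']]; exists (c \o c').
by split=> [q|u] /=; rewrite ?cf ?cf' ?cg' ?cg.
Qed.

(** The stable inverse of [f] lifts to the kernels, and both composites lift
    maps that are stably the identity.  For [f] an identity this is Schanuel's
    lemma. *)
Lemma schanuel U Q V K P N (s : {linear U -> Q}) (r : {linear Q -> V})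
    (i : {linear K -> P}) (p : {linear P -> N}) (f : {linear V -> N})
    (g : {linear U -> K}) :
  fgproj Q -> ses s r -> fgproj P -> ses i p ->
  seqmap s r i p g f -> stable_iso f -> stable_iso g.
Proof.
move=> Qp sr Pp ip gf [f' [f'f ff']].
have [g' gf'] := seqmap_exl Pp (ses_rex ip) sr f'.
exists g'; split.
  exact: (seqmap_steql Qp (ses_rex sr) sr (seqmap_comp gf' gf) (seqmap_id _ _)).
exact: (seqmap_steql Pp (ses_rex ip) ip (seqmap_comp gf gf') (seqmap_id _ _)).
Qed.

Lemma choose_linearP X Y (Q : {linear X -> Y} -> Prop) :
  (exists g, Q g) -> Q (choose_linear Q).
Proof.
by move=> ex; rewrite /choose_linear; case: pselect => // h; case: cid.
Qed.

Lemma syz_homP M N (f : {linear M -> N}) : fg M -> fg N ->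
  seqmap (syzi M) (cover M)
         (syzi N) (cover N)
         (syz_hom f) f.
Proof.
move=> Mfg Nfg; have := seqmap_exl (fgproj_freecover M) (ses_rex (ses_syz Mfg)) (ses_syz Nfg) f.
move=> [g [c [cf cg]]].
have := choose_linearP (Q := fun g : {linear syz M -> syz N} =>
    exists h : {linear freecover M -> freecover N},
      (forall x, freecover_map (h x) = f (freecover_map x)) /\
      (forall x, subincl (g x) = h (subincl x))).
move=> [|h [hf hg]]; first by exists g, c; split=> // x; exact: esym (cg x).
by exists h; split=> // u; exact: esym (hg u).
Qed.

Lemma syz_hom_steq M N (f f' : {linear M -> N}) : fg M -> fg N ->
  stable_eq f f' -> stable_eq (syz_hom f) (syz_hom f').
Proof.
move=> Mfg Nfg; exact: (seqmap_steql (fgproj_freecover M)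
  (ses_rex (ses_syz Mfg)) (ses_syz Nfg) (syz_homP f Mfg Nfg) (syz_homP f' Mfg Nfg)).
Qed.

Lemma syz_hom_comp M N Z (f : {linear N -> Z}) (g : {linear M -> N}) :
  fg M -> fg N -> fg Z ->
  stable_eq (syz_hom (f \o g)) (syz_hom f \o syz_hom g).
Proof.
move=> Mfg Nfg Zfg; exact: (seqmap_steql (fgproj_freecover M)
  (ses_rex (ses_syz Mfg)) (ses_syz Zfg) (syz_homP _ Mfg Zfg)
  (seqmap_comp (syz_homP f Nfg Zfg) (syz_homP g Mfg Nfg)) (steq_refl (f \o g))).
Qed.

Lemma syz_hom_iso M N (f : {linear M -> N}) : fg M -> fg N ->
  stable_iso f -> stable_iso (syz_hom f).
Proof.
move=> Mfg Nfg; exact: (schanuel (fgproj_freecover M) (ses_syz Mfg)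
  (fgproj_freecover N) (ses_syz Nfg) (syz_homP f Mfg Nfg)).
Qed.

End StableMaps.

(** * Isomorphism and stable equivalence *)

Section Isom.
Variable A : pzRingType.
Implicit Types X Y Z E D M N K P : lmodType A.

Definition isom M N : Prop :=
  exists f : {linear M -> N}, injective f /\ onto f.

Lemma isom_sym M N : isom M N -> isom N M.
Proof.
move=> [f [fI fO]]; have [g [fK gK]] := linear_inverse fI fO.
by exists g; split; [exact: can_inj gK | move=> y; exists (f y)].
Qed.

Lemma isom_trans M N X : isom M N -> isom N X -> isom M X.
Proof.
move=> [f [fI fO]] [g [gI gO]]; exists (g \o f); split.
  by move=> x y /gI/fI.
by move=> z; have [y <-] := gO z; have [x <-] := fO y; exists x.
Qed.

Lemma isom_of_onto D E E' (f : {linear D -> E}) (g : {linear D -> E'}) :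
  onto f -> onto g -> (forall x, f x = 0 <-> g x = 0) -> isom E E'.
Proof.
move=> fO gO fg.
have [h hE] := factor_onto fO (fun x => (fg x).1).
exists h; split=> [|y]; last by have [x <-] := gO y; exists (f x).
apply: linear_inj0 => x; have [d <-] := fO x.
by rewrite hE => /fg.
Qed.

Lemma isom_zero M N : isom M N -> (forall x : M, x = 0) -> forall y : N, y = 0.
Proof.
by move=> [f [_ fO]] M0 y; have [x <-] := fO y; rewrite (M0 x) linear0.
Qed.

Lemma isom_fg M N : isom M N -> fg M -> fg N.
Proof. by move=> [f [_ fO]]; apply: (@fg_onto _ _ _ f). Qed.

Definition steqv M N : Prop := exists f : {linear M -> N}, stable_iso f.

Lemma steqv_refl M : steqv M M.
Proof. by exists idfun; exists idfun; split; exact: steq_refl. Qed.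

Lemma steqv_sym M N : steqv M N -> steqv N M.
Proof. by move=> [f [g [gf fg]]]; exists g, f. Qed.

Lemma steqv_trans M N X : steqv M N -> steqv N X -> steqv M X.
Proof. by move=> [f fI] [g gI]; exists (g \o f); apply: stable_iso_comp. Qed.

Lemma isom_steqv M N : isom M N -> steqv M N.
Proof. by move=> [f [fI fO]]; exists f; apply: iso_stable_iso. Qed.

Lemma steqv_syz M N : fg M -> fg N -> steqv M N -> steqv (syz M) (syz N).
Proof. by move=> Mfg Nfg [f fI]; exists (syz_hom f); apply: syz_hom_iso. Qed.

Lemma ses_syz_steqv K P M (i : {linear K -> P}) (p : {linear P -> M}) :
  fg M -> fgproj P -> ses i p -> steqv K (syz M).
Proof.
move=> Mfg Pp ip.
have [g gE] := seqmap_exl Pp (ses_rex ip) (ses_syz Mfg) idfun.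
exists g; apply: (schanuel Pp ip (fgproj_freecover M) (ses_syz Mfg) gE).
by exists idfun; split; exact: steq_refl.
Qed.

End Isom.

(** * Duals, left projective approximations and Ext *)

Section Duals.
Variables (A B : pzRingType) (o : antiiso B A) (o' : antiiso A B).

(** The two rings acting on the right and on the left of the modules, with
    mutually inverse identifications.  The data are symmetric, so that each
    result about [A]-modules holds for [B]-modules as well. *)
Definition noeth_duality : Prop :=
  [/\ cancel o o', cancel o' o, left_noetherian A & left_noetherian B].

End Duals.

Lemma noeth_duality_sym A B (o : antiiso B A) (o' : antiiso A B) :
  noeth_duality o o' -> noeth_duality o' o.
Proof. by case. Qed.

Section Duality.
Variables (A B : pzRingType) (o : antiiso B A) (o' : antiiso A B).
Hypothesis H : noeth_duality o o'.
Implicit Types U V W X Y Z P Q K M N : lmodType A.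

Let oK : cancel o o'. Proof. by case: H. Qed.
Let o'K : cancel o' o. Proof. by case: H. Qed.
Let AN : left_noetherian A. Proof. by case: H. Qed.
Let BN : left_noetherian B. Proof. by case: H. Qed.

Lemma antiB (x y : A) : o' (x - y) = o' x - o' y.
Proof.
have o'0 : o' 0 = 0 by apply: (addIr (o' 0)); rewrite -antiD !add0r.
apply: (addIr (o' y)); rewrite subrK -antiD subrK //.
Qed.

Lemma anti0 : o' 0 = 0.
Proof. by rewrite -(subrr 0) antiB subrr. Qed.

Lemma ev_linear M (x : M) : linear (fun u : dual o M => o' (u x) : B^o).
Proof.
move=> b u v; rewrite antiD; congr (_ + _).
by rewrite [(b *: u) x]/((u x : A) * o b) antiM oK.
Qed.

Lemma ev_ex M (x : M) : exists e : {linear dual o M -> B^o},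
  forall u, e u = o' (u x).
Proof. exact: ex_linear (@ev_linear M x). Qed.

Lemma o'_eq0 (a : A) : o' a = 0 -> a = 0.
Proof. by move=> a0; apply: (can_inj o'K); rewrite a0 anti0. Qed.

Lemma dual_sum M n (F : 'I_n -> dual o M) x :
  (\sum_i F i : dual o M) x = \sum_i F i x.
Proof. by elim/big_rec2: _ => // i a u _ <-. Qed.

Lemma dual_basis_dual P n (x : 'I_n -> P) (u : 'I_n -> {linear P -> A^o}) :
  dual_basis x u -> exists v : 'I_n -> {linear dual o P -> B^o},
    (forall i w, v i w = o' (w (x i))) /\
    dual_basis (u : 'I_n -> dual o P) v.
Proof.
move=> xu; have [v vE] := choice (fun i => ev_ex (x i)).
exists v; split=> // w; apply: dual_ext => y.
rewrite dual_sum [in LHS](xu y) linear_sum; apply: eq_bigr => i _.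
by rewrite linearZ vE /= /dual_scale_fun o'K.
Qed.

Lemma dual_fgproj P : fgproj P -> fgproj (dual o P).
Proof.
move=> /fgproj_basis[n [x [u xu]]]; have [v [_ uv]] := dual_basis_dual xu.
exact: dual_basis_fgproj uv.
Qed.

(** Finitely generated projectives are reflexive; the element is read off from
    the values of [l] at a dual basis. *)
Lemma bidual_onto P (l : {linear dual o P -> B^o}) : fgproj P ->
  exists x, forall u : dual o P, l u = o' (u x).
Proof.
move=> /fgproj_basis[n [x [u xu]]]; have [v [vE uv]] := dual_basis_dual xu.
exists (\sum_i o (l (u i)) *: x i) => w.
rewrite [w in LHS]uv !linear_sum.
have anti_sum (F : 'I_n -> A) : o' (\sum_i F i) = \sum_i o' (F i).
  by elim/big_rec2: _ => [|i a b _ <-]; rewrite ?anti0 ?antiD.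
rewrite anti_sum; apply: eq_bigr => i _.
by rewrite !linearZ /= vE antiM oK.
Qed.

Lemma dual_separated P x : fgproj P -> (forall u : dual o P, u x = 0) -> x = 0.
Proof.
move=> /fgproj_basis[n [y [u yu]]] x0; rewrite [LHS]yu big1// => i _.
by rewrite [u i x](x0 (u i)) scale0r.
Qed.

Lemma dual_fg M : fg M -> fg (dual o M).
Proof.
move=> /freecover_onto MO.
apply: (fg_inj (i := dualmap o (cover M))) => //.
  move=> u v uv; apply: dual_ext => x; have [y <-] := MO x.
  exact: (congr1 (fun w : dual o (freecover M) => w y) uv).
by have [] := dual_fgproj (fgproj_freecover M).
Qed.

Definition extends K P (i : {linear K -> P}) (u : {linear K -> A^o}) : Prop :=
  exists v : {linear P -> A^o}, forall k, u k = v (i k).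

Lemma row_functional n (Q : lmodType A) (f : 'I_n -> {linear Q -> A^o}) :
  exists g : {linear Q -> 'rV[A]_n}, forall q i, g q 0 i = f i q.
Proof.
have [|g gE] := @ex_linear A Q 'rV[A]_n (fun q => \row_i (f i q : A)).
  by move=> a x y; apply/rowP => i; rewrite !mxE linearP.
by exists g => q i; rewrite gE mxE.
Qed.

Lemma fgproj_ring : fgproj A^o.
Proof.
apply: (@dual_basis_fgproj A A^o 1 (fun=> 1 : A) (fun=> idfun)) => y.
by rewrite big_ord1 /= [_ *: _]mulr1.
Qed.

Lemma combination n (Q : lmodType A) (x : 'I_n -> Q) (N : lmodType A)
    (u : 'I_n -> {linear N -> A^o}) :
  exists g : {linear N -> Q}, forall y, g y = \sum_i (u i y : A) *: x i.
Proof.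
apply: ex_linear => a y z; rewrite scaler_sumr -big_split /=.
by apply: eq_bigr => i _; rewrite linearP scalerDl scalerA.
Qed.

(** It is enough to extend functionals: a map to a projective is given by its
    coordinates in a dual basis. *)
Lemma approxP X Q (s : {linear X -> Q}) :
  left_proj_approx s <-> fgproj Q /\ forall u, extends s u.
Proof.
split=> -[Qp sA]; split=> //.
  by move=> u; have [v vE] := sA _ u fgproj_ring; exists v.
move=> Q' h /fgproj_basis[n [x [u xu]]].
have [v vE] := choice (fun i => sA (u i \o h)).
have [g gE] := combination x v; exists g => y.
by rewrite gE [LHS]xu; apply: eq_bigr => i _; rewrite -vE.
Qed.

(** The generators of [dual o X], which is finitely generated over a
    noetherian ring, are the coordinates of an approximation. *)
Lemma approx_ex X : fg X ->
  exists Q (s : {linear X -> Q}), left_proj_approx s.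
Proof.
move=> /dual_fg[t tP].
have [s sE] := row_functional (fun i : 'I_(size t) => (t`_i : dual o X)).
exists 'rV[A]_(size t), s; apply/approxP; split; first exact: fgproj_row.
move=> u; have [c cE] := tP (u : dual o X).
have [e [eE _]] := row_dual_basis A (size t).
have [v vE] := ex_linear (f := fun y => (\sum_i (c i *: (e i : dual o _)) : dual o _) y) (linearP _).
exists v => x; rewrite vE dual_sum -[u x]/((u : dual o X) x) cE dual_sum.
by apply: eq_bigr => i _; rewrite /= /dual_scale_fun eE sE.
Qed.

(** [E] is the cokernel of the restriction from [dual o P] to [dual o K].  For
    [0 -> K -> P -> N -> 0] with [P] projective it is Ext^1 of [N] ([ext1P]),
    so Ext can be handled by extending functionals along any convenient
    inclusion. *)
Definition is_e1 K P (i : {linear K -> P}) (E : lmodType B) : Prop :=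
  exists f : {linear dual o K -> E}, onto f /\ forall u, f u = 0 <-> extends i u.

Lemma is_e1_isom K P (i : {linear K -> P}) E E' :
  is_e1 i E -> is_e1 i E' -> isom E E'.
Proof.
move=> [f [fO fE]] [g [gO gE]]; apply: (isom_of_onto fO gO) => u.
by rewrite fE gE.
Qed.

Lemma is_e1_zero K P (i : {linear K -> P}) E : is_e1 i E ->
  (forall x : E, x = 0) <-> (forall u, extends i u).
Proof.
move=> [f [fO fE]]; split=> [E0 u|iE x]; first by apply/fE.
by have [u <-] := fO x; apply/fE.
Qed.

(** Comparison maps of the two sequences exist in both directions, and their
    composites differ from the identities by maps that extend to the
    projective middle terms ([seqmap_factl]), which do not count in the
    cokernel. *)
Lemma is_e1_transport U Q V K P N (s : {linear U -> Q}) (r : {linear Q -> V})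
    (i : {linear K -> P}) (p : {linear P -> N}) (f : {linear V -> N}) E :
  fgproj Q -> ses s r -> fgproj P -> ses i p -> stable_iso f ->
  is_e1 s E -> is_e1 i E.
Proof.
move=> Qp sr Pp ip [f' [f'f ff']] [h [hO hE]].
have [g gf] := seqmap_exl Qp (ses_rex sr) ip f.
have [g' gf'] := seqmap_exl Pp (ses_rex ip) sr f'.
(* [g' g - 1] factors through [s], and [g g' - 1] through [i]. *)
have cmp := seqmap_sub (seqmap_comp gf' gf) (seqmap_id s r).
have [d dE] := seqmap_factl (ses_rex sr) sr cmp f'f.
have cmp' := seqmap_sub (seqmap_comp gf gf') (seqmap_id i p).
have [d' d'E] := seqmap_factl (ses_rex ip) ip cmp' ff'.
have gfE := gf; case: gfE => c [_ cg]; have gfE' := gf'; case: gfE' => c' [_ cg'].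
exists (h \o dualmap o g); split.
  move=> y; have [v <-] := hO y; exists (dualmap o g' v).
  apply/subr0_eq; rewrite /= -linearB; apply/hE; exists (v \o d) => k.
  by rewrite /= -dE /= linearB.
move=> u; rewrite /= hE; split=> [[v vE]|[v vE]].
  exists ((v \o c') \- (u \o d')) => k; rewrite /= -d'E /= linearB.
  by rewrite cg' -vE /dualmap/= opprB addrC subrK.
by exists (v \o c) => k; rewrite /= cg -vE.
Qed.

(** A 1-cocycle is a functional on the cover of [syz W] that vanishes on
    relations, that is, a functional on [syz W]; the coboundaries are those
    that extend to the cover of [W]. *)
Lemma ext1_syzi W : fg W -> is_e1 (syzi W) (ext o 1 W).
Proof.
move=> Wfg; have sO := freecover_onto (fg_syz W AN).
have ssO := freecover_onto (fg_syz (syz W) AN).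
have [t tE] : exists t : {linear dual o (syz W) -> submod (linker (codiff o 1 W))},
    forall u, subincl (t u) = dualmap o (cover (syz W)) u.
  apply: factor_inj => [|u]; first exact: subincl_inj.
  apply/subinclP; rewrite mem_linker; apply/eqP; apply: dual_ext => x.
  rewrite /= /dualmap /=.
  by rewrite -[freecover_map (subincl _)]/(cover _ (syzi _ _)) (rex0 (ses_rex (ses_syz _))) ?linear0//; exact: fg_syz.
exists (quotproj _ \o t); split.
  move=> y; case: (quotprojP y) => z ->.
  have [u uE] : exists u : {linear syz W -> A^o}, forall x, u (cover _ x) = (subincl z : dual o _) x.
    apply: factor_onto => // x /(proj1 (ses_rex (ses_syz (fg_syz W AN)))) [k <-].
    have [x' <-] := ssO k.
    have /eqP := subincl_mem z.
    by move=> /(congr1 (fun w : dual o _ => w x')).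
  exists u; congr (quotproj _ _); apply: subincl_inj; rewrite tE.
  by apply: dual_ext => x; rewrite -uE.
move=> u; rewrite /= quotproj0; split.
  move=> /mem_linimg[v vE]; exists v => k; have [x <-] := sO k.
  exact: (esym (congr1 (fun w : dual o _ => w x) (etrans vE (tE u)))).
move=> [v vE]; apply/mem_linimg; exists v; apply: etrans (esym (tE u)).
by apply: dual_ext => x; rewrite /= /dualmap /= vE.
Qed.

Lemma ext1P W V K P (i : {linear K -> P}) (p : {linear P -> V}) :
  fg W -> steqv W V -> fgproj P -> ses i p -> is_e1 i (ext o 1 W).
Proof.
move=> Wfg [f fI] Pp ip.
exact: is_e1_transport (fgproj_freecover W) (ses_syz Wfg) Pp ip fI (ext1_syzi Wfg).
Qed.

Lemma steqv_syzn j W V : fg W -> fg V -> steqv W V -> steqv (syzn j W) (syzn j V).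
Proof.
by move=> Wfg Vfg WV; elim: j => //= j; apply: steqv_syz; exact: fg_syzn.
Qed.

Lemma steqv_syznS j W V : fg W -> fg V -> steqv V (syz W) ->
  steqv (syzn j V) (syzn j.+1 W).
Proof.
move=> Wfg Vfg WV; elim: j => //= j; apply: steqv_syz; first exact: fg_syzn.
exact: (fg_syzn j.+1).
Qed.

Lemma ext1_steqv W V : fg W -> fg V -> steqv W V -> isom (ext o 1 W) (ext o 1 V).
Proof.
move=> Wfg Vfg WV; apply: is_e1_isom (ext1_syzi Vfg).
exact: ext1P Wfg WV (fgproj_freecover V) (ses_syz Vfg).
Qed.

(** Ext^1 as a function of the module alone.  The degree [j + 1] part of Ext
    of [W] mentions [W] and [j] only through [syzn j W], and naming this
    function makes the dimension shift [extSE] a cheap conversion. *)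
Definition ext_one (X : lmodType A) : lmodType B :=
  subquot (linker (dualmap o (pres_map (syz X)))) (linimg (dualmap o (pres_map X))).

Lemma ext_oneE j W : ext o j.+1 W = ext_one (syzn j W).
Proof.
cbv beta iota delta [ext cochain codiff coboundary ext_one].
by change (syzn j.+1 W) with (syz (syzn j W)).
Qed.

Lemma extSE j W : ext o j.+1 W = ext o 1 (syzn j W).
Proof. by rewrite !ext_oneE. Qed.

Lemma ext_steqv j W V : fg W -> fg V -> steqv W V ->
  isom (ext o j.+1 W) (ext o j.+1 V).
Proof.
move=> Wfg Vfg WV; rewrite (extSE j W) (extSE j V); apply: ext1_steqv; try exact: fg_syzn.
exact: steqv_syzn.
Qed.

Lemma ext_shift j W K P (i : {linear K -> P}) (p : {linear P -> W}) :
  fg W -> fgproj P -> ses i p -> isom (ext o j.+1 K) (ext o j.+2 W).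
Proof.
move=> Wfg Pp ip; have Kfg : fg K by apply: ses_fgl AN ip _; case: Pp.
rewrite (extSE j K) (extSE j.+1 W); apply: ext1_steqv; try exact: fg_syzn.
by apply: steqv_syznS => //; apply: ses_syz_steqv ip.
Qed.

Lemma ext0P W : fg W -> ext_zero o 0 W <-> forall u : dual o W, u = 0.
Proof.
move=> Wfg; have WO := freecover_onto Wfg; have sO := freecover_onto (fg_syz W AN).
split=> [W0 u|W0 x].
  have [z zE] : exists z : submod (linker (codiff o 0 W)), subincl z = dualmap o (cover W) u.
    apply/subinclP; rewrite mem_linker; apply/eqP/dual_ext => x.
    rewrite /= /dualmap /=.
    by rewrite -[freecover_map (subincl _)]/(cover _ (syzi _ _)) (rex0 (ses_rex (ses_syz _))) ?linear0.
  have /quotproj0/mem_linimg[w wE0] := W0 (quotproj _ z).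
  have wE := etrans wE0 zE; apply: dual_ext => x; have [y <-] := WO x.
  exact: (esym (congr1 (fun w : dual o _ => w y) wE)).
case: (quotprojP x) => z ->; apply/quotproj0/mem_linimg.
exists 0; rewrite /=; apply/esym; apply: dual_ext => x'.
have [u uE] : exists u : {linear W -> A^o}, forall x, u (cover _ x) = (subincl z : dual o _) x.
  apply: factor_onto => // y /(proj1 (ses_rex (ses_syz Wfg))) [k <-].
  have [y' <-] := sO k.
  by have /eqP := subincl_mem z; move=> /(congr1 (fun w : dual o _ => w y')).
by rewrite -uE [u _](congr1 (fun w : dual o _ => w _) (W0 u)).
Qed.

Lemma ext_fg j W : fg W -> fg (ext o j W).
Proof.
move=> Wfg; apply: (@fg_onto _ _ _ (quotproj _)); first exact: quotproj_onto.
apply: (fg_inj (i := @subincl _ _ _) BN); first exact: subincl_inj.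
by have [] := dual_fgproj (fgproj_freecover (syzn j W)).
Qed.

End Duality.

(** * The horseshoe lemma *)

Section Horseshoe.
Variable A : pzRingType.
Variables (X Y Z KX PX KZ PZ : lmodType A).
Variables (a : {linear X -> Y}) (b : {linear Y -> Z}).
Variables (iX : {linear KX -> PX}) (pX : {linear PX -> X}).
Variables (iZ : {linear KZ -> PZ}) (pZ : {linear PZ -> Z}).

(** The formulas for the maps are part of the result, since functionals on the
    kernels are split into components along them. *)
Lemma horseshoe : ses a b -> ses iX pX -> ses iZ pZ -> fgproj PZ ->
  exists (Y' : lmodType A) (iY : {linear Y' -> (PX * PZ)%type})
    (pY : {linear (PX * PZ)%type -> Y})
    (a' : {linear KX -> Y'}) (b' : {linear Y' -> KZ}),
    [/\ ses iY pY, ses a' b', forall k, iY (a' k) = (iX k, 0),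
        forall y, iZ (b' y) = (iY y).2
      & (forall x, pY (x, 0) = a (pX x)) /\ forall q, b (pY q) = pZ q.2].
Proof.
move=> ab iXp iZp PZp; have [aI ab0 bO] := ab.
have [iXI iXE pXO] := iXp; have [iZI iZE pZO] := iZp.
have [l lE] := proj_lift pZ PZp bO.
pose pY := copair (a \o pX) l.
have bpY q : b (pY q) = pZ q.2.
  by rewrite /= linearD lE (rex0 (ses_rex ab)) add0r.
have pYO : onto pY.
  move=> y; have [r rE] := pZO (b y).
  have /ab0[x xE] : b (y - l r) = 0 by rewrite linearB lE rE subrr.
  by have [x' x'E] := pXO x; exists (x', r); rewrite /= x'E xE subrK.
have pY0 x : pY (x, 0) = a (pX x) by rewrite /= linear0 addr0.
have [S [iY sY]] := ker_ex pYO.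
have [iYI iYE _] := sY.
have [a' a'E] : exists a' : {linear KX -> S},
    forall k, iY (a' k) = (inl_map PX PZ \o iX) k.
  apply: factor_inj => // k; apply/iYE.
  by rewrite /= /pair_map /= linear0 (rex0 (ses_rex iXp)) linear0 addr0.
have [b' b'E] : exists b' : {linear S -> KZ},
    forall k, iZ (b' k) = (snd \o iY) k.
  apply: factor_inj => // y; apply/iZE; rewrite -[LHS]/(pZ (iY y).2) -bpY.
  by rewrite (rex0 (ses_rex sY)) linear0.
exists (S), iY, pY, a', b'; split=> //.
split.
- move=> k k' kk; apply: iXI.
  by case: (etrans (esym (a'E k)) (etrans (congr1 iY kk) (a'E k'))).
- move=> y; split=> [by0|[k <-]]; last first.
    by apply: iZI; rewrite b'E linear0; exact: (congr1 snd (a'E k)).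
  have y2 : (iY y).2 = 0 by rewrite -[LHS](b'E y) by0 linear0.
  have : pY (iY y) = 0 by apply: rex0 (ses_rex sY) _.
  rewrite [iY y]surjective_pairing y2 pY0 -(linear0 a) => /aI/iXE[k kE].
  by exists k; apply: iYI; rewrite a'E [RHS]surjective_pairing y2 -kE.
- move=> k; have /ab0[x xE] : b (l (iZ k)) = 0.
    by rewrite lE (rex0 (ses_rex iZp)).
  have [x' x'E] := pXO x.
  have /iYE[y yE] : pY (- x', iZ k) = 0.
    by rewrite /= !linearN x'E xE addNr.
  by exists y; apply: iZI; rewrite b'E /= yE.
Qed.

End Horseshoe.

(** * Projective dimension *)

Section ProjDim.
Variable A : pzRingType.
Implicit Types X Y Z K P Q M N W : lmodType A.

(** If the identity of [W] is [g f] up to a map through a projective [S], then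
    [W] is a retract of [P * S]. *)
Lemma steqv_fgproj W P : fgproj P -> steqv W P -> fgproj W.
Proof.
move=> Pp [f [g [[S [u [v [Sp gfE]]]] _]]].
apply: (fgproj_retract (r := copair g (\- v)) (s := pair_map f u)) (fgproj_prod Pp Sp) => x.
by rewrite /= /pair_map /= -gfE /= opprB addrC subrK.
Qed.

Lemma isom_fgproj W P : isom W P -> fgproj P -> fgproj W.
Proof. by move=> /isom_steqv WP Pp; apply: steqv_fgproj WP. Qed.

Lemma pd_lt1 W : pd_lt 1 W <-> fgproj W.
Proof.
split=> [[K [P [i [p [Pp [iI ip pO] K0]]]]]|Wp].
  apply: isom_fgproj Pp; apply: isom_sym; exists p; split=> //.
  by apply: linear_inj0 => x /ip[k <-]; rewrite (K0 k) linear0.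
exists 'rV[A]_0, W, \0, idfun; split=> //; last by move=> x; exact: thinmx0.
split=> [x y _|y|y]; last by exists y.
  by rewrite [LHS]thinmx0 [RHS]thinmx0.
by split=> [y0|[_ <-]//]; exists 0; exact: esym y0.
Qed.

Lemma pd_lt_isom k M N : isom M N -> pd_lt k M -> pd_lt k N.
Proof.
case: k => [|k] /=; first exact: isom_zero.
move=> [f [fI fO]] [K [P [i [p [Pp [iI ip pO] Kk]]]]].
exists K, P, i, (f \o p); split=> //; split=> //.
  by move=> y; rewrite -ip /=; split=> [|->]; [rewrite -(linear0 f) => /fI | rewrite linear0].
by move=> z; have [y <-] := fO z; have [x <-] := pO y; exists x.
Qed.

Lemma pd_ltS k M : pd_lt k M -> pd_lt k.+1 M.
Proof.
elim: k M => [|k IHk] M.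
  move=> M0; apply/pd_lt1; apply: isom_fgproj (fgproj_row A 0).
  exists \0; split=> [x y _|y]; first by rewrite (M0 x) (M0 y).
  by exists 0; rewrite [RHS]thinmx0 [LHS]thinmx0.
move=> [K [P [i [p [Pp ip Kk]]]]]; exists K, P, i, p; split=> //.
exact: IHk.
Qed.

Lemma pd_lt_leq k l M : (k <= l)%N -> pd_lt k M -> pd_lt l M.
Proof.
by move=> /subnKC <- Mk; elim: (l - k)%N => [|m]; rewrite ?addn0// addnS => /pd_ltS.
Qed.

Lemma pd_lt_ses k X Y Z (a : {linear X -> Y}) (b : {linear Y -> Z}) :
  ses a b -> pd_lt k X -> pd_lt k Z -> pd_lt k Y.
Proof.
elim: k X Y Z a b => [|k IHk] X Y Z a b ab.
  move=> /= X0 Z0 y; have [_ ab0 _] := ab.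
  by have /ab0[x <-] := Z0 (b y); rewrite (X0 x) linear0.
move=> [KX [PX [iX [pX [PXp iXp KXk]]]]] [KZ [PZ [iZ [pZ [PZp iZp KZk]]]]].
have [Y' [iY [pY [a' [b' [sY sab _ _ _]]]]]] := horseshoe ab iXp iZp PZp.
exists Y', (PX * PZ)%type, iY, pY; split=> //; first exact: fgproj_prod.
exact: IHk sab _ _.
Qed.

Lemma fgproj_syz P : fgproj P -> fgproj (syz P).
Proof.
move=> /fgproj_syz_split[r rK].
exact: fgproj_retract rK (fgproj_freecover P).
Qed.

Lemma fgproj_syzn j P : fgproj P -> fgproj (syzn j P).
Proof. by move=> Pp; elim: j => //= j; exact: fgproj_syz. Qed.

End ProjDim.

(** * Long exact sequences of Ext *)

Section ExtSequences.
Variables (A B : pzRingType) (o : antiiso B A) (o' : antiiso A B).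
Hypothesis H : noeth_duality o o'.
Implicit Types U V X Y Z K P Q M N W : lmodType A.

Let AN : left_noetherian A. Proof. by case: H. Qed.

Lemma ext1_zeroP W : fg W -> ext_zero o 1 W <-> forall u, extends (syzi W) u.
Proof. by move=> Wfg; exact: is_e1_zero (ext1_syzi H Wfg). Qed.

Lemma ext_zeroSE j W : ext_zero o j.+1 W = ext_zero o 1 (syzn j W).
Proof. by rewrite /ext_zero extSE. Qed.

Lemma ext_fgproj j P : fgproj P -> ext_zero o j.+1 P.
Proof.
move=> /(fgproj_syzn j) Pp; rewrite ext_zeroSE; have [Pfg _] := Pp.
apply/(ext1_zeroP Pfg) => u; have [r rK] := fgproj_syz_split Pp.
by exists (u \o r) => k; rewrite /= rK.
Qed.

Lemma pd_syzn k W : fg W -> pd_lt k.+1 W -> fgproj (syzn k W).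
Proof.
elim: k W => [|k IHk] W Wfg; first by move/pd_lt1.
move=> [K [P [i [p [Pp ip Kk]]]]].
have Kfg : fg K by apply: ses_fgl AN ip _; case: Pp.
have KW := ses_syz_steqv Wfg Pp ip.
apply: steqv_fgproj (IHk K Kfg Kk) _.
exact/steqv_sym/(steqv_syznS H).
Qed.

Lemma pd_ext_zero k j W : fg W -> pd_lt k W -> (k <= j)%N -> (0 < j)%N ->
  ext_zero o j W.
Proof.
move=> Wfg Wk kj; case: j kj => // j kj _.
rewrite ext_zeroSE; apply: (@ext_fgproj 0); apply: pd_syzn => //.
exact: pd_lt_leq Wk.
Qed.

(** The sequence is a pushout of the cover of [Z] along [g : syz Z -> X].  So
    [u] extends to [Y] as soon as [u g] extends to the cover. *)
Lemma ext1_extends X Y Z (a : {linear X -> Y}) (b : {linear Y -> Z}) :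
  fg Z -> ses a b -> ext_zero o 1 Z -> forall u, extends a u.
Proof.
move=> Zfg ab /(ext1_zeroP Zfg) Z0 u; have [aI ab0 bO] := ab.
have sZ := ses_syz Zfg.
have [g [c [cE cg]]] := seqmap_exl (fgproj_freecover Z) (ses_rex sZ) ab idfun.
have [w wE] := Z0 (u \o g).
have acO : onto (copair a c).
  move=> y; have [r rE] := freecover_onto Zfg (b y).
  have /ab0[x xE] : b (y - c r) = 0 by rewrite linearB cE /= rE subrr.
  by exists (x, r); rewrite /= xE subrK.
have [v vE] : exists v : {linear Y -> A^o}, forall q, v (copair a c q) = copair u w q.
  apply: factor_onto => // -[x r] /= xr.
  have /(proj1 (ses_rex sZ))[k kE] : cover Z r = 0.
    by rewrite -[LHS](cE r) -[c r](addKr (a x)) linearD linearN (rex0 (ses_rex ab)) oppr0 xr linear0 addr0.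
  have xE : x = - g k.
    by apply: aI; rewrite linearN -cg kE; apply/eqP; rewrite -addr_eq0 xr.
  by rewrite xE linearN -kE -wE /= addNr.
by exists v => x; have := vE (x, 0); rewrite /= !linear0 !addr0.
Qed.

Section Level1.
Variables (X Y Z : lmodType A) (a : {linear X -> Y}) (b : {linear Y -> Z}).
Hypotheses (Xfg : fg X) (Yfg : fg Y) (Zfg : fg Z) (ab : ses a b).

Section Resolved.
Variables (Y' : lmodType A) (iY : {linear Y' -> (freecover X * freecover Z)%type}).
Variables (pY : {linear (freecover X * freecover Z)%type -> Y}).
Variables (a' : {linear syz X -> Y'}) (b' : {linear Y' -> syz Z}).
Hypotheses (sY : ses iY pY) (sab : ses a' b').
Hypothesis a'E : forall k, iY (a' k) = (syzi X k, 0).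
Hypothesis b'E : forall y, syzi Z (b' y) = (iY y).2.
Hypothesis pYa : forall x, pY (x, 0) = a (cover X x).

Let Yp : fgproj (freecover X * freecover Z)%type.
Proof. exact: fgproj_prod (fgproj_freecover X) (fgproj_freecover Z). Qed.

Lemma level_e1 : is_e1 o iY (ext o 1 Y).
Proof. exact (ext1P H Yfg (steqv_refl Y) Yp sY). Qed.

(** A functional on the syzygy of [Y] whose restriction to [syz X] extends to
    the cover of [X] comes, after subtracting that extension, from [syz Z]. *)
Lemma level_factor (u : {linear Y' -> A^o}) : extends (syzi X) (u \o a') ->
  exists (w : {linear freecover X -> A^o}) (t : {linear syz Z -> A^o}),
    forall y, t (b' y) = u y - w (iY y).1.
Proof.
move=> [w wE]; exists w.
apply: (factor_onto (f := u \- (w \o fst \o iY))); first by case: sab.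
by case: sab => _ E _ y /E[k <-] /=; rewrite a'E /= -wE subrr.
Qed.

Lemma level_extends (u : {linear Y' -> A^o}) : extends (syzi X) (u \o a') ->
  (forall v, extends (syzi Z) v) -> extends iY u.
Proof.
move=> /level_factor[w [t tE]] /(_ t)[v vE]; exists (copair w v) => y /=.
by rewrite -b'E -vE tE /= addrC subrK.
Qed.

(** Injectivity of Ext^1 of [Z] in Ext^1 of [Y] when functionals of [X] extend
    to [Y]: an extension of [v b'] to the cover of [Y] restricts to a
    functional on [X]; subtracting an extension of the latter to [Y] leaves a
    functional on the cover of [Z]. *)
Lemma level_inj : (forall u, extends a u) ->
  forall v : {linear syz Z -> A^o}, extends iY (v \o b') -> extends (syzi Z) v.
Proof.
move=> aA v [w wE].
have [t tE] : exists t : {linear X -> A^o}, forall x, t (cover X x) = (w \o inl_map _ _) x.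
  apply: factor_onto; first exact: freecover_onto.
  move=> x /(proj1 (ses_rex (ses_syz Xfg)))[k <-].
  by rewrite /= /pair_map /= -a'E -wE /= (rex0 (ses_rex sab)) linear0.
have [t' t'E] := aA t.
exists ((w \o inr_map _ _) \- (t' \o pY \o inr_map _ _)) => k.
have [y <-] : exists y, b' y = k by case: sab => _ _.
have pY0 : pY (iY y) = 0 by exact: rex0 (ses_rex sY) y.
rewrite [LHS]wE /= /pair_map /= b'E.
case: (iY y) pY0 => x r /= pY0.
rewrite copair_decomp pYa in pY0.
rewrite copair_decomp; have := tE x; rewrite /= /pair_map /= => <-.
rewrite t'E addrC; congr (_ + _).
by apply/eqP; rewrite -addr_eq0 -linearD pY0 linear0.
Qed.

End Resolved.

Lemma level_data :
  exists (Y' : lmodType A) (iY : {linear Y' -> (freecover X * freecover Z)%type})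
    (pY : {linear (freecover X * freecover Z)%type -> Y})
    (a' : {linear syz X -> Y'}) (b' : {linear Y' -> syz Z}),
  [/\ ses iY pY, ses a' b', forall k, iY (a' k) = (syzi X k, 0),
        forall y, syzi Z (b' y) = (iY y).2
      & forall x, pY (x, 0) = a (cover X x)].
Proof.
have [Y' [iY [pY [a' [b' [sY sab a'E b'E [pYa _]]]]]]] :=
  horseshoe ab (ses_syz Xfg) (ses_syz Zfg) (fgproj_freecover Z).
by exists Y', iY, pY, a', b'.
Qed.

Lemma ext1_mid : ext_zero o 1 X -> ext_zero o 1 Z -> ext_zero o 1 Y.
Proof.
move=> /(ext1_zeroP Xfg) X0 /(ext1_zeroP Zfg) Z0.
have [Y' [iY [pY [a' [b' [sY sab a'E b'E pYa]]]]]] := level_data.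
by apply/(is_e1_zero (level_e1 sY)) => u; apply: level_extends sab a'E b'E _ (X0 _) Z0.
Qed.

Lemma ext1_right0 : (forall u, extends a u) -> ext_zero o 1 Y -> ext_zero o 1 Z.
Proof.
move=> aA Y0; have [Y' [iY [pY [a' [b' [sY sab a'E b'E pYa]]]]]] := level_data.
have {}Y0 := (is_e1_zero (level_e1 sY)).1 Y0.
by apply/(ext1_zeroP Zfg) => v; apply: (level_inj sY sab a'E b'E pYa).
Qed.

Lemma ext1_right_iso : (forall u, extends a u) -> ext_zero o 1 X ->
  isom (ext o 1 Z) (ext o 1 Y).
Proof.
move=> aA /(ext1_zeroP Xfg) X0.
have [Y' [iY [pY [a' [b' [sY sab a'E b'E pYa]]]]]] := level_data.
have [f [fO fE]] := level_e1 sY.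
apply: is_e1_isom (ext1_syzi H Zfg) _; exists (f \o dualmap o b'); split.
  move=> y; have [u <-] := fO y.
  have [w [t tE]] := level_factor sab a'E (X0 (u \o a')).
  exists t; apply/subr0_eq; rewrite /= -linearB; apply/fE.
  exists (\- (w \o fst)) => k.
  by rewrite -[LHS]/(t (b' k) - u k) tE addrAC subrr add0r.
move=> v; rewrite /= fE; split; first exact: (level_inj sY sab a'E b'E pYa).
by move=> [w wE]; exists (w \o snd) => y; rewrite /= -b'E -wE.
Qed.

Lemma ext1_left : ext_zero o 1 Y -> ext_zero o 1 (syz Z) -> ext_zero o 1 X.
Proof.
move=> Y0 Z0; have [Y' [iY [pY [a' [b' [sY sab a'E b'E pYa]]]]]] := level_data.
have {}Y0 := (is_e1_zero (level_e1 sY)).1 Y0.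
apply/(ext1_zeroP Xfg) => u.
have [v vE] := ext1_extends (fg_syz Z AN) sab Z0 u; have [w wE] := Y0 v.
by exists (w \o inl_map _ _) => k; rewrite vE wE a'E.
Qed.

Lemma ext1_left_iso : ext_zero o 1 Z -> ext_zero o 1 (syz Z) ->
  isom (ext o 1 Y) (ext o 1 X).
Proof.
move=> /(ext1_zeroP Zfg) Z0 Z1.
have [Y' [iY [pY [a' [b' [sY sab a'E b'E pYa]]]]]] := level_data.
apply: is_e1_isom (level_e1 sY) _.
have [f [fO fE]] := ext1_syzi H Xfg.
exists (f \o dualmap o a'); split.
  move=> y; have [u <-] := fO y.
  have [v vE] := ext1_extends (fg_syz Z AN) sab Z1 u; exists v.
  by rewrite /=; congr (f _); apply: dual_ext => x; rewrite vE.
move=> u; rewrite /= fE; split=> [ue|[w wE]].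
  exact: level_extends sab a'E b'E _ ue Z0.
by exists (w \o inl_map _ _) => k; rewrite /dualmap /= wE a'E.
Qed.

(** Surjectivity of Ext^j of [Y] onto Ext^j of [X], for [j = 0], and a
    sufficient condition for it otherwise.  It is what makes functionals
    extend along the inclusion of [j]-th syzygies. *)
Definition lifting (j : nat) : Prop :=
  if j is 0 then forall u, extends a u else ext_zero o j X.

(** The syzygies of a short exact sequence form one, up to stable equivalence,
    so the whole long exact sequence is reduced to the degrees 0 and 1. *)
Lemma syzygy_sequence j : exists (Xj Yj Zj : lmodType A)
    (aj : {linear Xj -> Yj}) (bj : {linear Yj -> Zj}),
  [/\ ses aj bj, [/\ fg Xj, fg Yj & fg Zj],
     [/\ steqv Xj (syzn j X), steqv Yj (syzn j Y) & steqv Zj (syzn j Z)]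
   & lifting j -> forall u, extends aj u].
Proof.
elim: j => [|j [Xj [Yj [Zj [aj [bj [sj [Xf Yf Zf] [Xs Ys Zs] _]]]]]]].
  by exists X, Y, Z, a, b; split=> //; split=> //; exact: steqv_refl.
have [Yk [iY [pY [ak [bk [sY sk akE bkE [pYa pYb]]]]]]] :=
  horseshoe sj (ses_syz Xf) (ses_syz Zf) (fgproj_freecover Zj).
have Yp := fgproj_prod (fgproj_freecover Xj) (fgproj_freecover Zj).
exists (syz Xj), Yk, (syz Zj), ak, bk; split=> //.
- split; [exact: fg_syz | | exact: fg_syz].
  by apply: ses_fgl AN sY _; case: Yp.
- split; try by apply: steqv_syz => //; exact: fg_syzn.
  apply: steqv_trans (ses_syz_steqv Yf Yp sY) _.
  by apply: steqv_syz => //; exact: fg_syzn.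
move=> Xz u; have Xj0 : ext_zero o 1 (syzn j X) by rewrite -ext_zeroSE.
have /(ext1_zeroP Xf)/(_ u)[w wE] : ext_zero o 1 Xj.
  apply: isom_zero Xj0; apply: (ext1_steqv H) => //; first exact: fg_syzn.
  exact: steqv_sym.
by exists (w \o fst \o iY) => k; rewrite /= akE -wE.
Qed.

End Level1.

Lemma level_isom j W V : fg W -> fg V -> steqv V (syzn j W) ->
  isom (ext o 1 V) (ext o j.+1 W).
Proof.
by move=> Wfg Vfg VW; rewrite (extSE o j W); apply: (ext1_steqv H Vfg _ VW); exact: fg_syzn.
Qed.

Lemma level_isom2 j W V : fg W -> fg V -> steqv V (syzn j W) ->
  isom (ext o 1 (syz V)) (ext o j.+2 W).
Proof.
move=> Wfg Vfg VW; apply: level_isom => //; first exact: fg_syz.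
by apply: steqv_syz => //; exact: fg_syzn.
Qed.

Section LongExact.
Variables (X Y Z : lmodType A) (a : {linear X -> Y}) (b : {linear Y -> Z}).
Hypotheses (Xfg : fg X) (Yfg : fg Y) (Zfg : fg Z) (ab : ses a b).
Variable j : nat.

Lemma ext_mid : ext_zero o j.+1 X -> ext_zero o j.+1 Z -> ext_zero o j.+1 Y.
Proof.
have [Xj [Yj [Zj [aj [bj [sj [Xf Yf Zf] [Xs Ys Zs] _]]]]]] := syzygy_sequence Xfg Yfg Zfg ab j.
move=> /(isom_zero (isom_sym (level_isom Xfg Xf Xs))) X0.
move=> /(isom_zero (isom_sym (level_isom Zfg Zf Zs))) Z0.
apply: (isom_zero (level_isom Yfg Yf Ys)).
exact: ext1_mid sj X0 Z0.
Qed.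

Lemma ext_left : ext_zero o j.+1 Y -> ext_zero o j.+2 Z -> ext_zero o j.+1 X.
Proof.
have [Xj [Yj [Zj [aj [bj [sj [Xf Yf Zf] [Xs Ys Zs] _]]]]]] := syzygy_sequence Xfg Yfg Zfg ab j.
move=> /(isom_zero (isom_sym (level_isom Yfg Yf Ys))) Y0.
move=> /(isom_zero (isom_sym (level_isom2 Zfg Zf Zs))) Z0.
apply: (isom_zero (level_isom Xfg Xf Xs)).
exact: ext1_left sj Y0 Z0.
Qed.

Lemma ext_right0 : lifting a j -> ext_zero o j.+1 Y -> ext_zero o j.+1 Z.
Proof.
have [Xj [Yj [Zj [aj [bj [sj [Xf Yf Zf] [Xs Ys Zs] aA]]]]]] := syzygy_sequence Xfg Yfg Zfg ab j.
move=> /aA{}aA /(isom_zero (isom_sym (level_isom Yfg Yf Ys))) Y0.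
apply: (isom_zero (level_isom Zfg Zf Zs)).
exact: ext1_right0 sj aA Y0.
Qed.

Lemma ext_right_iso : lifting a j -> ext_zero o j.+1 X ->
  isom (ext o j.+1 Z) (ext o j.+1 Y).
Proof.
have [Xj [Yj [Zj [aj [bj [sj [Xf Yf Zf] [Xs Ys Zs] aA]]]]]] := syzygy_sequence Xfg Yfg Zfg ab j.
move=> /aA{}aA /(isom_zero (isom_sym (level_isom Xfg Xf Xs))) X0.
apply: isom_trans (isom_sym (level_isom Zfg Zf Zs)) _.
apply: isom_trans (level_isom Yfg Yf Ys).
exact: ext1_right_iso sj aA X0.
Qed.

Lemma ext_left_iso : ext_zero o j.+1 Z -> ext_zero o j.+2 Z ->
  isom (ext o j.+1 Y) (ext o j.+1 X).
Proof.
have [Xj [Yj [Zj [aj [bj [sj [Xf Yf Zf] [Xs Ys Zs] _]]]]]] := syzygy_sequence Xfg Yfg Zfg ab j.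
move=> /(isom_zero (isom_sym (level_isom Zfg Zf Zs))) Z0.
move=> /(isom_zero (isom_sym (level_isom2 Zfg Zf Zs))) Z1.
apply: isom_trans (isom_sym (level_isom Yfg Yf Ys)) _.
apply: isom_trans (level_isom Xfg Xf Xs).
exact: ext1_left_iso sj Z0 Z1.
Qed.

End LongExact.

End ExtSequences.

(** * The transpose and its syzygies *)

Section Transpose.
Variables (A B : pzRingType) (o : antiiso B A) (o' : antiiso A B).
Hypothesis H : noeth_duality o o'.
Implicit Types U V X Y Z K P Q M N W : lmodType A.

Let H' : noeth_duality o' o. Proof. exact: noeth_duality_sym. Qed.
Let AN : left_noetherian A. Proof. by case: H. Qed.
Let BN : left_noetherian B. Proof. by case: H. Qed.

Lemma dualE M N (g : {linear M -> N}) (u : dual o N) x :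
  ((dualmap o g : {linear _ -> _}) u : dual o M) x = u (g x).
Proof. by []. Qed.

Lemma pres_mapE W x : pres_map W x = syzi W (cover (syz W) x).
Proof. by []. Qed.

Lemma tr_fg W : fg (tr o W).
Proof.
apply: (@fg_onto _ _ _ (quotproj _)); first exact: quotproj_onto.
by have [] := dual_fgproj H (fgproj_freecover (syz W)).
Qed.

Lemma cover_syzi W x : fg W -> cover W (syzi W x) = 0.
Proof. by move=> Wfg; rewrite (rex0 (ses_rex (ses_syz Wfg))). Qed.

Definition trq W : {linear dual o (freecover (syz W)) -> tr o W} :=
  quotproj (linimg (dualmap o (pres_map W))).

Lemma rex_pres W : fg W -> rex (pres_map W) (cover W).
Proof.
move=> Wfg; have sO := freecover_onto (fg_syz W AN).
have [_ iE iO] := ses_syz Wfg; split=> // y; rewrite iE.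
split=> [[k <-]|[x <-]]; last by exists (cover _ x).
by have [x <-] := sO k; exists x.
Qed.

Lemma rex_trq W : rex (dualmap o (pres_map W)) (trq W).
Proof. exact: rex_quot. Qed.

(** By reflexivity a functional on [dual o P1], with [P1] the cover of
    [syz W], is evaluation at an element [x] of [P1].  If it vanishes on the
    image of [dual o P0], then [x] is a relation, hence in the image of the
    next map of the resolution. *)
Lemma tr_functional W (v : {linear tr o W -> B^o}) : fg W ->
  exists z, forall f : dual o (freecover (syz W)),
    v (trq W f) = o' (f (pres_map (syz W) z)).
Proof.
move=> Wfg; have Sfg := fg_syz W AN.
have [x xE] := bidual_onto H (v \o trq W) (fgproj_freecover (syz W)).
have x0 : pres_map W x = 0.
  refine (@dual_separated _ _ o (freecover W) _ (fgproj_freecover W) _) => w.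
  apply: (o'_eq0 H); have := xE (dualmap o (pres_map W) w).
  rewrite -[RHS]/(o' (w (pres_map W x))) => <- /=.
  by rewrite (rex0 (rex_trq W)) linear0.
have /(rex_pres Sfg).1[z zE] : cover (syz W) x = 0.
  have [iI _ _] := ses_syz Wfg.
  by apply: iI; rewrite linear0 -pres_mapE.
by exists z => f; rewrite zE -xE.
Qed.

(** Dualizing the free resolution of [W] gives maps [d0] and [d1] with
    [d1 d0 = 0]; [tr W] is the cokernel of [d0] and [tr (syz W)] that of [d1].
    So [d1] induces a map on [tr W] with kernel [ext o 1 W] and cokernel
    [tr (syz W)], and [D] is its image. *)
Lemma tr_seq W : exists (j : {linear ext o 1 W -> tr o W}) (D : lmodType B)
    (q : {linear tr o W -> D})
    (i : {linear D -> dual o (freecover (syz (syz W)))})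
    (p : {linear dual o (freecover (syz (syz W))) -> tr o (syz W)}),
  [/\ ses j q, ses i p
    & forall f : dual o (freecover (syz W)),
      i (q (quotproj _ f)) = dualmap o (pres_map (syz W)) f].
Proof.
rewrite (ext_oneE o 0 W); change (syzn 0 W) with W.
set d0 := dualmap o (pres_map W); set d1 := dualmap o (pres_map (syz W)).
have dd f : d1 (d0 f) = 0.
  apply: dual_ext => x; rewrite !dualE.
  by rewrite !pres_mapE cover_syzi ?linear0//; exact: fg_syz.
have [b bE] : exists b : {linear tr o W -> dual o (freecover (syz (syz W)))},
    forall f, b (quotproj (linimg d0) f) = d1 f.
  apply: factor_onto => [|f /quotproj0/mem_linimg[g <-]]; last exact: dd.
  exact: quotproj_onto.
have [D [q [i [qO iI qE]]]] := img_ex b.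
have [j jE] : exists j : {linear ext_one o W -> tr o W},
    forall z, j (quotproj _ z) = (quotproj (linimg d0) \o @subincl _ _ (linker d1)) z.
  apply: factor_onto => [|z]; first exact: quotproj_onto.
  by move=> /quotproj0 z0; apply/quotproj0.
exists j, D, q, i, (quotproj (linimg d1)); split; last by move=> f; rewrite qE bE.
- split=> //.
  + apply: linear_inj0 => x; case: (quotprojP x) => z ->.
    by rewrite jE => /quotproj0 z0; apply/quotproj0.
  + move=> y; case: (quotprojP y) => f ->; split.
      move=> q0; have f0 : d1 f = 0 by rewrite -bE -qE q0 linear0.
      have /subinclP[z zE] : f \in linker d1 by apply/eqP.
      by exists (quotproj _ z); rewrite jE /= zE.
    move=> [x <-]; case: (quotprojP x) => z ->; apply: iI.
    by rewrite jE qE /= bE linear0; apply/eqP/(subincl_mem z).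
- split=> //; last exact: quotproj_onto.
  move=> f; split.
    move=> /quotproj0/mem_linimg[g gE].
    by exists (q (quotproj _ g)); rewrite qE bE.
  move=> [z <-]; apply/quotproj0; have [y <-] := qO z; rewrite qE.
  by case: (quotprojP y) => g ->; rewrite bE; apply/mem_linimg; exists g.
Qed.

(** A functional on [D] restricts to [tr W] as evaluation of [d1] at some [z]
    ([tr_functional]), and evaluation at [z] is defined on the whole
    projective that contains [D]. *)
Lemma ext1_tr_syz W : fg W -> ext_zero o' 1 (tr o (syz W)).
Proof.
move=> Wfg; have [j [D [q [i [p [jq ip iqE]]]]]] := tr_seq W.
have Fp := dual_fgproj H (fgproj_freecover (syz (syz W))).
apply/(is_e1_zero (ext1P H' (tr_fg _) (steqv_refl _) Fp ip)) => u.
have [z zE] := tr_functional (u \o q) Wfg; have [e eE] := ev_ex H z.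
exists e => d; have [t <-] : exists t, q t = d by case: jq => _ _.
by case: (quotprojP t) => f ->; rewrite iqE eE dualE; exact: zE f.
Qed.

End Transpose.

(** * Grade and torsionless modules *)

Section Grade.
Variables (A B : pzRingType) (o : antiiso B A) (o' : antiiso A B).
Hypothesis H : noeth_duality o o'.
Implicit Types U V X Y Z K P Q M N W : lmodType A.

Let H' : noeth_duality o' o. Proof. exact: noeth_duality_sym. Qed.
Let AN : left_noetherian A. Proof. by case: H. Qed.
Let BN : left_noetherian B. Proof. by case: H. Qed.

Lemma grade_zero k j (E : lmodType B) :
  grade_ge o' k E -> (j < k)%N -> ext_zero o' j E.
Proof. by move=> Eg jk; apply: contrapT => /Eg; rewrite leqNgt jk. Qed.

Lemma grade_geP k (E : lmodType B) :
  (forall j, (j < k)%N -> ext_zero o' j E) -> grade_ge o' k E.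
Proof. by move=> E0 j; apply: contra_notT; rewrite -ltnNge; exact: E0. Qed.

Lemma grade_geW k l (E : lmodType B) :
  (l <= k)%N -> grade_ge o' k E -> grade_ge o' l E.
Proof. by move=> lk Ek j /Ek; exact: leq_trans. Qed.

Lemma ext_zero_isom j (E E' : lmodType B) :
  fg E -> isom E E' -> ext_zero o' j E -> ext_zero o' j E'.
Proof.
move=> Efg EE'; have E'fg := isom_fg EE' Efg.
case: j => [|j]; last first.
  exact: (isom_zero (ext_steqv H' j Efg E'fg (isom_steqv EE'))).
move=> /(ext0P H' Efg) E0; apply/(ext0P H' E'fg) => u.
have [f [_ fO]] := EE'; apply: dual_ext => x; have [y <-] := fO x.
by have := congr1 (fun w : dual o' E => w y) (E0 (u \o f)).
Qed.

Lemma grade_isom k (E E' : lmodType B) :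
  fg E -> isom E E' -> grade_ge o' k E -> grade_ge o' k E'.
Proof.
move=> Efg EE' Ek; apply: grade_geP => j jk.
by apply: ext_zero_isom EE' _ => //; exact: grade_zero jk.
Qed.

Lemma grade_of_zero k (E : lmodType B) : (forall x : E, x = 0) -> grade_ge o' k E.
Proof.
move=> E0; have Efg := fg_trivial E0; apply: grade_geP => -[|j] _.
  by apply/(ext0P H' Efg) => u; apply: dual_ext => x; rewrite (E0 x) linear0.
by apply: (ext_fgproj H'); apply/pd_lt1; exact: pd_ltS.
Qed.

(** The presentation of a projective splits, hence also its dual. *)
Lemma fgproj_tr P : fgproj P -> fgproj (tr o P).
Proof.
move=> Pp; have [Pfg _] := Pp; have Sp := fgproj_syz Pp; have [Sfg _] := Sp.
have [r rK] := fgproj_syz_split Pp.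
have [t tE] := proj_lift idfun Sp (freecover_onto Sfg).
have [h hE] : exists h : {linear tr o P -> dual o (freecover (syz P))},
    forall f, h (quotproj _ f) = (idfun \- dualmap o (t \o cover _)) f.
  apply: factor_onto; first exact: quotproj_onto.
  move=> f /quotproj0/mem_linimg[u <-]; apply: dual_ext => x.
  rewrite -[LHS]/(u (pres_map P x) - u (pres_map P (t (cover _ x)))).
  by rewrite !pres_mapE tE subrr.
apply: (fgproj_retract (r := quotproj _) (s := h)) (dual_fgproj H (fgproj_freecover (syz P))) => y.
case: (quotprojP y) => f ->; rewrite hE; apply/eqP.
rewrite quotproj_eq /= addrC addKr; apply/mem_linimg.
pose w : {linear freecover P -> A^o} := f \o t \o r.
exists (- (w : dual o (freecover P))); apply: dual_ext => x; rewrite dualE.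
by rewrite pres_mapE -[LHS]/(- f (t (r (syzi P (cover _ x))))) rK.
Qed.

(** Evaluation at a preimage [x] of [y] is well defined on the image of [d0],
    because the kernel of [d0] consists of the functionals on [Y], all of
    which kill [y].  As Ext^1 of the transpose vanishes it extends; by
    reflexivity the extension is evaluation at an element whose image is [x],
    so [x] is a relation and [y = 0]. *)
Lemma torsionless_of_ext Y : fg Y -> ext_zero o' 1 (tr o Y) ->
  forall y, (forall u : dual o Y, u y = 0) -> y = 0.
Proof.
move=> Yfg; set d0 := dualmap o (pres_map Y).
have Fp := dual_fgproj H (fgproj_freecover (syz Y)).
have [D [r [i [rO iI rE]]]] := img_ex d0.
have ip : ses i (quotproj (linimg d0)).
  split=> //; last exact: quotproj_onto.
  move=> f; rewrite quotproj0; split=> [/mem_linimg[g gE]|[d <-]].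
    by exists (r g); rewrite rE.
  by have [g <-] := rO d; apply/mem_linimg; exists g; rewrite rE.
move=> /(is_e1_zero (ext1P H' (tr_fg H _) (steqv_refl _) Fp ip)) ext y y0.
have [x xE] := freecover_onto Yfg y.
have [e eE] := ev_ex H x.
have [u uE] : exists u : {linear D -> B^o}, forall f, u (r f) = e f.
  apply: factor_onto => // f r0.
  have f0 k : f (syzi Y k) = 0.
    have [k' <-] := freecover_onto (fg_syz Y AN) k.
    have := rE f; rewrite r0 linear0 => /(congr1 (fun w : dual o _ => w k')).
    by move=> /esym.
  have [g gE] : exists g : {linear Y -> A^o}, forall z, g (cover Y z) = f z.
    apply: factor_onto; first exact: freecover_onto.
    by move=> z /(proj1 (ses_rex (ses_syz Yfg)))[k <-].
  by rewrite eE -gE xE (y0 g) (anti0 o').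
have [v vE] := ext u.
have [z zE] := bidual_onto H v (fgproj_freecover (syz Y)).
rewrite -xE (_ : x = pres_map Y z) ?pres_mapE ?cover_syzi//.
apply/subr0_eq; refine (@dual_separated _ _ o (freecover Y) _ (fgproj_freecover Y) _) => w.
apply: (o'_eq0 H); rewrite linearB antiB -eE -uE vE rE zE.
by rewrite -[X in X - _]/(o' (w (pres_map Y z))) subrr.
Qed.

(** Induction on [n] with the sequences of [tr_seq] for [syzn n W]: Ext^(p+1)
    of the transpose of the next syzygy is Ext^p of [D], and this vanishes
    because Ext^p of [tr (syzn n W)] does and because the grade of
    [ext o n.+1 W] is at least [n]. *)
Lemma ext_tr_syzn n W : fg W ->
  (forall k, (1 <= k <= n)%N -> grade_ge o' k.-1 (ext o k W)) ->
  forall p, (1 <= p <= n)%N -> ext_zero o' p (tr o (syzn n W)).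
Proof.
move=> Wfg; elim: n => [|n IHn] Wg p; first by case: p.
have Vfg : fg (syzn n W) by exact: fg_syzn.
case: p => // -[|p] /andP[_ pn]; first exact: ext1_tr_syz.
have [j [D [q [i [r [jq ir irE]]]]]] := tr_seq H (syzn n W).
have Fp := dual_fgproj H (fgproj_freecover (syz (syz (syzn n W)))).
apply: (isom_zero (ext_shift H' p (tr_fg H _) Fp ir)).
have Tfg := tr_fg H (syzn n W).
have Dfg : fg D by apply: (fg_onto (f := q)) Tfg; case: jq.
have Efg := ext_fg H 1 Vfg.
apply: (ext_right0 H' Efg Tfg Dfg jq); last first.
  by apply: IHn => // k /andP[k0 kn]; apply: Wg; rewrite k0 leqW.
have Eg : grade_ge o' n (ext o 1 (syzn n W)).
  by rewrite -extSE; apply: (Wg n.+1); rewrite ltnSn.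
have := grade_zero Eg pn; case: p {pn} => [|p] //.
move=> /(ext0P H' Efg) E0 u; exists \0 => k.
exact: (congr1 (fun w : dual o' _ => w k) (E0 u)).
Qed.

(** If [syz W] is projective then so is [D], and a functional on [ext o 1 W]
    extends to [tr W].  There it factors through [d1] ([tr_functional]), which
    vanishes on [ext o 1 W]. *)
Lemma hom_ext_pd W : fg W -> fgproj (syz W) -> ext_zero o' 0 (ext o 1 W).
Proof.
move=> Wfg Sp; have Sfg := fg_syz W AN.
have [j [D [q [i [r [jq ir irE]]]]]] := tr_seq H W.
have Fp := dual_fgproj H (fgproj_freecover (syz (syz W))).
have Dp : fgproj D.
  apply: steqv_fgproj (fgproj_syz (fgproj_tr Sp)) _.
  exact: ses_syz_steqv (tr_fg H _) Fp ir.
apply/(ext0P H' (ext_fg H 1 Wfg)) => u; have [Dfg _] := Dp.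
have [v vE] := ext1_extends H' Dfg jq (ext_fgproj H' Dp) u.
have [z zE] := tr_functional H v Wfg.
apply: dual_ext => e; rewrite vE; case: (quotprojP (j e)) => f fE.
rewrite fE [LHS](zE f) -dualE.
have : dualmap o (pres_map (syz W)) f = 0.
  by rewrite -irE -fE (rex0 (ses_rex jq)) linear0.
by move=> f0; exact: (etrans (congr1 (fun w : dual o _ => o' (w z)) f0) (anti0 o')).
Qed.

(** For [W = syzn i.-1 Y] the module [D] of [tr_seq] is projective, so Ext^p
    of [ext o i Y] is Ext^p of the transpose for [p > 0], and vanishes by
    [ext_tr_syzn]; the case [p = 0] is [hom_ext_pd]. *)
Lemma grade_top i Y : fg Y -> pd_le i Y -> (0 < i)%N ->
  (forall j, (1 <= j < i)%N -> grade_ge o' j.-1 (ext o j Y)) ->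
  grade_ge o' i (ext o i Y).
Proof.
case: i => // n Yfg Ypd _ Yg; have Wfg : fg (syzn n Y) by exact: fg_syzn.
have Sp : fgproj (syz (syzn n Y)) by exact: (pd_syzn H (k := n.+1)).
rewrite (extSE o n Y); apply: grade_geP => -[|p] pn; first exact: hom_ext_pd.
have [j [D [q [i [r [jq ir irE]]]]]] := tr_seq H (syzn n Y).
have Fp := dual_fgproj H (fgproj_freecover (syz (syz (syzn n Y)))).
have Dp : fgproj D.
  apply: steqv_fgproj (fgproj_syz (fgproj_tr Sp)) _.
  exact: ses_syz_steqv (tr_fg H _) Fp ir.
have [Dfg _] := Dp.
apply: (ext_left H' (ext_fg H 1 Wfg) (tr_fg H _) Dfg jq).
  by apply: ext_tr_syzn => // k /andP[k0 kn]; apply: Yg; rewrite k0.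
exact: (ext_fgproj H' Dp).
Qed.

(** By [torsionless_of_ext] it is enough that Ext^1 of [tr Y] vanishes.  By
    [tr_seq] Ext^(k+1) of [tr (syzn k Y)] vanishes if Ext^(k+1) of
    [ext o k.+1 Y] and Ext^(k+2) of [tr (syzn k.+1 Y)] do; the former does by
    the grades, and the descent ends at the projective [syzn m Y]. *)
Lemma torsionless_of_grade m Y : fg Y -> pd_le m Y ->
  (forall j, (1 <= j <= m)%N -> grade_ge o' j.+1 (ext o j Y)) ->
  forall y, (forall u : dual o Y, u y = 0) -> y = 0.
Proof.
move=> Yfg Ypd Yg; apply: torsionless_of_ext => //.
suff S d k : (d + k = m)%N -> ext_zero o' k.+1 (tr o (syzn k Y)).
  by have := S m 0 (addn0 m).
elim: d k => [|d IHd] k.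
  by rewrite add0n => ->; apply: (ext_fgproj H'); apply: fgproj_tr; exact: (pd_syzn H).
rewrite addSnnS => dk; have Wfg : fg (syzn k Y) by exact: fg_syzn.
have [j [D [q [i [r [jq ir irE]]]]]] := tr_seq H (syzn k Y).
have Fp := dual_fgproj H (fgproj_freecover (syz (syz (syzn k Y)))).
have Tfg := tr_fg H (syzn k Y).
have Dfg : fg D by apply: (fg_onto (f := q)) Tfg; case: jq.
apply: (ext_mid H' (ext_fg H 1 Wfg) Tfg Dfg jq).
  rewrite -extSE; apply: grade_zero (Yg k.+1 _) _ => //.
  by rewrite -dk leq_addl.
by apply: (isom_zero (isom_sym (ext_shift H' k (tr_fg H _) Fp ir))); exact: IHd.
Qed.

End Grade.

(** * AB approximations and origin extensions *)

Section Approximations.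
Variables (A B : pzRingType) (o : antiiso B A) (o' : antiiso A B).
Hypothesis H : noeth_duality o o'.
Implicit Types U V X Y Z K P Q M N W : lmodType A.

Let H' : noeth_duality o' o. Proof. exact: noeth_duality_sym. Qed.
Let AN : left_noetherian A. Proof. by case: H. Qed.

Lemma rep_by_monosP X M (f : {linear X -> M}) :
  rep_by_monos f <-> exists Q (t : {linear X -> Q}),
    fgproj Q /\ forall x, f x = 0 -> t x = 0 -> x = 0.
Proof.
split=> [[P [Q [s [t [u [Pp Qp I]]]]]]|[Q [t [Qp ft]]]].
  exists Q, t; split=> // x fx tx.
  have /I[] // : (f (x, 0 : P).1 + s (x, 0 : P).2, t (x, 0 : P).1 + u (x, 0 : P).2)
       = (f (0 : X, 0 : P).1 + s (0 : X, 0 : P).2, t (0 : X, 0 : P).1 + u (0 : X, 0 : P).2).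
  by rewrite /= fx tx !linear0.
exists 'rV[A]_0, Q, \0, t, \0; split=> //; first exact: fgproj_row.
move=> [x p] [y q] /= []; rewrite !addr0 => fxy txy.
congr (_, _); last by rewrite [LHS]thinmx0 [RHS]thinmx0.
by apply/subr0_eq/ft; rewrite linearB ?fxy ?txy subrr.
Qed.

Lemma rep_by_monos_approx X M Q (f : {linear X -> M}) (s : {linear X -> Q}) :
  left_proj_approx s -> rep_by_monos f -> forall x, f x = 0 -> s x = 0 -> x = 0.
Proof.
move=> [_ sA] /rep_by_monosP[P [t [Pp ft]]] x fx sx; apply: ft => //.
by have [k ->] := sA P t Pp; rewrite sx linear0.
Qed.

(** The kernel of [(f, s)] is zero because every map to a projective factors
    through [s].  As [f] is onto, [P] maps onto the cokernel [Y], with kernel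
    [Z]; this is the resolution that bounds the projective dimension of
    [Y]. *)
Lemma origin_of_approx n M Z X P (g : {linear Z -> X}) (f : {linear X -> M})
    (s : {linear X -> P}) :
  AB_approx o n g f -> rep_by_monos f -> left_proj_approx s ->
  injective (pair_map f s) /\
  origin_ext o n (pair_map f s) (quotproj (linimg (pair_map f s))).
Proof.
move=> [Zfg Xfg gf Zn Xn] fm sA; have [Pp _] := sA; have [Pfg _] := Pp.
have inj0 := rep_by_monos_approx sA fm.
have I : injective (pair_map f s).
  by apply: linear_inj0 => x [fx sx]; exact: inj0.
have Mfg : fg M by apply: (fg_onto (f := f)) Xfg; case: gf.
have [gI fE fO] := gf.
set q := quotproj (linimg (pair_map f s)).
have q0 y : q y = 0 <-> exists x, pair_map f s x = y.
  by rewrite quotproj0; split=> /mem_linimg.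
split=> //; split=> //.
- by apply: (fg_onto (f := q)); [exact: quotproj_onto | exact: fg_prod].
- by split=> //; exact: quotproj_onto.
split=> //; exists Z, P, (s \o g), (q \o inr_map M P); split=> //; split.
- apply: linear_inj0 => z /= sgz; apply: gI; rewrite linear0.
  by apply: inj0 => //; apply/fE; exists z.
- move=> y; rewrite [X in X <-> _](q0 (0, y)); split=> [[x [fx sx]]|[z <-]].
    by have /fE[z zE] := fx; exists z; rewrite /= zE.
  by exists (g z); congr (_, _); apply/fE; exists z.
- move=> w; case: (quotprojP w) => -[m y] ->; have [x xE] := fO m.
  exists (y - s x); apply/subr0_eq; rewrite /= -linearB; apply/q0.
  exists (- x); rewrite /pair_map !linearN xE; congr (_, _); rewrite /= ?add0r //.
  by rewrite addrAC subrr add0r.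
Qed.

(** Let [e : F -> Y] be a map from a projective onto [Y], with kernel [K].
    The pullback [X'] of [M -> Y] and [e] maps onto [M] with kernel [K] and
    embeds in [M * F].  Its Ext groups vanish by comparison with the pullback
    [E] of [M * P -> Y] and [e]: the projection of [E] to [F] has kernel [X],
    and that to [P] has kernel [X']. *)
Lemma approx_of_origin n M X P Y (f : {linear X -> (M * P)%type})
    (g : {linear (M * P)%type -> Y}) : fg M -> origin_ext o n f g ->
  exists (Z X' : lmodType A) (g' : {linear Z -> X'}) (f' : {linear X' -> M}),
    AB_approx o n g' f' /\ rep_by_monos f'.
Proof.
move=> Mfg [Xfg Pp Yfg fg_ [[K [F [i [e [Fp ie Kn]]]]] Xn]].
have [Pfg _] := Pp; have [Ffg _] := Fp.
have [iI eE eO] := ie; have [fI gE gO] := fg_.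
(* Pullbacks as kernels: [X'] inside [M * F] and [E] inside [(M * P) * F]. *)
have hO : onto (copair (g \o inl_map M P) (\- e)).
  by move=> y; have [r <-] := eO y; exists (0, - r); rewrite /= linearN opprK linear0 add0r.
have [X' [a aS]] := ker_ex hO; have [aI aE _] := aS.
have kO : onto (copair g (\- e)).
  by move=> y; have [r <-] := eO y; exists (0, - r); rewrite /= linearN opprK linear0 add0r.
have [E [c cS]] := ker_ex kO; have [cI cE _] := cS.
have X'fg : fg X' by apply: ses_fgl AN aS _; exact: fg_prod.
have Efg : fg E by apply: ses_fgl AN cS _; do 2!apply: fg_prod => //.
have Kfg : fg K by apply: ses_fgl AN ie _.
have aP m r : (exists x, a x = (m, r)) <-> g (m, 0) = e r.
  rewrite -aE /=; split=> [/eqP|->]; last by rewrite subrr.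
  by rewrite subr_eq0 => /eqP.
have cP m r : (exists x, c x = (m, r)) <-> g m = e r.
  rewrite -cE /=; split=> [/eqP|->]; last by rewrite subrr.
  by rewrite subr_eq0 => /eqP.
have [z zE] : exists z : {linear K -> X'}, forall k, a (z k) = (inr_map M F \o i) k.
  apply: factor_inj => // k; apply/aP; rewrite (rex0 (ses_rex ie)).
  exact: (linear0 g).
have [x xE] : exists x : {linear X -> E}, forall k, c (x k) = (inl_map _ F \o f) k.
  by apply: factor_inj => // k; apply/cP; rewrite (rex0 (ses_rex fg_)) linear0.
have [w wE] : exists w : {linear X' -> E}, forall y,
    c (w y) = (pair_map (inl_map M P \o fst) snd \o a) y.
  apply: factor_inj => // y; apply/cP; apply/(aP (a y).1); exists y.
  by case: (a y).
exists K, X', z, (fst \o a); split; last first.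
  apply/rep_by_monosP; exists F, (snd \o a); split=> // y y1 y2.
  by apply: aI; rewrite linear0 [LHS]surjective_pairing; congr (_, _).
split=> //.
  split.
  - move=> k k' kk; apply: iI.
    by have := congr1 a kk; rewrite !zE => -[].
  - move=> y; split=> [/= y1|[k <-]]; last by rewrite /= zE.
    have /eE[k kE] : e (a y).2 = 0.
      have <- : g ((a y).1, 0) = e (a y).2 by apply/aP; exists y; case: (a y).
      by rewrite y1; exact: (linear0 g).
    by exists k; apply: aI; rewrite zE [RHS]surjective_pairing y1 -kE.
  - move=> m; have [r rE] := eO (g (m, 0)).
    have /aP[y yE] : g (m, 0) = e r by [].
    by exists y; rewrite /= yE.
(* The two projections of [E], onto [F] with kernel [X] and onto [P] with
   kernel [X']. *)
have sXE : ses x (snd \o c).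
  split.
  - by move=> k k' kk; apply: fI; have := congr1 c kk; rewrite !xE => -[].
  - move=> y; split=> [/= y2|[k <-]]; last by rewrite /= xE.
    have /gE[k kE] : g (c y).1 = 0.
      have -> : g (c y).1 = e (c y).2 by apply/cP; exists y; case: (c y).
      by rewrite y2 linear0.
    by exists k; apply: cI; rewrite xE [RHS]surjective_pairing y2 -kE.
  - move=> r; have [m mE] := gO (e r); have /cP[y yE] := mE.
    by exists y; rewrite /= yE.
have sX'E : ses w (snd \o fst \o c).
  split.
  - move=> y y' yy; apply: aI; have := congr1 c yy; rewrite !wE /= /pair_map /= => -[y1 y2].
    by rewrite [LHS]surjective_pairing y1 y2 -surjective_pairing.
  - move=> y; split=> [/= y2|[k <-]]; last by rewrite /= wE.
    have /aP[k kE] : g ((c y).1.1, 0) = e (c y).2.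
      by rewrite -y2 -surjective_pairing; apply/cP; exists y; case: (c y).
    exists k; apply: cI; rewrite wE /= kE /pair_map /= [RHS]surjective_pairing.
    by rewrite [X in _ = (X, _)]surjective_pairing y2.
  - move=> p; have [r rE] := eO (g (0, p)); have /cP[y yE] := esym rE.
    by exists y; rewrite /= yE.
move=> [//|j] jn; apply: (ext_left H X'fg Efg Pfg sX'E); last exact: (ext_fgproj H).
by apply: (ext_mid H Xfg Efg Ffg sXE); [exact: Xn | exact: (ext_fgproj H)].
Qed.

Lemma dual_ses X Y Z (f : {linear X -> Y}) (g : {linear Y -> Z}) :
  ses f g -> (ses (dualmap o g) (dualmap o f) <-> forall u, extends f u).
Proof.
move=> fg_; have [fI gE gO] := fg_; split=> [[_ _ dO] u|fA].
  by have [v vE] := dO u; exists v => x; rewrite -vE.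
split.
- move=> u v uv; apply: dual_ext => z; have [y <-] := gO z.
  exact: (congr1 (fun w : dual o Y => w y) uv).
- move=> v; split=> [v0|[u <-]]; last first.
    by apply: dual_ext => x; rewrite /= /dualmap /= (rex0 (ses_rex fg_)) linear0.
  have [u uE] : exists u : {linear Z -> A^o}, forall y, u (g y) = v y.
    apply: factor_onto => // y /gE[x <-].
    exact: (congr1 (fun w : dual o X => w x) v0).
  by exists u; apply: dual_ext => y; rewrite -uE.
- move=> u; have [v vE] := fA u; exists v.
  by apply: dual_ext => x; rewrite vE.
Qed.

(** Add a left projective approximation [s : X -> Q] to the inclusion of [X],
    which makes every functional extend.  The new cokernel is an extension of
    [Y] by [Q]. *)
Lemma origin_dual n M X P Y (f : {linear X -> (M * P)%type})
    (g : {linear (M * P)%type -> Y}) : fg M -> origin_ext o n f g ->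
  cond5 o n M.
Proof.
move=> Mfg [Xfg Pp Yfg fg_ [Yn Xn]].
have [Pfg _] := Pp; have [fI gE gO] := fg_.
have [Q [s sA]] := approx_ex H Xfg; have [Qp _] := sA; have [Qfg _] := Qp.
pose f2 : {linear X -> (M * (P * Q))%type} := pair_map (fst \o f) (pair_map (snd \o f) s).
have f2I : injective f2.
  move=> x y [xy1 xy2 _]; apply: fI.
  by rewrite [LHS]surjective_pairing xy1 xy2 -surjective_pairing.
have [Y2 [g2 fg2]] := coker_ex f2I; have [_ g2E g2O] := fg2.
have M2fg : fg (M * (P * Q))%type by do 2!apply: fg_prod => //.
exists X, (P * Q)%type, Y2, f2, g2; split; last first.
  apply/(dual_ses fg2) => u; have [_ /(_ u)[v vE]] := (approxP s).1 sA.
  by exists (v \o snd \o snd) => x; rewrite vE.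
split=> //; first exact: fgproj_prod.
  by apply: (fg_onto (f := g2)).
split=> //.
have [h hE] : exists h : {linear Y2 -> Y}, forall y,
    h (g2 y) = (g \o pair_map fst (fst \o snd)) y.
  apply: factor_onto => // y /g2E[x <-] /=.
  rewrite /pair_map /= -[_ (f x).1 _](_ : f x = _).
    by rewrite (rex0 (ses_rex fg_)).
  by case: (f x).
apply: (@pd_lt_ses _ n.+1 Q Y2 Y (g2 \o inr_map _ _ \o inr_map _ _) h) => //; last first.
  by apply: (@pd_lt_leq _ 1) => //; apply/pd_lt1.
split.
- apply: linear_inj0 => q /g2E[x [x1 x2 <-]].
  have /fI -> : f x = f 0 by rewrite linear0 [LHS]surjective_pairing; congr (_, _).
  exact: linear0.
- move=> y; have [[m [p q]] <-] := g2O y; split=> [|[q' <-]]; last first.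
    by rewrite hE; exact: linear0.
  rewrite hE /= /pair_map /= => /gE[x xE].
  exists (q - s x); apply/subr0_eq; rewrite /= -linearB; apply/g2E.
  have f2E : f2 (- x) = - (m, (p, s x)).
    by rewrite linearN -[f2 x]/((f x).1, ((f x).2, s x)) xE.
  exists (- x); apply: etrans f2E _; congr (_, (_, _)); rewrite /= ?add0r//.
  by rewrite addrAC subrr add0r.
- move=> y; have [[m p] <-] := gO y; exists (g2 (m, (p, 0))).
  by rewrite hE.
Qed.

Lemma steqv_prodr M P : fgproj P -> steqv (M * P)%type M.
Proof.
move=> Pp; exists fst, (inl_map M P); split; last exact: steq_ext.
exists P, snd, (\- inr_map M P); split=> // -[m p].
by rewrite /= /pair_map /=; congr (_, _); rewrite /= ?add0r ?subrr ?oppr0.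
Qed.

Lemma origin_ext_isom n M X P Y (f : {linear X -> (M * P)%type})
    (g : {linear (M * P)%type -> Y}) j : fg M -> origin_ext o n f g ->
  (forall u, extends f u) -> (1 <= j <= n)%N -> isom (ext o j Y) (ext o j M).
Proof.
move=> Mfg [Xfg Pp Yfg fg_ [Yn Xn]] fA; case: j => // j jn.
have [Pfg _] := Pp; have MPfg := fg_prod Mfg Pfg.
apply: isom_trans (ext_steqv H j MPfg Mfg (steqv_prodr M Pp)).
apply: (ext_right_iso H Xfg MPfg Yfg fg_); last exact: Xn.
by case: j jn => // j /ltnW jn; apply: Xn; rewrite jn.
Qed.

End Approximations.

(** * Stable isomorphisms of iterated syzygies *)

Section IsoAfter.
Variable A : pzRingType.
Hypothesis AN : left_noetherian A.
Implicit Types M N X : lmodType A.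

(** The same requirement as [stable_iso (syzn_hom n f)], but with the
    recursion on the inside, which fits inductions that replace [M] by
    [syz M]. *)
Fixpoint iso_after n X M (f : {linear X -> M}) : Prop :=
  if n is n'.+1 then iso_after n' (syz_hom f) else stable_iso f.

Lemma iso_after_iso n X M (f : {linear X -> M}) : fg X -> fg M ->
  stable_iso f -> iso_after n f.
Proof.
elim: n X M f => //= n IHn X M f Xfg Mfg fI.
by apply: IHn; [exact: fg_syz | exact: fg_syz | exact: syz_hom_iso].
Qed.

Lemma iso_after_steq n X M (f f' : {linear X -> M}) : fg X -> fg M ->
  stable_eq f f' -> iso_after n f -> iso_after n f'.
Proof.
elim: n X M f f' => [|n IHn] X M f f' Xfg Mfg ff' /=.
  exact: stable_iso_steq.
by apply: IHn; [exact: fg_syz | exact: fg_syz | exact: syz_hom_steq].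
Qed.

Lemma iso_after_comp n X M N (f : {linear M -> N}) (g : {linear X -> M}) :
  fg X -> fg M -> fg N -> iso_after n f -> iso_after n g -> iso_after n (f \o g).
Proof.
elim: n X M N f g => [|n IHn] X M N f g Xfg Mfg Nfg /=.
  exact: stable_iso_comp.
move=> fI gI; apply: iso_after_steq (steq_sym (syz_hom_comp f g Xfg Mfg Nfg)) _; try exact: fg_syz.
by apply: IHn => //; exact: fg_syz.
Qed.

Lemma iso_after_syzn n X M (f : {linear X -> M}) :
  iso_after n f -> stable_iso (syzn_hom n f).
Proof.
suff S d k : (d + k = n)%N -> iso_after d (syzn_hom k f) -> stable_iso (syzn_hom n f).
  exact: (S n 0 (addn0 n)).
elim: d k => [|d IHd] k; first by rewrite add0n => ->.
by rewrite addSnnS => dk; exact: (IHd k.+1).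
Qed.

End IsoAfter.

(** * Approximations from grade conditions *)

Section Main.
Variables (A B : pzRingType) (o : antiiso B A) (o' : antiiso A B).
Hypothesis H : noeth_duality o o'.
Implicit Types U V X Y Z K P Q M N W : lmodType A.

Let H' : noeth_duality o' o. Proof. exact: noeth_duality_sym. Qed.
Let AN : left_noetherian A. Proof. by case: H. Qed.

(** The pullback of [f] and the free cover of [M] contains [syz M] and, by
    projectivity, splits as [freecover M * Z]. *)
Lemma pullback_seq Z X M (g : {linear Z -> X}) (f : {linear X -> M}) :
  fg M -> ses g f ->
  exists (k : {linear syz M -> Z}) (c : {linear freecover M -> X}),
    ses (pair_map (syzi M) (\- k)) (copair c g).
Proof.
move=> Mfg gf; have sM := ses_syz Mfg; have [gI fE fO] := gf.
have [k [c [cE ck]]] := seqmap_exl (fgproj_freecover M) (ses_rex sM) gf idfun.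
exists k, c; have [iI iE iO] := sM; split.
- by move=> x y [/iI].
- move=> [r z] /=; split=> [cg|[x [<- <-]]]; last first.
    by rewrite linearN /= ck subrr.
  have /iE[x xE] : cover M r = 0.
    rewrite -[LHS](cE r) -[c r](addrK (g z)) cg sub0r linearN.
    by rewrite (rex0 (ses_rex gf)) oppr0.
  exists x; congr (_, _) => //=; apply: gI.
  by rewrite linearN -ck xE; apply/eqP; rewrite eqr_oppLR -addr_eq0 cg.
- move=> x; have [r rE] := iO (f x).
  have /fE[z zE] : f (x - c r) = 0 by rewrite linearB cE /= rE subrr.
  by exists (r, z); rewrite /= zE addrC subrK.
Qed.

(** Let [z] in [Z] die under a left projective approximation of [X].
    Evaluation at [z] kills the functionals that extend to [X], and the other
    ones are measured by Ext^1 of [M], because Ext^1 of [X] is zero.  So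
    evaluation at [z] is a functional on Ext^1 of [M], hence zero. *)
Lemma mono_criterion Z X M (g : {linear Z -> X}) (f : {linear X -> M}) :
  fg X -> fg M -> ses g f -> ext_zero o 1 X -> ext_zero o' 0 (ext o 1 M) ->
  (forall z, (forall u : dual o Z, u z = 0) -> z = 0) -> rep_by_monos f.
Proof.
move=> Xfg Mfg gf X0 M0 Ztl.
have [Q [s sA]] := approx_ex H Xfg; have [Qp sE] := (approxP s).1 sA.
apply/rep_by_monosP; exists Q, s; split=> // x; have [gI fE fO] := gf.
move=> /fE[z <-] {x} sz; rewrite (_ : z = 0) ?linear0//; apply: Ztl.
have [k [c kc]] := pullback_seq Mfg gf.
have [h [hO hE]] := ext1_syzi H Mfg.
have [e eE] := ev_ex H z.
(* [h] makes Ext^1 of [M] a quotient of [dual o (syz M)], and restriction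
   along [k] maps [dual o Z] onto it. *)
have [m mE] : exists m : {linear ext o 1 M -> B^o},
    forall u, m ((h \o dualmap o k) u) = e u.
  apply: factor_onto => [y|u].
    have [v <-] := hO y; have [w wE] := ext1_extends H Xfg kc X0 v.
    pose w1 : {linear Z -> A^o} := w \o inr_map _ _.
    exists (- (w1 : dual o Z)); apply/subr0_eq; rewrite /= -linearB; apply/hE.
    exists (\- (w \o inl_map _ _)) => x.
    have vE : v x = w (syzi M x, 0) - w1 (k x).
      by rewrite wE -linearN [LHS](copair_decomp w).
    by rewrite -[LHS]/(- w1 (k x) - v x) vE opprB addKr.
  move=> /= /hE[w wE].
  have [t tE] : exists t : {linear X -> A^o}, forall y, t (copair c g y) = copair w u y.
    apply: factor_onto; first by case: kc.
    by case: kc => _ E _ y /E[x <-] /=; rewrite linearN -wE /dualmap /= subrr.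
  have uE y : u y = t (g y) by have := tE (0, y); rewrite /= !linear0 !add0r.
  by rewrite eE uE; have [v ->] := sE t; rewrite sz linear0 (anti0 o').
move=> u; apply: (o'_eq0 H); rewrite -eE -mE.
have Efg := ext_fg H 1 Mfg.
exact: (congr1 (fun w : dual o' _ => w _) ((ext0P H' Efg).1 M0 m)).
Qed.

Lemma ext_syz_shift j M : fg M ->
  isom (ext o j.+1 (syz M)) (ext o j.+2 M).
Proof. by move=> Mfg; exact: (ext_shift H j Mfg (fgproj_freecover M) (ses_syz Mfg)). Qed.

(** Being represented by monomorphisms, [f] makes the left projective
    approximation [s : X -> Q] injective, because the composite of [f] with
    the inclusion of [syz M] in its projective factors through [s].  Put
    [V = Q / X]; then [X] is a syzygy of [V], so the Ext groups of [V] vanish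
    in degree 1 by the choice of [s] and beyond by shifting.  The map from [V]
    induced by [f], together with the free cover, maps [V * freecover M] onto
    [M]; its kernel is [Q / Z] and its syzygy is [f] up to stable
    isomorphism. *)
Lemma approx_step n M X Z (g : {linear Z -> X}) (f : {linear X -> syz M}) :
  fg M -> AB_approx o n g f -> rep_by_monos f -> iso_after n f ->
  exists (Z' X' : lmodType A) (g' : {linear Z' -> X'}) (f' : {linear X' -> M}),
    AB_approx o n.+1 g' f' /\ iso_after n.+1 f'.
Proof.
move=> Mfg [Zfg Xfg gf Zn Xn] fm fI; have [gI fE fO] := gf.
have sM := ses_syz Mfg; have [iI iE iO] := sM.
have [Q [s sA]] := approx_ex H Xfg; have [Qp _] := sA; have [Qfg _] := Qp.
have sX0 : forall x, s x = 0 -> x = 0.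
  move=> x sx; apply: (rep_by_monos_approx sA fm) => //.
  have [k kE] := sA.2 _ (syzi M \o f) (fgproj_freecover M).
  by apply: iI; rewrite [LHS](kE x) sx !linear0.
have [V [q sq]] := coker_ex (linear_inj0 sX0); have [sI qE qO] := sq.
have [f0 [c [cf cs]]] := seqmap_exr sA (ses_rex sq) (fgproj_freecover M) (ses_rex sM) f.
set F := freecover M in c cf cs *.
have Fp : fgproj F := fgproj_freecover M; have [Ffg _] := Fp.
have Vfg : fg V by apply: (fg_onto (f := q)).
pose X' : lmodType A := (V * F)%type.
have X'fg : fg X' by exact: fg_prod.
pose f' : {linear X' -> M} := copair f0 (cover M).
have f'O : onto f'.
  by move=> m; have [r rE] := iO m; exists (0, r); rewrite /= linear0 add0r.
have [Z' [g' gf']] := ker_ex f'O; have [g'I f'E _] := gf'.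
have [p pE] : exists p : {linear Q -> Z'}, forall y, g' (p y) = pair_map q (\- c) y.
  apply: factor_inj => // y; apply/f'E; rewrite /= linearN -cf subrr //.
(* [Z' = Q / Z] has projective dimension at most one more than [Z]. *)
have sZ' : ses (s \o g) p.
  split.
  - by move=> z z' /sI/gI.
  - move=> y; split=> [py|[z <-]]; last first.
      apply: g'I; rewrite pE /pair_map /= cs (rex0 (ses_rex sq)) (rex0 (ses_rex gf)).
      by rewrite !linear0.
    have [qy cy] : q y = 0 /\ c y = 0.
      have := pE y; rewrite py linear0 => -[<- cy]; split=> //.
      by apply/eqP; rewrite -oppr_eq0 -cy.
    have /qE[x xE] := qy; have /fE[z zE] : f x = 0.
      by apply: iI; rewrite linear0 -cs xE.
    by exists z; rewrite /= zE.
  - move=> z; have : f' (g' z) = 0 by exact: rex0 (ses_rex gf') z.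
    case E : (g' z) => [v r] /= vr; have [y yE] := qO v.
    have /iE[m mE] : cover M (c y + r) = 0 by rewrite linearD cf yE.
    have [x xE] := fO m; exists (y - s x); apply: g'I.
    have cE : c (y - s x) = - r by rewrite linearB cs xE mE opprD addNKr.
    rewrite pE E /pair_map /= cE opprK; congr (_, _).
    by rewrite linearB (rex0 (ses_rex sq)) subr0.
(* [X] is also a syzygy of [X' = V * F], through [Q * F]. *)
have sX' : ses (pair_map s \0) (pair_map (q \o fst) snd : {linear (Q * F)%type -> X'}).
  split.
  - by move=> x x' [/sI].
  - move=> [y r]; split=> [[qy r0]|[x [<- <-]]].
      have /qE[x xE] := qy; exists x.
      by congr (_, _); [exact: xE | exact: esym r0].
    by congr (_, _); exact: (rex0 (ses_rex sq)).
  - by move=> [v r]; have [y yE] := qO v; exists (y, r); congr (_, _).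
have QFp : fgproj (Q * F)%type by exact: fgproj_prod.
exists Z', X', g', f'; split.
  split=> //.
  - exact: ses_fgl AN gf' X'fg.
  - by exists Z, Q, (s \o g), p.
  - move=> j /andP[j0 jn]; case: j j0 jn => // -[|j] _ jn.
      have [sf sE] := (approxP s).1 sA.
      apply: (isom_zero (ext_steqv H 0 Vfg X'fg (steqv_sym (steqv_prodr V Fp)))).
      by apply/(is_e1_zero (ext1P H Vfg (steqv_refl V) Qp sq)).
    apply: (isom_zero (ext_steqv H j.+1 Vfg X'fg (steqv_sym (steqv_prodr V Fp)))).
    by apply: (isom_zero (ext_shift H j Vfg Qp sq)); exact: Xn.
have [k kid] := seqmap_exl (fgproj_freecover X') (ses_rex (ses_syz X'fg)) sX' idfun.
have kI : stable_iso k.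
  apply: (schanuel (fgproj_freecover X') (ses_syz X'fg) QFp sX' kid).
  by exists idfun; split; exact: steq_refl.
(* So [f] is the syzygy of [f'] up to the stable isomorphism [k]. *)
have ff' : seqmap (pair_map s \0) (pair_map (q \o fst) snd : {linear (Q * F)%type -> X'})
    (syzi M) (cover M) f f'.
  exists (copair c idfun); split=> [[y r]|x] /=; last by rewrite cs addr0.
  by rewrite linearD cf.
have := seqmap_steql (fgproj_freecover X') (ses_rex (ses_syz X'fg)) sM
  (seqmap_comp ff' kid) (syz_homP f' X'fg Mfg) (steq_refl f').
have Sfg := fg_syz M AN; have S'fg := fg_syz X' AN.
move=> /(iso_after_steq AN S'fg Sfg); apply.
by apply: (iso_after_comp AN S'fg Xfg Sfg fI); exact: iso_after_iso.
Qed.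

Definition good_approx n M : Prop :=
  exists (Z X : lmodType A) (g : {linear Z -> X}) (f : {linear X -> M}),
    [/\ AB_approx o n g f, rep_by_monos f & iso_after n f].

(** In the sequence of [pullback_seq] the middle term is stably [Z], and Ext
    of [X] vanishes. *)
Lemma ext_approx_kernel n Z X M (g : {linear Z -> X}) (f : {linear X -> M}) j :
  fg M -> AB_approx o n.+1 g f -> (1 <= j <= n)%N -> isom (ext o j Z) (ext o j.+1 M).
Proof.
move=> Mfg [Zfg Xfg gf Zn Xn]; case: j => // j jn.
have [k [c kc]] := pullback_seq Mfg gf.
have Fp := fgproj_freecover M; have [Ffg _] := Fp.
have FZfg := fg_prod Ffg Zfg; have Sfg := fg_syz M AN.
apply: isom_trans (ext_syz_shift j Mfg).
have FZ : steqv Z (freecover M * Z)%type.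
  exists (inr_map _ _), snd; split; first exact: steq_ext.
  exists (freecover M), fst, (\- inl_map _ _); split=> // -[r z].
  by rewrite /= /pair_map /=; congr (_, _); rewrite /= ?add0r ?subrr ?oppr0.
apply: isom_trans (ext_steqv H j Zfg FZfg FZ) _.
case/andP: jn => _ jn.
by apply: (ext_left_iso H Sfg FZfg Xfg kc); apply: Xn; rewrite /= ltnS // ltnW.
Qed.

(** Condition [cond1] of order [n + 1] for [M] implies that of order [n] for
    [syz M], with grades one higher than needed.  It is used again in full to
    make the kernel of the resulting approximation torsionless. *)
Theorem grade_good_approx n M : fg M -> cond1 o o' n M -> good_approx n M.
Proof.
elim: n M => [|n IHn] M Mfg Mg.
  exists 'rV[A]_0, M, \0, idfun; split.
  - split=> //; [exact: (fgproj_row A 0).1 | | by move=> x; exact: thinmx0 | by case].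
    split=> [x y _|y|y]; last by exists y.
      by rewrite [LHS]thinmx0 [RHS]thinmx0.
    by split=> [y0|[_ <-]//]; exists 0; exact: esym y0.
  - by apply/rep_by_monosP; exists 'rV[A]_0, \0; split=> //; exact: fgproj_row.
  - by apply: iso_stable_iso => // y; exists y.
have Sfg := fg_syz M AN.
have [|Z [X [g [f [gf fm fI]]]]] := IHn (syz M) Sfg.
  move=> [//|j] jn; have Efg := ext_fg H j.+2 Mfg.
  apply: (grade_isom H Efg (isom_sym (ext_syz_shift j Mfg))).
  apply: grade_geW (leqnSn _) _; exact: (Mg j.+2).
have [Z' [X' [g' [f' [gf' fI']]]]] := approx_step Mfg gf fm fI.
exists Z', X', g', f'; split=> //; have [Z'fg X'fg gfs' Z'n X'n] := gf'.
apply: (mono_criterion X'fg Mfg gfs').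
- exact: X'n.
- by apply: grade_zero (Mg 1 _) _.
apply: (torsionless_of_grade H Z'fg Z'n) => j jn.
have Efg := ext_fg H j.+1 Mfg.
apply: (grade_isom H Efg (isom_sym (ext_approx_kernel Mfg gf' jn))).
by apply: Mg; case/andP: jn.
Qed.

End Main.

(** * Functoriality of the transpose *)

Section TransposeMaps.
Variables (A B : pzRingType) (o : antiiso B A) (o' : antiiso A B).
Hypothesis H : noeth_duality o o'.
Implicit Types U V X Y Z K P Q M N W : lmodType A.
Implicit Types T S : lmodType B.

Let H' : noeth_duality o' o. Proof. exact: noeth_duality_sym. Qed.
Let AN : left_noetherian A. Proof. by case: H. Qed.
Let BN : left_noetherian B. Proof. by case: H. Qed.

(** [t] is induced by [w] on the transposes computed from presentations
    [P1 -> P0 -> W] that are free to vary.  This freedom is what identifies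
    [X] with the transpose of [tr X]. *)
Definition tr_rel (P1 P0 W P1' P0' W' : lmodType A) (T T' : lmodType B)
    (d : {linear P1 -> P0}) (p : {linear P0 -> W}) (q : {linear dual o P1 -> T})
    (d' : {linear P1' -> P0'}) (p' : {linear P0' -> W'})
    (q' : {linear dual o P1' -> T'})
    (w : {linear W -> W'}) (t : {linear T' -> T}) : Prop :=
  exists (h0 : {linear P0 -> P0'}) (h1 : {linear P1 -> P1'}),
    [/\ forall x, p' (h0 x) = w (p x), forall x, d' (h1 x) = h0 (d x)
      & forall f, t (q' f) = q (dualmap o h1 f)].

Lemma lift_rex (P P1 P0 W : lmodType A) (d : {linear P1 -> P0}) (p : {linear P0 -> W})
    (f : {linear P -> P0}) : fgproj P -> rex d p -> (forall x, p (f x) = 0) ->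
  exists c : {linear P -> P1}, forall x, d (c x) = f x.
Proof.
move=> Pp [dp _] pf; have [D [q [i [qO iI qE]]]] := img_ex d.
have [g gE] : exists g : {linear P -> D}, forall x, i (g x) = f x.
  by apply: factor_inj => // x; have /dp[y yE] := pf x; exists (q y); rewrite qE.
have [c cE] := proj_lift g Pp qO; exists c => x.
by rewrite -qE cE gE.
Qed.

Section Rel.
Variables (P1 P0 W P1' P0' W' : lmodType A) (T T' : lmodType B).
Variables (d : {linear P1 -> P0}) (p : {linear P0 -> W}).
Variable (q : {linear dual o P1 -> T}).
Variables (d' : {linear P1' -> P0'}) (p' : {linear P0' -> W'}).
Variable (q' : {linear dual o P1' -> T'}).
Hypotheses (P1p : fgproj P1) (P0p : fgproj P0).
Hypotheses (dp : rex d p) (dq : rex (dualmap o d) q).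
Hypotheses (dp' : rex d' p') (dq' : rex (dualmap o d') q').

Lemma tr_rel_ex w : exists t, tr_rel d p q d' p' q' w t.
Proof.
have [h0 h0E] := proj_lift (w \o p) P0p dp'.2.
have [|h1 h1E] := @lift_rex P1 _ _ _ d' p' (h0 \o d) P1p dp'.
  by move=> x; rewrite /= h0E /= (rex0 dp) linear0.
have [t tE] : exists t : {linear T' -> T}, forall f, t (q' f) = (q \o dualmap o h1) f.
  apply: factor_onto => [|f /dq'.1[g <-] /=]; first exact: dq'.2.
  apply/dq.1; exists (dualmap o h0 g); apply: dual_ext => x.
  by rewrite /= /dualmap /= h1E.
by exists t, h0, h1.
Qed.

Lemma tr_rel_sub w t w' t' :
  tr_rel d p q d' p' q' w t -> tr_rel d p q d' p' q' w' t' ->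
  tr_rel d p q d' p' q' (w \- w') (t \- t').
Proof.
move=> [h0 [h1 [pw dh tq]]] [k0 [k1 [pw' dh' tq']]].
exists (h0 \- k0), (h1 \- k1); split=> [x|x|f] /=.
- by rewrite linearB pw pw'.
- by rewrite linearB dh dh'.
rewrite tq tq' -linearB; congr (q _); apply: dual_ext => x.
by rewrite -[RHS]/(f (h1 x - k1 x)) linearB.
Qed.

(** If [w] is null, [h0] is homotopic to a map through a projective: the
    difference lifts to [c : P0 -> P1'].  Then [h1 - c d] induces the same map
    [t], and its dual vanishes on the image of the dual of [d'], so [t]
    factors through [dual o P1]. *)
Lemma tr_rel_null w t : tr_rel d p q d' p' q' w t -> null w -> null t.
Proof.
move=> [h0 [h1 [pw dh tq]]] [S [a [b [Sp wE]]]].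
have [b' b'E] := proj_lift b Sp dp'.2.
have [|c cE] := @lift_rex P0 _ _ _ d' p' (h0 \- (b' \o a \o p)) P0p dp'.
  by move=> x; rewrite /= linearB pw b'E wE subrr.
pose y : {linear P1 -> P1'} := h1 \- (c \o d).
have dy x : d' (y x) = 0.
  by rewrite /= linearB dh cE /= (rex0 dp) !linear0 addr0 subrr.
have [g gE] : exists g : {linear T' -> dual o P1}, forall f, g (q' f) = dualmap o y f.
  apply: factor_onto => [|f /dq'.1[k <-]]; first exact: dq'.2.
  apply: dual_ext => x; rewrite !dualE dy; exact: linear0.
exists (dual o P1), g, q; split; first exact: dual_fgproj H _ P1p.
move=> z; have [f <-] := dq'.2 z; rewrite gE tq.
apply/subr0_eq; rewrite -linearB; apply/dq.1; exists (dualmap o c f).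
apply: dual_ext => x; rewrite -[RHS]/(f (h1 x) - f (h1 x - c (d x))) linearB.
by rewrite opprB addrC subrK.
Qed.

Lemma tr_rel_steq w t w' t' :
  tr_rel d p q d' p' q' w t -> tr_rel d p q d' p' q' w' t' ->
  stable_eq w w' -> stable_eq t t'.
Proof. by move=> wt wt'; exact: tr_rel_null (tr_rel_sub wt wt'). Qed.

End Rel.

Lemma tr_rel_id (P1 P0 W : lmodType A) T
    (d : {linear P1 -> P0}) (p : {linear P0 -> W}) (q : {linear dual o P1 -> T}) :
  tr_rel d p q d p q idfun idfun.
Proof.
by exists idfun, idfun; split=> // f; congr (q _); apply: dual_ext.
Qed.

Lemma tr_rel_comp (P1 P0 W P1' P0' W' P1'' P0'' W'' : lmodType A)
    (T T' T'' : lmodType B)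
    (d : {linear P1 -> P0}) (p : {linear P0 -> W}) (q : {linear dual o P1 -> T})
    (d' : {linear P1' -> P0'}) (p' : {linear P0' -> W'})
    (q' : {linear dual o P1' -> T'})
    (d'' : {linear P1'' -> P0''}) (p'' : {linear P0'' -> W''})
    (q'' : {linear dual o P1'' -> T''}) w t w' t' :
  tr_rel d p q d' p' q' w t -> tr_rel d' p' q' d'' p'' q'' w' t' ->
  tr_rel d p q d'' p'' q'' (w' \o w) (t \o t').
Proof.
move=> [h0 [h1 [pw dh tq]]] [k0 [k1 [pw' dh' tq']]].
exists (k0 \o h0), (k1 \o h1); split=> [x|x|f] /=.
- by rewrite pw' pw.
- by rewrite dh' dh.
by rewrite tq' tq; congr (q _); apply: dual_ext.
Qed.

Definition std_tr_rel (W W' : lmodType A) : {linear W -> W'} -> {linear tr o W' -> tr o W} -> Prop :=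
  tr_rel (pres_map W) (cover W) (trq o W) (pres_map W') (cover W') (trq o W').

Lemma tr_homP (W W' : lmodType A) (w : {linear W -> W'}) : fg W -> fg W' ->
  std_tr_rel w (tr_hom o w).
Proof.
move=> Wfg Wfg'.
have [t [h0 [h1 [E0 E1 E2]]]] := tr_rel_ex (fgproj_freecover (syz W))
  (fgproj_freecover W) (rex_pres H Wfg) (rex_trq o W) (rex_pres H Wfg') (rex_trq o W') w.
have := choose_linearP (Q := fun g : {linear tr o W' -> tr o W} =>
    exists (h0 : {linear freecover W -> freecover W'})
      (h1 : {linear freecover (syz W) -> freecover (syz W')}),
      [/\ forall x, freecover_map (h0 x) = w (freecover_map x),
          forall x, pres_map W' (h1 x) = h0 (pres_map W x)
        & forall u : dual o (freecover (syz W')),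
            g (quotproj _ u) = quotproj _ (dualmap o h1 u)]).
by apply; exists t, h0, h1; split.
Qed.

Lemma std_tr_rel_steq (W W' : lmodType A) (w w' : {linear W -> W'}) t t' : fg W -> fg W' ->
  std_tr_rel w t -> std_tr_rel w' t' -> stable_eq w w' -> stable_eq t t'.
Proof.
move=> Wfg Wfg'; exact: (tr_rel_steq (fgproj_freecover (syz W))
  (fgproj_freecover W) (rex_pres H Wfg) (rex_trq o W) (rex_pres H Wfg') (rex_trq o W')).
Qed.

(** The composite of the two middle maps of [tr_seq]: [tr W] maps to a
    projective with cokernel [tr (syz W)]. *)
Definition trs_spec W (s : {linear tr o W -> dual o (freecover (syz (syz W)))}) :=
  forall f, s (trq o W f) = dualmap o (pres_map (syz W)) f.

Lemma trs_ex W : fg W -> exists s, @trs_spec W s.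
Proof.
move=> Wfg; apply: factor_onto => [|f /(rex_trq o W).1[g <-]].
  exact: (rex_trq o W).2.
apply: dual_ext => x; rewrite !dualE !pres_mapE cover_syzi ?linear0//.
exact: fg_syz.
Qed.

Definition trs W : {linear tr o W -> dual o (freecover (syz (syz W)))} :=
  choose_linear (@trs_spec W).

Lemma trsE W f : fg W -> trs W (trq o W f) = dualmap o (pres_map (syz W)) f.
Proof. by move=> Wfg; exact: (choose_linearP (trs_ex Wfg)). Qed.

Lemma rex_trs W : fg W -> rex (trs W) (trq o (syz W)).
Proof.
move=> Wfg; split; last exact: (rex_trq o (syz W)).2.
move=> f; rewrite (rex_trq o (syz W)).1; split=> [[g <-]|[y <-]].
  by exists (trq o W g); rewrite trsE.
by have [g <-] := (rex_trq o W).2 y; exists g; rewrite trsE.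
Qed.

(** This is the reason why Tr Omega is the cosyzygy of Tr: a functional on
    [tr W] is evaluation of [d1] at an element ([tr_functional]), hence
    extends. *)
Lemma approx_trs W : fg W -> left_proj_approx (trs W).
Proof.
move=> Wfg; apply/approxP; split.
  exact: dual_fgproj H _ (fgproj_freecover _).
move=> u; have [z zE] := tr_functional H u Wfg; have [e eE] := ev_ex H z.
exists e => y; have [f <-] := (rex_trq o W).2 y.
by rewrite zE trsE// eE dualE.
Qed.

(** A null change of [g] is absorbed by the middle map, since it extends along
    [s]. *)
Lemma seqmap_replace (C : pzRingType) (U Q V K P N : lmodType C)
    (s : {linear U -> Q}) (r : {linear Q -> V})
    (i : {linear K -> P}) (p : {linear P -> N}) g g' f :
  left_proj_approx s -> rex i p -> stable_eq g' g ->
  seqmap s r i p g f -> seqmap s r i p g' f.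
Proof.
move=> [_ sA] ip [S [a [b [Sp gE]]]] [c [cf cg]].
have [a' a'E] := sA S a Sp; exists (c \+ (i \o b \o a')).
split=> [y|u] /=; first by rewrite linearD cf (rex0 ip) addr0.
by rewrite cg -a'E -gE /= -linearD addrC subrK.
Qed.

Lemma tr_hom_seqmap (W W' : lmodType A) (w : {linear W -> W'}) : fg W -> fg W' ->
  seqmap (trs W') (trq o (syz W')) (trs W) (trq o (syz W))
    (tr_hom o w) (tr_hom o (syz_hom w)).
Proof.
move=> Wfg Wfg'; have Sfg := fg_syz W AN; have Sfg' := fg_syz W' AN.
have [h1 [h2 [E1 E2 E3]]] := tr_homP (syz_hom w) Sfg Sfg'.
have [h0 [E0 E0']] := syz_homP w Wfg Wfg'.
have hh x : pres_map W' (h1 x) = h0 (pres_map W x) by rewrite !pres_mapE E1 -E0'.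
have [t tE] : exists t : {linear tr o W' -> tr o W},
    forall f, t (trq o W' f) = (trq o W \o dualmap o h1) f.
  apply: factor_onto => [|f /(rex_trq o W').1[g <-] /=]; first exact: (rex_trq o W').2.
  apply/(rex_trq o W).1; exists (dualmap o h0 g); apply: dual_ext => x.
  by rewrite !dualE hh.
have wt : std_tr_rel w t by exists h0, h1.
apply: seqmap_replace (approx_trs Wfg') (rex_trs Wfg) _ _.
  exact: std_tr_rel_steq Wfg Wfg' (tr_homP w Wfg Wfg') wt (steq_refl w).
exists (dualmap o h2); split=> [f|y]; first by rewrite E3.
have [f <-] := (rex_trq o W').2 y; rewrite tE trsE//.
apply: etrans (esym (trsE (dualmap o h1 f) Wfg)).
by apply: dual_ext => x; rewrite !dualE E2.
Qed.

End TransposeMaps.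

(** * The adjunction of Tr Omega^i Tr and Omega^i *)

Section Linked.
Variables (A B : pzRingType) (o : antiiso B A) (o' : antiiso A B).
Hypothesis H : noeth_duality o o'.
Implicit Types X Y : lmodType A.
Implicit Types Z : lmodType B.

Let H' : noeth_duality o' o. Proof. exact: noeth_duality_sym. Qed.
Let AN : left_noetherian A. Proof. by case: H. Qed.
Let BN : left_noetherian B. Proof. by case: H. Qed.

(** A chain of [k] morphisms of sequences, from
    [tr (syzn k' Z) -> Q -> tr (syz (syzn k' Z))] to [syz (syzn j Y) ->
    freecover (syzn j Y) -> syzn j Y], leading from [f] to [g].  Each step
    trades a cosyzygy of the source for a syzygy of the target.  It only
    relates degrees with [k + j = m]; the equation [e] of the base case stands
    for this, because [m] cannot be computed from [k] and [j] up to
    conversion. *)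
Fixpoint linked Z Y (k : nat) : forall j m,
    {linear tr o' (syzn k Z) -> syzn j Y} -> {linear tr o' Z -> syzn m Y} -> Prop :=
  if k is k'.+1 then fun j m f g =>
    exists f1 : {linear tr o' (syzn k' Z) -> syzn j.+1 Y},
      seqmap (trs o' (syzn k' Z)) (trq o' (syz (syzn k' Z)))
             (syzi (syzn j Y)) (cover (syzn j Y)) f1 f /\ @linked Z Y k' j.+1 m f1 g
  else fun j m f g =>
    exists e : j = m, g = eq_rect j (fun l => {linear tr o' Z -> syzn l Y}) f m e.

Section Fixed.
Variables (Z : lmodType B) (Y : lmodType A).
Hypotheses (Zfg : fg Z) (Yfg : fg Y).

Let Zk k : fg (syzn k Z). Proof. exact: fg_syzn. Qed.
Let Yj j : fg (syzn j Y). Proof. exact: fg_syzn. Qed.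
Let Fp k : fgproj (dual o' (freecover (syz (syz (syzn k Z))))).
Proof. exact: dual_fgproj H' _ (fgproj_freecover _). Qed.

Lemma linked_exl k j m (f : {linear tr o' (syzn k Z) -> syzn j Y}) :
  (k + j = m)%N -> exists g : {linear tr o' Z -> syzn m Y}, linked f g.
Proof.
elim: k j f => [|k IHk] j f.
  by rewrite add0n => jm; case: m / jm; exists f, erefl.
rewrite addSnnS => kj.
have [f1 f1f] := seqmap_exl (Fp k) (rex_trs H' (Zk k)) (ses_syz (Yj j)) f.
by have [g f1g] := IHk j.+1 f1 kj; exists g, f1.
Qed.

Lemma linked_exr k j m (g : {linear tr o' Z -> syzn m Y}) :
  (k + j = m)%N -> exists f : {linear tr o' (syzn k Z) -> syzn j Y}, linked f g.
Proof.
elim: k j => [|k IHk] j.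
  by rewrite add0n => jm; case: m / jm g => g; exists g, erefl.
rewrite addSnnS => /IHk[f1 f1g].
have [f f1f] := seqmap_exr (approx_trs H' (Zk k)) (rex_trs H' (Zk k))
  (fgproj_freecover _) (ses_rex (ses_syz (Yj j))) f1.
by exists f, f1.
Qed.

Lemma linked_sub k j m (f f' : {linear tr o' (syzn k Z) -> syzn j Y})
    (g g' : {linear tr o' Z -> syzn m Y}) :
  linked f g -> linked f' g' -> linked (f \- f') (g \- g').
Proof.
elim: k j f f' => [|k IHk] j f f' /=.
  move=> [e ->] [e' ->]; rewrite (eq_irrelevance e' e).
  by exists e; case: m / e g g' e' => g g' e' /=.
move=> [f1 [f1f f1g]] [f1' [f1f' f1g']]; exists (f1 \- f1'); split.
  exact: seqmap_sub.
exact: IHk.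
Qed.

Lemma linked_nulll k j m (f : {linear tr o' (syzn k Z) -> syzn j Y})
    (g : {linear tr o' Z -> syzn m Y}) : linked f g -> null f -> null g.
Proof.
elim: k j f => [|k IHk] j f /=.
  by move=> [e ->]; case: m / e g.
move=> [f1 [f1f f1g]] f0; apply: IHk f1g _.
exact: (seqmap_nulll (Fp k) (rex_trs H' (Zk k)) (ses_syz (Yj j)) f1f f0).
Qed.

Lemma linked_nullr k j m (f : {linear tr o' (syzn k Z) -> syzn j Y})
    (g : {linear tr o' Z -> syzn m Y}) : linked f g -> null g -> null f.
Proof.
elim: k j f => [|k IHk] j f /=.
  by move=> [e ->]; case: m / e g.
move=> [f1 [f1f f1g]] g0; have f10 := IHk _ _ f1g g0.
exact: (seqmap_nullr (approx_trs H' (Zk k)) (rex_trs H' (Zk k))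
  (fgproj_freecover _) (ses_rex (ses_syz (Yj j))) f1f f10).
Qed.

(** Each end of a morphism of sequences determines the other stably, on both
    sides: by projectivity of the middle term going down and by the
    approximation property going up. *)
Lemma linked_steq k j m (f f' : {linear tr o' (syzn k Z) -> syzn j Y})
    (g g' : {linear tr o' Z -> syzn m Y}) :
  linked f g -> linked f' g' -> stable_eq f f' <-> stable_eq g g'.
Proof.
move=> fg_ fg'; have s := linked_sub fg_ fg'.
by split; [exact: linked_nulll s | exact: linked_nullr s].
Qed.

Lemma linked_postcomp Y' (v : {linear Y -> Y'}) k j m
    (f : {linear tr o' (syzn k Z) -> syzn j Y}) (g : {linear tr o' Z -> syzn m Y}) :
  fg Y' -> linked f g -> linked (syzn_hom j v \o f) (syzn_hom m v \o g).
Proof.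
move=> Y'fg; elim: k j f => [|k IHk] j f /=.
  by move=> [e ->]; exists e; case: m / e g.
move=> [f1 [f1f f1g]]; exists (syzn_hom j.+1 v \o f1); split; last exact: IHk.
apply: seqmap_comp f1f; apply: syz_homP => //; exact: fg_syzn.
Qed.

Lemma linked_precomp Z' (w : {linear Z -> Z'}) k j m
    (f : {linear tr o' (syzn k Z) -> syzn j Y}) (g : {linear tr o' Z -> syzn m Y}) :
  fg Z' -> linked f g ->
  linked (f \o tr_hom o' (syzn_hom k w)) (g \o tr_hom o' w).
Proof.
move=> Z'fg; elim: k j f => [|k IHk] j f /=.
  by move=> [e ->]; exists e; case: m / e g.
move=> [f1 [f1f f1g]]; exists (f1 \o tr_hom o' (syzn_hom k w)); split; last exact: IHk.
apply: seqmap_comp f1f _.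
by apply: (tr_hom_seqmap H') => //; exact: fg_syzn.
Qed.

End Fixed.

Lemma unpres_ex X : fg X ->
  exists q : {linear dual o' (dual o (freecover X)) -> X},
    rex (dualmap o' (dualmap o (pres_map X))) q /\
    forall (l : dual o' (dual o (freecover X))) x,
      (forall w, l w = o' (w x)) -> q l = cover X x.
Proof.
move=> Xfg; have Fp := fgproj_freecover X.
have [s sE] := choice (fun l : dual o' (dual o (freecover X)) => bidual_onto H l Fp).
have sep x y : (forall w : dual o (freecover X), o' (w x) = o' (w y)) -> x = y.
  move=> xy; apply/subr0_eq/(dual_separated (o := o) Fp) => w.
  by apply: (o'_eq0 H); rewrite linearB antiB xy subrr.
have [|t tE] := @ex_linear A (dual o' (dual o (freecover X))) (freecover X) s.
  move=> a l l'; apply: sep => w; rewrite -sE linearP antiD -(sE l').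
  rewrite -[LHS]/((l w : B) * o' a + l' w); congr (_ + _).
  by rewrite sE -antiM.
exists (cover X \o t); split; last first.
  by move=> l x lE; rewrite /= tE; congr (cover X _); apply: sep => w; rewrite -sE.
split; last first.
  move=> x; have [y <-] := freecover_onto Xfg x; have [e eE] := ev_ex H y.
  by exists e; rewrite /= tE; congr (cover X _); apply: sep => w; rewrite -sE.
move=> l; split=> [/= /((rex_pres H Xfg).1)[x xE]|[k <-]].
  have [e eE] := ev_ex H x; exists e; apply: dual_ext => w.
  by rewrite dualE eE dualE xE tE -sE.
have [x xE] := bidual_onto H k (fgproj_freecover (syz X)).
apply/(rex_pres H Xfg).1; exists x; rewrite tE; apply: sep => w.
by rewrite -sE dualE xE dualE.
Qed.

(** The dual of the dual of the cover of [X] is that cover again, so [X] is a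
    transpose of [tr X] for the presentation of [tr X] that is dual to the one
    of [X]. *)
Definition unpres_spec X (q : {linear dual o' (dual o (freecover X)) -> X}) :=
  rex (dualmap o' (dualmap o (pres_map X))) q /\
    forall (l : dual o' (dual o (freecover X))) x,
      (forall w, l w = o' (w x)) -> q l = cover X x.

Definition unpres X := choose_linear (@unpres_spec X).

Lemma unpresP X : fg X -> unpres_spec (unpres X).
Proof. by move=> Xfg; exact: (choose_linearP (unpres_ex Xfg)). Qed.

Let DF X : fgproj (dual o (freecover X)).
Proof. exact: dual_fgproj H _ (fgproj_freecover X). Qed.

(** [X] and [tr (tr X)] are transposes of the same module for two
    presentations; [e] lies over the identity of [tr X], so it is a stable
    isomorphism and natural. *)
Definition unit_spec X (e : {linear X -> tr o' (tr o X)}) : Prop :=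
  tr_rel (pres_map (tr o X)) (cover (tr o X)) (trq o' (tr o X))
    (dualmap o (pres_map X)) (trq o X) (unpres X) idfun e.

Lemma unit_ex X : fg X -> exists e, @unit_spec X e.
Proof.
move=> Xfg; have Tfg := tr_fg H X.
exact: (tr_rel_ex (fgproj_freecover _) (fgproj_freecover _)
  (rex_pres H' Tfg) (rex_trq o' _) (rex_trq o X) (unpresP Xfg).1).
Qed.

Definition unit X := choose_linear (@unit_spec X).

Lemma unitP X : fg X -> unit_spec (unit X).
Proof. by move=> Xfg; exact: (choose_linearP (unit_ex Xfg)). Qed.

Lemma unit_iso X : fg X -> stable_iso (unit X).
Proof.
move=> Xfg; have Tfg := tr_fg H X; have eP := unitP Xfg.
have [q0 _] := unpresP Xfg.
have [e' e'P] := tr_rel_ex (DF X) (DF (syz X))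
  (rex_trq o X) q0 (rex_pres H' Tfg) (rex_trq o' _) idfun.
exists e'; split.
  exact: (tr_rel_steq H' (DF X) (DF (syz X)) (rex_trq o X) q0 (rex_trq o X) q0
    (tr_rel_comp e'P eP) (tr_rel_id _ _ _) (steq_refl _)).
exact: (tr_rel_steq H' (fgproj_freecover _) (fgproj_freecover _)
  (rex_pres H' Tfg) (rex_trq o' _) (rex_pres H' Tfg) (rex_trq o' _)
  (tr_rel_comp eP e'P) (tr_rel_id _ _ _) (steq_refl _)).
Qed.

Lemma unit_natural X X' (u : {linear X' -> X}) : fg X -> fg X' ->
  stable_eq (unit X \o u) (tr_hom o' (tr_hom o u) \o unit X').
Proof.
move=> Xfg X'fg; have Tfg := tr_fg H X; have T'fg := tr_fg H X'.
have [q0 qE] := unpresP Xfg; have [q0' qE'] := unpresP X'fg.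
have [h0 [h1 [E0 E1 E2]]] := tr_homP H u X'fg Xfg.
have uP : tr_rel (dualmap o (pres_map X)) (trq o X) (unpres X)
    (dualmap o (pres_map X')) (trq o X') (unpres X') (tr_hom o u) u.
  exists (dualmap o h1), (dualmap o h0); split=> [f|f|l].
  - by rewrite E2.
  - by apply: dual_ext => x; rewrite !dualE E1.
  have [x xE] := bidual_onto H l (fgproj_freecover X').
  rewrite (qE' _ _ xE) -[LHS]E0; apply/esym/qE => w.
  by rewrite dualE xE dualE.
exact: (tr_rel_steq H' (fgproj_freecover _) (fgproj_freecover _)
  (rex_pres H' Tfg) (rex_trq o' _) (rex_trq o X') q0'
  (tr_rel_comp (unitP Xfg) uP)
  (tr_rel_comp (tr_homP H' (tr_hom o u) Tfg T'fg) (unitP X'fg))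
  (steq_refl _)).
Qed.

Variable i : nat.

(** The correspondence of the adjunction, as a relation: shift [f] by [i]
    steps to a map on [tr (tr X)] and compose with the stable isomorphism from
    [X]. *)
Definition adj_rel X Y (f : {linear tr_syz_tr o o' i X -> Y})
    (h : {linear X -> syzn i Y}) : Prop :=
  exists g : {linear tr o' (tr o X) -> syzn i Y},
    @linked (tr o X) Y i 0 i f g /\ stable_eq h (g \o unit X).

Lemma adj_rel_exl X Y (f : {linear tr_syz_tr o o' i X -> Y}) :
  fg X -> fg Y -> exists h, adj_rel f h.
Proof.
move=> Xfg Yfg.
have [g gE] := @linked_exl (tr o X) Y (tr_fg H X) Yfg i 0 i f (addn0 i).
by exists (g \o unit X), g; split=> //; exact: steq_refl.
Qed.

Lemma adj_rel_exr X Y (h : {linear X -> syzn i Y}) :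
  fg X -> fg Y -> exists f, @adj_rel X Y f h.
Proof.
move=> Xfg Yfg; have [e' [e'e ee']] := unit_iso Xfg.
have [f fE] := @linked_exr (tr o X) Y (tr_fg H X) Yfg i 0 i (h \o e') (addn0 i).
exists f, (h \o e'); split=> //.
exact: steq_sym (steq_comp (steq_refl h) e'e).
Qed.

Lemma adj_rel_steq X Y (f f' : {linear tr_syz_tr o o' i X -> Y}) h h' :
  fg X -> fg Y -> adj_rel f h -> adj_rel f' h' -> stable_eq f f' <-> stable_eq h h'.
Proof.
move=> Xfg Yfg [g [fg_ hg]] [g' [fg' hg']].
have gg' := linked_steq (tr_fg H X) Yfg fg_ fg'.
split=> [/gg' e|e].
  apply: steq_trans hg (steq_trans _ (steq_sym hg')).
  exact: steq_comp e (steq_refl _).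
apply/gg'; have [e' [e'e ee']] := unit_iso Xfg.
have e1 : stable_eq (g \o unit X) (g' \o unit X).
  by apply: steq_trans (steq_sym hg) (steq_trans e hg').
apply: steq_trans (steq_sym (steq_comp (steq_refl g) ee')) _.
apply: steq_trans (steq_comp (steq_refl g') ee').
exact: (steq_comp e1 (steq_refl e')).
Qed.

Definition adj_map X Y (f : {linear tr_syz_tr o o' i X -> Y}) :=
  choose_linear (adj_rel f).

Lemma adj_mapP X Y (f : {linear tr_syz_tr o o' i X -> Y}) :
  fg X -> fg Y -> adj_rel f (adj_map f).
Proof. by move=> Xfg Yfg; exact: (choose_linearP (adj_rel_exl f Xfg Yfg)). Qed.

Lemma syz_adjunction : stable_adjunction (@tr_syz_tr_hom A B o o' i)
  (fun X Y => @syzn_hom A i X Y).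
Proof.
exists adj_map.
- move=> X Y f g Xfg Yfg; exact: adj_rel_steq (adj_mapP f Xfg Yfg) (adj_mapP g Xfg Yfg).
- move=> X Y h Xfg Yfg; have [f fh] := adj_rel_exr h Xfg Yfg; exists f.
  by apply/(adj_rel_steq Xfg Yfg (adj_mapP f Xfg Yfg) fh); exact: steq_refl.
- move=> X' X Y u f X'fg Xfg Yfg; have Tfg := tr_fg H X; have T'fg := tr_fg H X'.
  apply/(adj_rel_steq X'fg Yfg (adj_mapP _ X'fg Yfg) (f' := f \o tr_syz_tr_hom o o' i u)); last exact: steq_refl.
  have [g [fg_ hg]] := adj_mapP f Xfg Yfg.
  exists (g \o tr_hom o' (tr_hom o u)); split.
    exact: (linked_precomp Tfg (tr_hom o u) T'fg fg_).
  apply: steq_trans (steq_comp hg (steq_refl u)) _.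
  exact: (steq_comp (steq_refl g) (unit_natural u Xfg X'fg)).
- move=> X Y Y' f v Xfg Yfg Y'fg; have Tfg := tr_fg H X.
  apply/(adj_rel_steq Xfg Y'fg (adj_mapP _ Xfg Y'fg) (f' := v \o f)); last exact: steq_refl.
  have [g [fg_ hg]] := adj_mapP f Xfg Yfg.
  exists (syzn_hom i v \o g); split.
    exact: (linked_postcomp Yfg v Y'fg fg_).
  exact: (steq_comp (steq_refl _) hg).
Qed.

End Linked.

(** * The counit *)

Section Counit.
Variables (A B : pzRingType) (o : antiiso B A) (o' : antiiso A B).
Hypothesis H : noeth_duality o o'.
Implicit Types U V X Y Z K P Q M N W : lmodType A.

Let AN : left_noetherian A. Proof. by case: H. Qed.

(** The difference of the two maps factors through a projective, which is
    added to the target. *)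
Lemma rep_by_monos_steq X M (f f' : {linear X -> M}) :
  stable_eq f f' -> rep_by_monos f -> rep_by_monos f'.
Proof.
move=> [S [a [b [Sp fE]]]] /rep_by_monosP[Q [t [Qp ft]]].
apply/rep_by_monosP; exists (Q * S)%type, (pair_map t a).
split=> [|x f'x [tx ax]]; first exact: fgproj_prod.
by apply: ft => //; apply/eqP; rewrite -[f x]subr0 -f'x; apply/eqP; rewrite [LHS]fE ax linear0.
Qed.

Lemma rep_by_monos_iso X Y M (f : {linear Y -> M}) (k : {linear X -> Y}) :
  stable_iso k -> rep_by_monos f -> rep_by_monos (f \o k).
Proof.
move=> [k' [[S [a [b [Sp kE]]]] _]] /rep_by_monosP[Q [t [Qp ft]]].
apply/rep_by_monosP; exists (Q * S)%type, (pair_map (t \o k) a).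
split=> [|x fx [tx ax]]; first exact: fgproj_prod.
have kx : k x = 0 by apply: ft.
by have := kE x; rewrite /= kx ax !linear0 sub0r => /eqP; rewrite oppr_eq0 => /eqP.
Qed.

Lemma rep_by_monos_comp_iso X Y M (f : {linear Y -> M}) (k : {linear X -> Y}) :
  stable_iso k -> rep_by_monos (f \o k) -> rep_by_monos f.
Proof.
move=> [k' [k'k kk']] fk; apply: (rep_by_monos_steq (f := (f \o k) \o k')).
  exact: (steq_comp (steq_refl f) kk').
by apply: rep_by_monos_iso fk; exists k.
Qed.

Lemma stable_rep_by_monosE X M (f : {linear X -> M}) :
  stable_rep_by_monos f <-> rep_by_monos f.
Proof.
split=> [[f' [ff' f'm]]|fm]; first exact: rep_by_monos_steq (steq_sym ff') f'm.
by exists f; split=> //; exact: steq_refl.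
Qed.

(** As long as Ext^1 of [syzn i X] vanishes, its inclusion in the cover is a
    left projective approximation, so that maps of sequences can be followed
    in both directions. *)
Lemma syzn_full_faithful i X N : fg X -> fg N -> ext_vanish o i X ->
  (forall f f' : {linear X -> N},
     stable_eq (syzn_hom i f) (syzn_hom i f') -> stable_eq f f') /\
  (forall g : {linear syzn i X -> syzn i N},
     exists f : {linear X -> N}, stable_eq (syzn_hom i f) g).
Proof.
move=> Xfg Nfg; elim: i => [|i IHi] Xi.
  by split=> // g; exists g; exact: steq_refl.
have [|IHf IHg] := IHi.
  by move=> j /andP[j0 ji]; apply: Xi; rewrite j0 leqW.
have Xifg : fg (syzn i X) by exact: fg_syzn.
have Nifg : fg (syzn i N) by exact: fg_syzn.
have sA : left_proj_approx (syzi (syzn i X)).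
  apply/approxP; split; first exact: fgproj_freecover.
  by apply/(ext1_zeroP H Xifg); rewrite -ext_zeroSE; apply: Xi; rewrite ltnSn.
have rX := ses_rex (ses_syz Xifg); have rN := ses_rex (ses_syz Nifg).
have Fp := fgproj_freecover (syzn i N).
split=> [f f' /= ff'|g].
  apply: IHf; exact: (seqmap_steqr sA rX Fp rN
    (syz_homP _ Xifg Nifg) (syz_homP _ Xifg Nifg) ff').
have [f1 f1g] := seqmap_exr sA rX Fp rN g.
have [f ff1] := IHg f1; exists f.
exact: (seqmap_steql (fgproj_freecover _) rX (ses_syz Nifg)
  (syz_homP _ Xifg Nifg) f1g ff1).
Qed.

Section Adjunction.
Variables (i : nat) (L : lmodType A -> lmodType A).
Variable Lhom : forall X Y, {linear X -> Y} -> {linear L X -> L Y}.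
Variable a : stable_adjunction Lhom (fun X Y => @syzn_hom A i X Y).
Hypothesis Lfg : forall X, fg X -> fg (L X).

Let R X := syzn i X.
Let Rfg X : fg X -> fg (R X). Proof. exact: fg_syzn. Qed.

Lemma syzn_hom_comp M N X (f : {linear M -> N}) (g : {linear X -> M}) :
  fg M -> fg N -> fg X ->
  stable_eq (syzn_hom i (f \o g)) (syzn_hom i f \o syzn_hom i g).
Proof.
move=> Mfg Nfg Xfg; elim: i => [|k IHk] /=; first exact: steq_refl.
have [Mk Nk Xk] : [/\ fg (syzn k M), fg (syzn k N) & fg (syzn k X)].
  by split; exact: fg_syzn.
apply: steq_trans (syz_hom_comp (syzn_hom k f) (syzn_hom k g) Xk Mk Nk).
exact: syz_hom_steq.
Qed.

Lemma syzn_hom_id M : fg M -> stable_eq (syzn_hom i (idfun : {linear M -> M})) idfun.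
Proof.
move=> Mfg; elim: i => [|k IHk] /=; first exact: steq_refl.
have Mk : fg (syzn k M) by exact: fg_syzn.
apply: steq_trans (syz_hom_steq Mk Mk IHk) _.
exact: (seqmap_steql (fgproj_freecover _) (ses_rex (ses_syz Mk)) (ses_syz Mk)
  (syz_homP _ Mk Mk) (seqmap_id _ _) (steq_refl _)).
Qed.

(** Naturality at the identity of [L Y]: [Lhom u] corresponds to [u] followed
    by the unit.  The functoriality of [L] on stable maps follows from this,
    because the unit determines [Lhom]. *)
Lemma adj_left X Y (u : {linear X -> Y}) : fg X -> fg Y ->
  stable_eq (adj a (Lhom u)) (adj a (idfun : {linear L Y -> L Y}) \o u).
Proof.
move=> Xfg Yfg; have := adj_natl a u (idfun : {linear L Y -> L Y}) Xfg Yfg (Lfg Yfg).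
apply: steq_trans; apply/(adj_eq a _ _ Xfg (Lfg Yfg)); exact: steq_refl.
Qed.

Lemma left_adjoint_comp X Y Z (v : {linear Y -> Z}) (u : {linear X -> Y}) :
  fg X -> fg Y -> fg Z -> stable_eq (Lhom v \o Lhom u) (Lhom (v \o u)).
Proof.
move=> Xfg Yfg Zfg; apply/(adj_eq a _ _ Xfg (Lfg Zfg)).
apply: steq_trans (adj_natl a _ _ Xfg Yfg (Lfg Zfg)) _.
apply: steq_trans (steq_comp (adj_left v Yfg Zfg) (steq_refl u)) _.
exact: steq_sym (adj_left (v \o u) Xfg Zfg).
Qed.

Lemma left_adjoint_steq X Y (u v : {linear X -> Y}) :
  fg X -> fg Y -> stable_eq u v -> stable_eq (Lhom u) (Lhom v).
Proof.
move=> Xfg Yfg uv; apply/(adj_eq a _ _ Xfg (Lfg Yfg)).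
apply: steq_trans (adj_left u Xfg Yfg) _.
apply: steq_trans (steq_sym (adj_left v Xfg Yfg)).
exact: steq_comp (steq_refl _) uv.
Qed.

Lemma left_adjoint_id X : fg X ->
  stable_eq (Lhom (idfun : {linear X -> X})) idfun.
Proof.
move=> Xfg; apply/(adj_eq a _ _ Xfg (Lfg Xfg)).
exact: (adj_left idfun Xfg Xfg).
Qed.

Lemma left_adjoint_iso X Y (u : {linear X -> Y}) : fg X -> fg Y ->
  stable_iso u -> stable_iso (Lhom u).
Proof.
move=> Xfg Yfg [v [vu uv]]; exists (Lhom v); split.
  apply: steq_trans (left_adjoint_comp v u Xfg Yfg Xfg) _.
  exact: steq_trans (left_adjoint_steq Xfg Xfg vu) (left_adjoint_id Xfg).
apply: steq_trans (left_adjoint_comp u v Yfg Xfg Yfg) _.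
exact: steq_trans (left_adjoint_steq Yfg Yfg uv) (left_adjoint_id Yfg).
Qed.

(** Since [R] is full on maps out of [X], the unit at [R X] is [R] of a map
    [s : X -> L (R X)]; by the triangle identities and faithfulness, [s] is
    inverse to the counit. *)
Lemma counit_iso X (e : {linear L (R X) -> X}) : fg X -> ext_vanish o i X ->
  is_counit a e -> stable_iso e.
Proof.
move=> Xfg X0 eE; have RXfg := Rfg Xfg; have LRfg := Lfg RXfg.
have [_ full] := syzn_full_faithful Xfg LRfg X0.
have [faith _] := syzn_full_faithful Xfg Xfg X0.
have [s sE] := full (adj a (idfun : {linear L (R X) -> L (R X)})).
exists s; split.
  apply/(adj_eq a _ _ RXfg LRfg).
  apply: steq_trans (adj_natr a e s RXfg Xfg LRfg) _.
  exact: (steq_comp sE eE).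
apply: faith; apply: steq_trans (syzn_hom_comp e s LRfg Xfg Xfg) _.
apply: steq_trans (steq_comp (steq_refl _) sE) _.
apply: steq_trans (steq_sym (adj_natr a idfun e RXfg LRfg Xfg)) _.
apply: steq_trans (steq_sym (syzn_hom_id Xfg)).
apply: steq_trans eE; apply/(adj_eq a _ _ RXfg Xfg); exact: steq_ext.
Qed.

(** By naturality of the counit [e \o L (R f)] is [f \o eX], where [eX] is the
    counit at [X]; both [L (R f)] and [eX] are stable isomorphisms. *)
Lemma counit_compare X M (f : {linear X -> M}) (e : {linear L (R M) -> M}) :
  fg X -> fg M -> ext_vanish o i X -> stable_iso (syzn_hom i f) ->
  is_counit a e ->
  exists k : {linear L (R M) -> X}, stable_iso k /\ stable_eq e (f \o k).
Proof.
move=> Xfg Mfg X0 fI eE.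
have RXfg := Rfg Xfg; have RMfg := Rfg Mfg; have LRfg := Lfg RXfg.
have [eX eXE] := adj_surj a (idfun : {linear R X -> R X}) RXfg Xfg.
have eXI := counit_iso Xfg X0 eXE.
have LI := left_adjoint_iso RXfg RMfg fI; have [l [lL Ll]] := LI.
have sq : stable_eq (e \o Lhom (syzn_hom i f)) (f \o eX).
  apply/(adj_eq a _ _ RXfg Mfg).
  apply: steq_trans (adj_natl a _ _ RXfg RMfg Mfg) _.
  apply: steq_trans (steq_comp eE (steq_refl _)) _.
  apply: steq_sym; apply: steq_trans (adj_natr a _ _ RXfg Xfg Mfg) _.
  exact: (steq_comp (steq_refl _) eXE).
exists (eX \o l); split.
  by apply: stable_iso_comp => //; exists (Lhom (syzn_hom i f)).
apply: steq_trans (steq_sym (steq_comp (steq_refl e) Ll)) _.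
exact: (steq_comp sq (steq_refl l)).
Qed.

End Adjunction.

Lemma psiP i M : fg M ->
  exists a : stable_adjunction (@tr_syz_tr_hom A B o o' i) (fun X Y => @syzn_hom A i X Y),
    is_counit a (psi o o' i M).
Proof.
move=> Mfg; apply: (choose_linearP (Q := fun f => exists a : stable_adjunction
  (@tr_syz_tr_hom A B o o' i) (fun X Y => @syzn_hom A i X Y), is_counit a f)).
have a := syz_adjunction H i.
have [f fE] := adj_surj a (idfun : {linear syzn i M -> syzn i M}) (fg_syzn i AN Mfg) Mfg.
by exists f, a.
Qed.

(** Up to stable isomorphism of sources the counit at [M] is [f], whichever
    adjunction it belongs to. *)
Lemma psi_rep_by_monos i X M (f : {linear X -> M}) : fg X -> fg M ->
  ext_vanish o i X -> iso_after i f ->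
  stable_rep_by_monos (psi o o' i M) <-> rep_by_monos f.
Proof.
move=> Xfg Mfg X0 /iso_after_syzn fI; have [a aE] := psiP i Mfg.
have Lfg N : fg N -> fg (tr_syz_tr o o' i N).
  by move=> _; exact: tr_fg (noeth_duality_sym H) _.
have [k [kI kE]] := counit_compare Lfg Xfg Mfg X0 fI aE.
rewrite stable_rep_by_monosE; split=> [/(rep_by_monos_steq kE)|fm].
  exact: rep_by_monos_comp_iso.
by apply: (rep_by_monos_steq (steq_sym kE)); exact: rep_by_monos_iso.
Qed.

End Counit.

(** * Grade conditions and the counit *)

Section Conditions12.
Variables (A B : pzRingType) (o : antiiso B A) (o' : antiiso A B).
Hypothesis H : noeth_duality o o'.
Variable M : lmodType A.
Hypothesis Mfg : fg M.

Let AN : left_noetherian A. Proof. by case: H. Qed.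

Lemma cond12 n : cond1 o o' n M -> cond2 o o' n M.
Proof.
move=> Mg i i0n; split; first exact: grade_geW (leq_pred i) (Mg i i0n).
have [|Z [X [g [f [[Zfg Xfg gf Zi Xi] fm fI]]]]] := grade_good_approx H (n := i) Mfg.
  move=> j /andP[j0 ji]; apply: Mg; rewrite j0 (leq_trans ji) //.
  by case/andP: i0n.
by apply/(psi_rep_by_monos H Xfg Mfg Xi fI).
Qed.

Lemma syz_grade n : (forall i, (1 <= i <= n.+1)%N -> grade_ge o' i.-1 (ext o i M)) ->
  cond1 o o' n (syz M).
Proof.
move=> Mg [//|j] jn; have Efg := ext_fg H j.+2 Mfg.
apply: (grade_isom H Efg (isom_sym (ext_syz_shift H j Mfg))).
exact: (Mg j.+2).
Qed.

(** Induction on the degree.  The weak grade bounds for [M] are [cond1] of one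
    order less for [syz M], so [approx_step] provides an approximation of [M]
    of the order in question, and the counit tells that it is represented by
    monomorphisms.  In the resulting origin extension Ext^j of [Y] is Ext^j of
    [M], and [grade_top] raises the last grade. *)
Lemma cond21 n : cond2 o o' n M -> cond1 o o' n M.
Proof.
move=> Mm i; elim/ltn_ind: i => -[//|i] IHi iin.
have lein j : (1 <= j <= i.+1)%N -> (1 <= j <= n)%N.
  by case/andP=> j0 ji; rewrite j0 (leq_trans ji); case/andP: iin.
have [Z0 [X0 [g0 [f0 [gf0 fm0 fI0]]]]] : good_approx o i (syz M).
  apply: (grade_good_approx H (fg_syz M AN)); apply: syz_grade => j ji.
  by have [] := Mm j (lein j ji).
have [Z [X [g [f [gf fI]]]]] := approx_step H Mfg gf0 fm0 fI0.
have [Zfg Xfg sgf Zi Xi] := gf.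
have fm : rep_by_monos f.
  by apply/(psi_rep_by_monos H Xfg Mfg Xi fI); have [] := Mm _ iin.
have [P [s sA]] := approx_ex H Xfg.
have [_ oe] := origin_of_approx gf fm sA.
have [Xo [Po [Yo [fo [go [oe' /dual_ses dS]]]]]] := origin_dual H Mfg oe.
have [Xofg Pp Yofg fgo [Yn Xn]] := oe'.
have fA := dS fgo.
have eY j : (1 <= j <= i.+1)%N -> isom (ext o j Yo) (ext o j M).
  by move=> ji; exact: (origin_ext_isom H Mfg oe' fA ji).
have Ei := ext_fg H i.+1 Yofg.
apply: (grade_isom H Ei (eY i.+1 _)); first by rewrite ltnSn.
apply: (grade_top H Yofg Yn) => // j /andP[j0 ji].
have jj : (1 <= j <= i.+1)%N by rewrite j0 ltnW.
apply: (grade_isom H (ext_fg H j Mfg) (isom_sym (eY j jj))).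
by have [] := Mm j (lein j jj).
Qed.

End Conditions12.

(** * Spherical filtrations *)

Section Filtrations.
Variables (A B : pzRingType) (o : antiiso B A) (o' : antiiso A B).
Hypothesis H : noeth_duality o o'.
Implicit Types U V W X Y Z K P Q M N C : lmodType A.

Let AN : left_noetherian A. Proof. by case: H. Qed.

Definition image_sub U V (f : {linear U -> V}) : submodClosed V := linimg f.

Lemma image_subP U V (f : {linear U -> V}) v :
  reflect (exists x, f x = v) (v \in image_sub f).
Proof. exact: mem_linimg. Qed.

Definition stage k V (D E : submodClosed V) : Prop :=
  [/\ ext_vanish o k (submod E), spherical o k (subquot D E)
    & forall u : dual o (submod E), exists v : dual o (submod D),
        forall x y, subincl x = subincl y -> v x = u y].

Lemma ses_sub V (D E : submodClosed V) : {subset E <= D} ->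
  exists (a : {linear submod E -> submod D}) (q : {linear submod D -> subquot D E}),
    ses a q /\ forall x, subincl (a x) = subincl x.
Proof.
move=> ED.
have [a aE] : exists a : {linear submod E -> submod D},
    forall x, @subincl _ _ D (a x) = @subincl _ _ E x.
  apply: factor_inj => [|x]; first exact: subincl_inj.
  exact/subinclP/ED/subincl_mem.
exists a, (quotproj _); split=> //; split.
- by move=> x y xy; apply: subincl_inj; rewrite -!aE xy.
- move=> y; rewrite quotproj0; split=> [yE|[x <-]].
    have /subinclP[x xE] : subincl y \in E by exact: yE.
    by exists x; apply: subincl_inj; rewrite aE.
  by rewrite inE /= aE; exact: subincl_mem.
- exact: quotproj_onto.
Qed.

Lemma ses_third V (D E : submodClosed V) : {subset E <= D} ->
  exists (a : {linear subquot D E -> quotmod E}) (q : {linear quotmod E -> quotmod D}),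
    ses a q.
Proof.
move=> ED.
have [a aE] : exists a : {linear subquot D E -> quotmod E},
    forall x, a (quotproj _ x) = (quotproj E \o @subincl _ _ D) x.
  apply: factor_onto => [|x /quotproj0 x0]; first exact: quotproj_onto.
  by apply/quotproj0.
have [q qE] : exists q : {linear quotmod E -> quotmod D},
    forall x, q (quotproj E x) = quotproj D x.
  apply: factor_onto => [|x /quotproj0 x0]; first exact: quotproj_onto.
  by apply/quotproj0/ED.
exists a, q; split.
- apply: linear_inj0 => x; case: (quotprojP x) => y ->.
  by rewrite aE => /quotproj0 y0; apply/quotproj0.
- move=> y; case: (quotprojP y) => v ->; rewrite qE quotproj0; split.
    by move=> /subinclP[x <-]; exists (quotproj _ x); rewrite aE.
  move=> [x]; case: (quotprojP x) => z ->; rewrite aE => /eqP.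
  rewrite eq_sym quotproj_eq => /ED vz.
  by rewrite -[v](subrK (subincl z)) rpredD// subincl_mem.
- by move=> z; case: (quotprojP z) => v ->; exists (quotproj E v).
Qed.

Lemma ext_vanish_isom k X Y : fg X -> isom X Y ->
  ext_vanish o k X -> ext_vanish o k Y.
Proof.
move=> Xfg XY X0 [//|j] jk; have Yfg := isom_fg XY Xfg.
exact: (isom_zero (ext_steqv H j Xfg Yfg (isom_steqv XY)) (X0 j.+1 jk)).
Qed.

Lemma spherical_isom k X Y : isom X Y -> spherical o k X -> spherical o k Y.
Proof.
move=> XY [Xfg Xk X0]; have Yfg := isom_fg XY Xfg; split=> //.
  exact: pd_lt_isom XY Xk.
move=> [//|j] j0 jk.
exact: (isom_zero (ext_steqv H j Xfg Yfg (isom_steqv XY)) (X0 j.+1 j0 jk)).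
Qed.

(** Reads off the [k]-th step from an exact sequence [X1 -> V1 -> Y1] that is
    carried isomorphically to [E], [D] and [D / E] by [e]. *)
Lemma stage_intro k V (D E : submodClosed V) X1 V1 Y1
    (a : {linear X1 -> V1}) (b : {linear V1 -> Y1}) (e : {linear V1 -> V}) :
  fg V1 -> injective e -> ses a b ->
  (forall v, v \in D <-> exists x, e x = v) ->
  (forall v, v \in E <-> exists x, e (a x) = v) ->
  ext_vanish o k X1 -> spherical o k Y1 -> (forall u, extends a u) ->
  stage k D E.
Proof.
move=> Vfg eI ab eD eE X0 Y0 aA; have [aI abE bO] := ab.
have Xfg : fg X1 := ses_fgl AN ab Vfg.
have [d dE] : exists d : {linear V1 -> submod D}, forall x, @subincl _ _ D (d x) = e x.
  apply: factor_inj => [|x]; first exact: subincl_inj.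
  by apply/subinclP/eD; exists x.
have [c cE] : exists c : {linear X1 -> submod E}, forall x, @subincl _ _ E (c x) = (e \o a) x.
  apply: factor_inj => [|x]; first exact: subincl_inj.
  by apply/subinclP/eE; exists x.
have dO : onto d.
  move=> y; have /eD[x xE] := subincl_mem y; exists x.
  by apply: subincl_inj; rewrite dE.
have dI : injective d by move=> x y xy; apply: eI; rewrite -!dE xy.
have cO : onto c.
  move=> y; have /eE[x xE] := subincl_mem y; exists x.
  by apply: subincl_inj; rewrite cE.
have cI : injective c by move=> x y xy; apply/aI/eI; rewrite -[LHS]cE xy cE.
split.
- by apply: ext_vanish_isom X0 => //; exists c.
- apply: spherical_isom Y0.
  apply: (isom_of_onto (g := quotproj (preim_sub (@subincl _ _ D) E) \o d) bO).
    by move=> y; case: (quotprojP y) => z ->; have [x <-] := dO z; exists x.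
  move=> x; rewrite /= quotproj0 abE inE /= dE eE.
  by split=> -[y yE]; exists y; [rewrite yE | apply: eI].
move=> u; have [d' [dK d'K]] := linear_inverse dI dO.
have [v vE] := aA (u \o c); exists (v \o d') => x y xy.
have [y1 y1E] := cO y; rewrite -y1E; apply: etrans (esym (vE y1)).
congr (v _); apply: dI.
by apply: subincl_inj; rewrite d'K dE xy -y1E cE.
Qed.

(** Here [k] steps are done and [m] remain; [N] is the module reached, with
    vanishing Ext^1, ..., Ext^k.  A dual-exact origin extension of order
    [k + 1] embeds the next module [X] in [N * P'] with quotient [Y].  For
    [1 <= j <= k], Ext^j of [Y] is Ext^j of [N], so it vanishes and [Y] is
    [(k+1)]-spherical; for [j > k + 1], Ext^j of [X] is Ext^j of [N] because
    [Y] has projective dimension at most [k + 1].  So the grade hypotheses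
    pass to [X]. *)
Lemma filtration_ex m k N : fg N -> ext_vanish o k N ->
  (forall j, (k < j <= k + m)%N -> grade_ge o' j (ext o j N)) ->
  exists (P : lmodType A) (F : nat -> submodClosed (N * P)%type),
    [/\ fgproj P, F 0 =i predT, forall j, (j < m)%N -> {subset F j.+1 <= F j}
      & forall j, (1 <= j <= m)%N -> stage (k + j) (F j.-1) (F j)].
Proof.
elim: m k N => [|m IHm] k N Nfg N0 Ng.
  exists 'rV[A]_0, (fun=> image_sub idfun); split=> //; first exact: fgproj_row.
    by move=> x; apply/image_subP; exists x.
  by case.
have Nc1 : cond1 o o' k.+1 N.
  move=> j /andP[j0 jk]; have [jk'|kj] := leqP j k.
    by apply: (grade_of_zero H); apply: N0; rewrite j0.
  by apply: Ng; rewrite kj (leq_trans jk)// -addSnnS leq_addr.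
have [Z0 [X0 [g0 [f0 [gf0 fm0 _]]]]] := grade_good_approx H Nfg Nc1.
have [_ X0fg _ _ _] := gf0; have [Q [s sA]] := approx_ex H X0fg.
have [_ oe0] := origin_of_approx gf0 fm0 sA.
have [X [P' [Y [f [g [oe /dual_ses dS]]]]]] := origin_dual H Nfg oe0.
have [Xfg Pp Yfg fg_ [Yn Xn]] := oe; have fA := dS fg_.
have [Pfg _] := Pp; have NPfg := fg_prod Nfg Pfg.
have [|P2 [F2 [P2p F20 F2S F2s]]] := IHm k.+1 X Xfg Xn.
  move=> [//|j] /andP[kj jkm].
  have Nfgj := ext_fg H j.+1 Nfg.
  have j0 : forall l, (j < l)%N -> ext_zero o l Y.
    move=> l jl; apply: (pd_ext_zero H Yfg Yn); last exact: leq_ltn_trans jl.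
    exact: leq_trans kj jl.
  apply: (grade_isom H Nfgj (E' := ext o j.+1 X)); last first.
    by apply: Ng; rewrite (ltnW kj) -addSnnS.
  apply: isom_trans (isom_sym (ext_steqv H j NPfg Nfg (steqv_prodr N Pp))) _.
  by apply: (ext_left_iso H Xfg NPfg Yfg fg_); apply: j0.
have [P2fg _] := P2p; have [fI gE gO] := fg_.
(* The filtration of [X * P2] is carried into [N * (P' * P2)] by [h], the
   inclusion of [X] on the first factor and the identity of [P2]. *)
pose P := (P' * P2)%type.
pose h : {linear (X * P2)%type -> (N * P)%type} :=
  pair_map (fst \o f \o fst) (pair_map (snd \o f \o fst) snd).
pose b : {linear (N * P)%type -> Y} := g \o pair_map fst (fst \o snd).
have hI : injective h.
  move=> [x p] [y q] [/= xy1 xy2 ->]; congr (_, _); apply: fI.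
  by rewrite [LHS]surjective_pairing xy1 xy2 -surjective_pairing.
have hb : ses h b.
  split=> //.
  - move=> [n [p q]]; rewrite -[b _]/(g (n, p)) gE; split=> [[x xE]|[[x q'] [<- <- _]]].
      by exists (x, q); rewrite -[h _]/((f x).1, ((f x).2, q)) xE.
    by exists x; case: (f x).
  - by move=> y; have [[n p] <-] := gO y; exists (n, (p, 0)).
pose F j : submodClosed (N * P)%type :=
  if j is j'.+1 then image_sub (h \o @subincl _ _ (F2 j')) else image_sub idfun.
have FS j x : reflect (exists2 y, y \in F2 j & h y = x) (x \in F j.+1).
  apply: (iffP (image_subP _ _)) => [[y <-]|[y /subinclP[z <-] <-]].
    by exists (subincl y) => //; exact: subincl_mem.
  by exists z.
have F0 x : x \in F 0 by apply/image_subP; exists x.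
have NPPfg : fg (N * P)%type by do 2!apply: fg_prod => //.
exists P, F; split; first exact: fgproj_prod.
- by move=> x; rewrite F0.
- move=> [|j] jm x // /FS[y yF <-]; apply/FS; exists y => //.
  exact: F2S yF.
move=> [//|[|j]] jm.
  rewrite addn1; apply: (stage_intro (e := idfun) NPPfg _ hb) => //.
  - by move=> v; rewrite F0; split=> // _; exists v.
  - move=> v; split=> [/FS[y _ <-]|[y <-]]; first by exists y.
    by apply/FS; exists y => //; rewrite F20.
  - move=> [//|l] lk; have XPfg := fg_prod Xfg P2fg.
    apply: (isom_zero (isom_sym (ext_steqv H l XPfg Xfg (steqv_prodr X P2p)))).
    exact: Xn.
  - split=> // l l0 lk; apply: (isom_zero (isom_sym (origin_ext_isom H Nfg oe fA _))).
      by rewrite l0 ltnW.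
    by apply: N0; rewrite l0 -ltnS.
  - move=> u; have [v vE] := fA (u \o inl_map X P2).
    exists ((v \o pair_map fst (fst \o snd)) \+ (u \o inr_map X P2 \o snd \o snd)).
    move=> [x q]; rewrite copair_decomp; congr (_ + _).
    apply: etrans (vE x) _; rewrite -[RHS]/(v ((f x).1, (f x).2)).
    by rewrite -surjective_pairing.
rewrite -addSnnS; have [] := F2s j.+1 jm => S1 S2 S3.
have [a [q [aq aE]]] := ses_sub (F2S j jm).
have XPfg := fg_prod Xfg P2fg.
apply: (stage_intro (e := h \o @subincl _ _ (F2 j)) _ _ aq).
- exact: fg_inj AN (@subincl_inj _ _ _) XPfg.
- by move=> x y /hI/subincl_inj.
- move=> v; split=> [/FS[y /subinclP[z <-] <-]|[y <-]]; first by exists z.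
  by apply/FS; exists (subincl y) => //; exact: subincl_mem.
- move=> v; split=> [/FS[y /subinclP[z <-] <-]|[y <-]]; first by exists z; rewrite /= aE.
  by apply/FS; exists (subincl y); [exact: subincl_mem | rewrite /= aE].
- exact: S1.
- exact: S2.
- move=> u; have [v vE] := S3 u; exists v => x; apply/esym/vE; exact: aE.
Qed.

End Filtrations.

(** * The equivalences over a noetherian duality *)

Section Conditions.
Variables (A B : pzRingType) (o : antiiso B A) (o' : antiiso A B).
Hypothesis H : noeth_duality o o'.
Variables (n : nat) (M : lmodType A).
Hypothesis Mfg : fg M.

Let AN : left_noetherian A. Proof. by case: H. Qed.

Lemma cond1_3 : cond1 o o' n M -> cond3 o n M.
Proof.
move=> Mg; have [|j /= jn|P [F [Pp F0 FS Fs]]] := @filtration_ex A B o o' H n 0 M Mfg.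
- by case.
- exact: Mg.
by exists P, F.
Qed.

Section Filtered.
Variables (P : lmodType A) (F : nat -> submodClosed (M * P)%type).
Hypotheses (Pp : fgproj P) (F0 : F 0 =i predT).
Hypothesis FS : forall k, (k < n)%N -> {subset F k.+1 <= F k}.
Hypothesis Fs : forall k, (1 <= k <= n)%N -> stage o k (F k.-1) (F k).

Let MPfg : fg (M * P)%type. Proof. by apply: fg_prod => //; case: Pp. Qed.
Let Ffg k : fg (submod (F k)). Proof. exact: fg_inj AN (@subincl_inj _ _ _) MPfg. Qed.

Lemma filtered_extends j (a : {linear submod (F j.+1) -> submod (F j)}) :
  (j < n)%N -> (forall x, subincl (a x) = subincl x) -> forall u, extends a u.
Proof.
move=> jn aE u; have [_ _ /(_ u)[v vE]] := Fs (k := j.+1) jn.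
by exists v => x; apply/esym/vE; exact: aE.
Qed.

(** The quotients of the first [j] steps have projective dimension at most
    [j], so dividing them out does not change Ext^k. *)
Lemma filtered_ext j k : (j < k <= n)%N ->
  isom (ext o k (submod (F j))) (ext o k M).
Proof.
move=> /andP[jk kn]; case: k jk kn => // k; elim: j => [|j IHj] jk kn.
  have Pfg := Pp.1.
  apply: isom_trans (ext_steqv H k MPfg Mfg (steqv_prodr M Pp)).
  apply: (ext_steqv H k (Ffg 0) MPfg); apply: isom_steqv.
  exists (@subincl _ _ (F 0)); split; first exact: subincl_inj.
  by move=> x; apply/subinclP; rewrite F0.
apply: isom_trans (IHj (ltnW jk) kn).
have jn : (j < n)%N by exact: leq_trans (ltnW jk) kn.
have [a [q [aq aE]]] := ses_sub (FS jn).
have [_ [Cfg Cpd _] _] := Fs (k := j.+1) jn.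
apply: isom_sym; apply: (ext_left_iso H (Ffg _) (Ffg _) Cfg aq).
  by apply: (pd_ext_zero H Cfg Cpd).
by apply: (pd_ext_zero H Cfg Cpd) => //; exact: ltnW.
Qed.

(** Ext^k of [M] is that of the [k]-th quotient, since Ext^k of the next term
    vanishes and functionals extend.  In the spherical quotient the lower Ext
    groups are zero, so [grade_top] applies. *)
Lemma filtered_grade k : (1 <= k <= n)%N -> grade_ge o' k (ext o k M).
Proof.
case: k => // k kn; have [a [q [aq aE]]] := ses_sub (FS (k := k) kn).
have [X0 [Cfg Cpd C0] _] := Fs (k := k.+1) kn.
have Cg := ext_fg H k.+1 Cfg.
apply: (grade_isom H Cg (E := ext o k.+1 (subquot (F k) (F k.+1)))).
  apply: isom_trans (filtered_ext (j := k) (k := k.+1) _); last by rewrite ltnSn.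
  apply: (ext_right_iso H (Ffg _) (Ffg _) Cfg aq); last by apply: X0; rewrite ltnSn.
  case: k kn a q aq aE X0 Cfg Cpd C0 Cg => [|k] kn a q aq aE X0 Cfg Cpd C0 Cg.
    exact: filtered_extends aE.
  exact: (X0 k.+1 (leqnSn _)).
apply: (grade_top H Cfg Cpd) => // j /andP[j0 jk].
by apply: (grade_of_zero H); exact: C0.
Qed.

Lemma filtered_pd k : (k <= n)%N -> pd_le k (quotmod (F k)).
Proof.
elim: k => [|k IHk] kn.
  apply: pd_ltS => x; case: (quotprojP x) => v ->; apply/quotproj0.
  by rewrite F0.
have [a [q aq]] := ses_third (FS kn).
have [_ [_ Cpd _] _] := Fs (k := k.+1) kn.
exact: pd_lt_ses aq Cpd (pd_ltS (IHk (ltnW kn))).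
Qed.

Lemma filtered_origin : cond4 o n M.
Proof.
exists (submod (F n)), P, (quotmod (F n)), (@subincl _ _ _), (quotproj (F n)).
split=> //.
- by apply: (fg_onto (f := quotproj (F n))) MPfg; exact: quotproj_onto.
- exact: ses_subquot.
split; first exact: filtered_pd.
case En: n => [|m]; first by case.
by have [] := Fs (k := n); rewrite En ?ltnSn.
Qed.

End Filtered.

Lemma cond3_1 : cond3 o n M -> cond1 o o' n M.
Proof. by move=> [P [F [Pp F0 FS Fs]]] k; exact: filtered_grade FS Fs k. Qed.

Lemma cond3_4 : cond3 o n M -> cond4 o n M.
Proof. by move=> [P [F [Pp F0 FS Fs]]]; exact: filtered_origin FS Fs. Qed.

Lemma cond4_5 : cond4 o n M -> cond5 o n M.
Proof. by move=> [X [P [Y [f [g fg_]]]]]; exact: (origin_dual H Mfg fg_). Qed.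

Lemma cond5_4 : cond5 o n M -> cond4 o n M.
Proof. by move=> [X [P [Y [f [g [fg_ _]]]]]]; exists X, P, Y, f, g. Qed.

Lemma cond4_6 : cond4 o n M -> cond6 o n M.
Proof.
move=> [X [P [Y [f [g fg_]]]]].
have [Z [X' [g' [f' [gf fm]]]]] := approx_of_origin H Mfg fg_.
by split; exists Z, X', g', f'.
Qed.

Lemma cond6_4 : cond6 o n M -> cond4 o n M.
Proof.
move=> [_ [Z [X [g [f [gf fm]]]]]]; have [_ Xfg _ _ _] := gf.
have [P [s sA]] := approx_ex H Xfg; have [_ oe] := origin_of_approx gf fm sA.
by exists X, P, _, (pair_map f s), (quotproj (linimg (pair_map f s))).
Qed.

Lemma cond5_1 : star_condition o o' n -> cond5 o n M -> cond1 o o' n M.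
Proof.
move=> star [X [P [Y [f [g [oe /dual_ses dS]]]]]] j jn.
have [_ _ Yfg fg_ [Yn _]] := oe.
apply: (grade_isom H (ext_fg H j Yfg) (origin_ext_isom H Mfg oe (dS fg_) jn)).
exact: star.
Qed.

Lemma conditions_equivalent :
  [/\ (cond1 o o' n M <-> cond2 o o' n M) /\ (cond2 o o' n M <-> cond3 o n M),
      cond3 o n M -> cond4 o n M,
      (cond4 o n M <-> cond5 o n M) /\ (cond5 o n M <-> cond6 o n M)
    & star_condition o o' n ->
        [<-> cond1 o o' n M; cond2 o o' n M; cond3 o n M; cond4 o n M;
             cond5 o n M; cond6 o n M]].
Proof.
have c12 := cond12 H Mfg (n := n); have c21 := cond21 H Mfg (n := n).
split; [split | exact: cond3_4 | split | move=> star].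
- by split.
- by split=> [/c21/cond1_3|/cond3_1/c12].
- by split; [exact: cond4_5 | exact: cond5_4].
- by split=> [/cond5_4/cond4_6|/cond6_4/cond4_5].
tfae=> //.
- by move/c21/cond1_3.
- exact: cond3_4.
- exact: cond4_5.
- by move/cond5_4/cond4_6.
- by move/cond6_4/cond4_5/(cond5_1 star).
Qed.

End Conditions.

(** * Ideals and primes of a commutative ring *)

Section Ideals.
Variable R : comPzRingType.
Implicit Types I J p : R -> Prop.

Definition is_ideal I : Prop :=
  [/\ I 0, forall a b, I a -> I b -> I (a + b) & forall a b, I b -> I (a * b)].

Section Mod.
Variables (J : R -> Prop) (Ji : is_ideal J).

Lemma ideal0 : J 0. Proof. by case: Ji. Qed.
Lemma idealD a b : J a -> J b -> J (a + b). Proof. by case: Ji => _ + _; exact. Qed.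
Lemma idealMl a b : J b -> J (a * b). Proof. by case: Ji => _ _; exact. Qed.
Lemma idealMr a b : J a -> J (a * b). Proof. by rewrite mulrC; exact: idealMl. Qed.
Lemma idealN a : J a -> J (- a). Proof. by rewrite -mulN1r; exact: idealMl. Qed.
Lemma idealB a b : J a -> J b -> J (a - b).
Proof. by move=> Ja /idealN; exact: idealD. Qed.
Lemma ideal_sum n (F : 'I_n -> R) : (forall i, J (F i)) -> J (\sum_i F i).
Proof.
by move=> JF; elim/big_rec: _ => [|i a _]; [exact: ideal0 | exact: idealD].
Qed.

Definition mx_in m n (M : 'M[R]_(m, n)) : Prop := forall i j, J (M i j).

Lemma mx_in0 m n : mx_in (0 : 'M_(m, n)).
Proof. by move=> i j; rewrite mxE; exact: ideal0. Qed.
Lemma mx_inD m n (M N : 'M_(m, n)) : mx_in M -> mx_in N -> mx_in (M + N).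
Proof. by move=> MJ NJ i j; rewrite mxE; exact: idealD. Qed.
Lemma mx_inN m n (M : 'M_(m, n)) : mx_in M -> mx_in (- M).
Proof. by move=> MJ i j; rewrite mxE; exact: idealN. Qed.
Lemma mx_inB m n (M N : 'M_(m, n)) : mx_in M -> mx_in N -> mx_in (M - N).
Proof. by move=> MJ /mx_inN; exact: mx_inD. Qed.
Lemma mx_inZ m n a (M : 'M_(m, n)) : mx_in M -> mx_in (a *: M).
Proof. by move=> MJ i j; rewrite mxE; exact: idealMl. Qed.
Lemma mx_inMl m n q (N : 'M_(m, n)) (M : 'M_(n, q)) : mx_in M -> mx_in (N *m M).
Proof. by move=> MJ i j; rewrite mxE; apply: ideal_sum => k; exact: idealMl. Qed.
Lemma mx_inMr m n q (M : 'M_(m, n)) (N : 'M_(n, q)) : mx_in M -> mx_in (M *m N).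
Proof. by move=> MJ i j; rewrite mxE; apply: ideal_sum => k; exact: idealMr. Qed.

Lemma mx_in_col m1 m2 n (M : 'M_(m1, n)) (N : 'M_(m2, n)) :
  mx_in M -> mx_in N -> mx_in (col_mx M N).
Proof. by move=> MJ NJ i j; rewrite mxE; case: fintype.split. Qed.

Lemma det_mod m (M N : 'M[R]_m) : mx_in (M - N) -> J (\det M - \det N).
Proof.
move=> MN; rewrite /determinant -sumrB; elim/big_rec: _ => [|s a _].
  exact: ideal0.
apply: idealD; rewrite -mulrBr; apply: idealMl.
elim/big_rec2: _ => [|i b c _ bc]; first by rewrite subrr; exact: ideal0.
have -> : M i (s i) * c - N i (s i) * b =
    (M i (s i) - N i (s i)) * c + N i (s i) * (c - b).
  by rewrite mulrBl mulrBr addrA subrK.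
apply: idealD; last exact: idealMl.
by apply: idealMr; have := MN i (s i); rewrite !mxE.
Qed.

Definition adjoin_ideal x : R -> Prop := fun a => exists b, J (a - x * b).

Lemma adjoin_is_ideal x : is_ideal (adjoin_ideal x).
Proof.
split=> [|a b [c ac] [d bd]|a b [c bc]].
- by exists 0; rewrite mulr0 subr0; exact: ideal0.
- by exists (c + d); rewrite mulrDr opprD addrACA; exact: idealD.
by exists (a * c); rewrite mulrCA -mulrBr; exact: idealMl.
Qed.

Lemma adjoin_sub x a : J a -> adjoin_ideal x a.
Proof. by move=> Ja; exists 0; rewrite mulr0 subr0. Qed.

End Mod.

Lemma mx_in_adjoin J x m n (M : 'M_(m, n)) : is_ideal J ->
  mx_in (adjoin_ideal J x) M <-> exists N, mx_in J (M - x *: N).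
Proof.
move=> Ji; split=> [MJ|[N MN] i j]; last first.
  by exists (N i j); have := MN i j; rewrite !mxE.
have /choice[f fE] : forall i, exists g : 'I_n -> R,
    forall j, J (M i j - x * g j).
  by move=> i; have [g gE] := choice (MJ i); exists g.
by exists (\matrix_(i, j) f i j) => i j; rewrite !mxE.
Qed.

Definition is_prime p : Prop :=
  [/\ is_ideal p, ~ p 1 & forall a b, p (a * b) -> p a \/ p b].

Section Prime.
Variable p : R -> Prop.
Hypothesis pp : is_prime p.

Let pi : is_ideal p. Proof. by case: pp. Qed.

Lemma primeM a b : ~ p a -> ~ p b -> ~ p (a * b).
Proof. by case: pp => _ _ pM na nb /pM[]. Qed.

Lemma primeX a n : ~ p a -> ~ p (a ^+ n).
Proof.
move=> na; elim: n => [|n IHn]; first by case: pp.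
by rewrite exprS; exact: primeM.
Qed.

(** Linear algebra over the field of fractions of [R / p], with denominators
    cleared by [s]: if every row relation of [D] is one of [E], then the
    columns of [E] are combinations of those of [D].  The proof is Gaussian
    elimination on the rows. *)
Lemma prime_factor m n q (D : 'M[R]_(m, n)) (E : 'M[R]_(m, q)) :
  (forall z : 'rV_m, mx_in p (z *m D) -> mx_in p (z *m E)) ->
  exists2 s, ~ p s & exists G : 'M_(n, q), mx_in p (s *: E - D *m G).
Proof.
elim: m D E => [|m IHm] D E DE.
  by exists 1; [case: pp | exists 0 => -[]].
rewrite -[m.+1]/(1 + m)%N in D E DE *.
rewrite -[D]vsubmxK -[E]vsubmxK in DE *.
move: (usubmx D) (dsubmx D) (usubmx E) (dsubmx E) DE => {D E} d D e E DE.
(* If the first row of [D] is zero modulo [p], so is that of [E]; otherwise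
   [d 0 a] is a pivot and clears column [a]. *)
have [dp|/existsNP[i0 /existsNP[a da]]] := pselect (mx_in p d).
  have [z|s sp [G GE]] := IHm D E.
    have := DE (row_mx 0 z); rewrite !mul_row_col !mul0mx !add0r; exact.
  exists s => //; exists G; rewrite mul_col_mx scale_col_mx opp_col_mx add_col_mx.
  apply: mx_in_col => //; apply: mx_inB => //; last exact: mx_inMr.
  apply: mx_inZ => //.
  have := DE (row_mx 1%:M 0); rewrite !mul_row_col !mul0mx !addr0 !mul1mx; exact.
rewrite (ord1 i0) in da.
pose c := col a D.
have [z|s sp [G GE]] := IHm (d 0 a *: D - c *m d) (d 0 a *: E - c *m e).
  have := DE (row_mx (- (z *m c)) (d 0 a *: z)).
  rewrite !mul_row_col !mulNmx -!scalemxAl !mulmxBr -!scalemxAr !mulmxA.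
  by rewrite ![- _ + _]addrC.
exists (s * d 0 a); first exact: primeM.
pose w := s *: e - d *m G.
(* The solution [G] for the remaining rows is corrected in the row [a] only,
   to fit the first row; by the choice of the pivot the other equations
   survive. *)
pose u : 'cV[R]_n := delta_mx a 0.
have uE k (F : 'M_(k, n)) : F *m u = col a F.
  exact/esym/colE.
exists (d 0 a *: G + u *m w).
rewrite mul_col_mx scale_col_mx opp_col_mx add_col_mx; apply: mx_in_col.
  rewrite mulmxDr mulmxA uE -scalemxAr.
  rewrite (_ : col a d = (d 0 a)%:M); last first.
    by apply/matrixP => i j; rewrite !mxE (ord1 i) (ord1 j) eqxx.
  rewrite mul_scalar_mx /w scalerBr scalerA [d 0 a * s]mulrC.
  by rewrite [X in _ - X]addrC subrK subrr; exact: mx_in0.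
move: GE; rewrite mulmxDr mulmxA uE -/c -scalemxAr mulmxBl scalerBr scalerA.
rewrite /w mulmxBr -scalemxAr -scalemxAl mulmxA.
congr (mx_in p _).
by rewrite !opprD !opprK !addrA; congr (_ + _); rewrite -!addrA; congr (_ + _); rewrite addrC.
Qed.

End Prime.
End Ideals.

(** * Prime avoidance in a noetherian ring *)

Section NoetherianIdeals.
Variable R : comPzRingType.
Hypothesis RN : left_noetherian R.
Implicit Types I J : R -> Prop.

(** A family without maximal member would contain a strictly increasing
    sequence of ideals, whose union is finitely generated and therefore
    reached at a finite stage. *)
Lemma max_ideal (F : (R -> Prop) -> Prop) I0 :
  (forall I, F I -> is_ideal I) -> F I0 ->
  exists I, [/\ F I, forall a, I0 a -> I a
    & forall I', F I' -> (forall a, I a -> I' a) -> forall a, I' a -> I a].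
Proof.
move=> Fi F0; apply: contrapT => nomax.
(* A strictly larger member above each one, so that choice gives a
   sequence. *)
have step (X : {I | F I /\ forall a, I0 a -> I a}) :
  exists Y : {I | F I /\ forall a, I0 a -> I a},
    (forall a, sval X a -> sval Y a) /\ ~ forall a, sval Y a -> sval X a.
  case: X => I [FI I0I] /=; apply: contrapT => noY; apply: nomax.
  exists I; split=> // I' FI' II'; apply: contrapT => nII'; apply: noY.
  by exists (exist _ I' (conj FI' (fun a ha => II' a (I0I a ha)))).
have [f fE] := choice step.
pose X k := iter k f (exist _ I0 (conj F0 (fun a (h : I0 a) => h))).
have Xi k : is_ideal (sval (X k)) by apply: Fi; case: (X k) => I [].
have Xmono k l a : (k <= l)%N -> sval (X k) a -> sval (X l) a.
  move=> /subnKC <-; elim: (l - k)%N => [|m IHm]; first by rewrite addn0.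
  by rewrite addnS => /IHm; exact: (fE _).1.
pose U a := exists k, sval (X k) a.
pose S : {pred R^o} := fun a : R => `[< U a >].
have Sc : submod_closed S.
  split=> [|a x y /asboolP[k kx] /asboolP[l ly]]; apply/asboolP.
    by exists 0; exact: ideal0 (Xi 0).
  exists (maxn k l); apply: (idealD (Xi _)); last exact: Xmono (leq_maxr _ _) ly.
  by apply: (idealMl (Xi _)); exact: Xmono (leq_maxl _ _) kx.
pose S' : submodClosed R^o := HB.pack S (GRing.isSubmodClosed.Build R R^o S Sc).
have [s sP] := RN S'.
have [N NE] : exists N, forall i : 'I_(size s), sval (X N) (subincl s`_i : R).
  have /choice[g gE] : forall i : 'I_(size s), exists k, sval (X k) (subincl s`_i : R).
    by move=> i; have /asboolP := subincl_mem (s`_i).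
  exists (\max_i g i)%N => i; apply: Xmono (gE i); exact: (leq_bigmax (F := g)).

have [_ []] := fE (X N) => a aN.
have aS : (a : R^o) \in S' by apply/asboolP; exists N.+1.
have /subinclP[y <-] := aS; have [c ->] := sP y.
rewrite linear_sum; apply: (ideal_sum (Xi N)) => i.
by rewrite linearZ; exact: (idealMl (Xi N) _ (NE i)).
Qed.

Section Avoidance.
Variable J : R -> Prop.
Hypothesis Ji : is_ideal J.

(** The annihilator of the class of [t] in [R / J]; the maximal ones among
    those with [t] outside [J] are associated primes of [R / J]. *)
Definition ann t : R -> Prop := fun a => J (a * t).

Lemma ann_ideal t : is_ideal (ann t).
Proof.
split=> [|a b aJ bJ|a b bJ]; rewrite /ann.
- by rewrite mul0r; exact: ideal0.
- by rewrite mulrDl; exact: idealD.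
by rewrite -mulrA; exact: idealMl.
Qed.

Definition max_ann t : Prop :=
  ~ J t /\ forall t', ~ J t' -> (forall a, ann t a -> ann t' a) ->
  forall a, ann t' a -> ann t a.

Lemma max_ann_prime t : max_ann t -> is_prime (ann t).
Proof.
move=> [tJ tmax]; split; first exact: ann_ideal; first by rewrite /ann mul1r.
move=> a b abt; have [bt|bt] := pselect (ann t b); [by right | left].
apply: (tmax (b * t)) => //; last by rewrite /ann mulrA.
by move=> x xt; rewrite /ann mulrCA; exact: idealMl.
Qed.

Lemma max_ann_above t : ~ J t ->
  exists t', max_ann t' /\ forall a, ann t a -> ann t' a.
Proof.
move=> tJ; pose F I := exists2 t', ~ J t' & I = ann t'.
have [||I [[t' t'J ->] tt' tmax]] := @max_ideal F (ann t).
- by move=> _ [t' _ ->]; exact: ann_ideal.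
- by exists t.
exists t'; split=> //; split=> // u uJ; apply: tmax; by exists u.
Qed.

(** The ideal generated by [J] and [ts].  The coefficients are indexed by
    [nat] so that they do not depend on the length of [ts]. *)
Definition span (ts : seq R) : R -> Prop :=
  fun a => exists c : nat -> R, J (a - \sum_(i < size ts) c i * ts`_i).

Lemma span_ideal ts : is_ideal (span ts).
Proof.
split=> [|a b [c ac] [d bd]|a b [c bc]].
- by exists (fun=> 0); rewrite big1 ?subr0 => [|i _]; [exact: ideal0 | rewrite mul0r].
- exists (fun i => c i + d i); under eq_bigr do rewrite mulrDl.
  by rewrite big_split /= opprD addrACA; exact: idealD.
exists (fun i => a * c i); under eq_bigr do rewrite -mulrA.
by rewrite -mulr_sumr -mulrBr; exact: idealMl.
Qed.

(** Let [ts] generate a maximal ideal among those generated by [J] and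
    elements with maximal annihilators.  Every [t] with maximal annihilator is
    then in the span of [ts].  If no [ann ts_i] were contained in the prime
    ideal [ann t], the product of elements of the [ann ts_i] outside [ann t]
    would kill the span, hence [t]. *)
Lemma finite_max_ann : exists ts : seq R,
  (forall t, t \in ts -> max_ann t) /\
  forall t, max_ann t -> exists2 t', t' \in ts & forall a, ann t a <-> ann t' a.
Proof.
pose F I := exists2 ts : seq R, (forall t, t \in ts -> max_ann t) & I = span ts.
have [||I [[ts tsm ->] _ tsmax]] := @max_ideal F (span [::]).
- by move=> _ [ts _ ->]; exact: span_ideal.
- by exists [::].
exists ts; split=> // t tm; have [tJ tmax] := tm.
have [c tc] : span ts t.
  apply: (tsmax (span (t :: ts))).
  - by exists (t :: ts) => // u; rewrite inE => /orP[/eqP->|/tsm].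
  - move=> a [c ac]; exists (fun i => if i is i'.+1 then c i' else 0).
    by rewrite big_ord_recl /= mul0r add0r.
  exists (fun i => (i == 0)%:R); rewrite big_ord_recl /= mul1r big1 ?addr0 ?subrr.
    exact: ideal0.
  by move=> i _; rewrite mul0r.
have [] := max_ann_prime tm => _ t1 tM.
have [[i ni]|all] := pselect (exists i : 'I_(size ts), forall a, ann ts`_i a -> ann t a).
  exists ts`_i; first exact: mem_nth.
  have [iJ imax] := tsm ts`_i (mem_nth _ (ltn_ord i)).
  by move=> a; split; [exact: imax | exact: ni].
have /choice[b bE] : forall i : 'I_(size ts), exists a, ann ts`_i a /\ ~ ann t a.
  move=> i; apply: contrapT => nb; apply: all; exists i => a ia.
  by apply: contrapT => na; apply: nb; exists a.
have [] : ~ ann t (\prod_i b i).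
  elim/big_rec: _ => [//|i x _ nx]; apply: primeM (bE i).2 nx.
  exact: max_ann_prime.
have tE : t = (t - \sum_(i < size ts) c i * ts`_i) + \sum_(i < size ts) c i * ts`_i.
  by rewrite subrK.
rewrite /ann tE mulrDr; apply: idealD => //; first exact: idealMl.
rewrite mulr_sumr; apply: ideal_sum => // i.
rewrite (bigD1 i) //= [b i * _]mulrC mulrACA; apply: idealMl => //.
exact: (bE i).1.
Qed.

(** The zero divisors modulo [J] are the union of the finitely many maximal
    annihilators, all of them prime, and [I] is contained in none.  By prime
    avoidance [I] has an element outside their union. *)
Lemma regular_element I : is_ideal I ->
  (forall t, ~ J t -> exists2 a, I a & ~ J (a * t)) ->
  exists2 x, I x & forall a, J (x * a) -> J a.
Proof.
move=> Ii It; have [ts [tsm tsP]] := finite_max_ann.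
suff [x Ix xts] : exists2 x, I x & forall t, t \in ts -> ~ ann t x.
  exists x => // a xa; apply: contrapT => aJ.
  have [t [tm at_]] := max_ann_above aJ; have [t' t'ts tt'] := tsP t tm.
  by apply: (xts t' t'ts); apply/tt'/at_.
elim: ts tsm {tsP} => [|t ts IHts] tsm; first by exists 0; [exact: ideal0|].
have [|x Ix xts] := IHts; first by move=> u uts; apply: tsm; rewrite inE uts orbT.
have tm : max_ann t by apply: tsm; rewrite mem_head.
have tp := max_ann_prime tm.
have [tx|nx] := pselect (ann t x); last first.
  by exists x => // u; rewrite inE => /orP[/eqP->|/xts].
(* An element of [I] outside [ann t] but in all other annihilators: a product
   of elements of these with one of [I] outside [ann t].  Added to [x], which
   lies in [ann t] only, it avoids all of them. *)
have [y [Iy ty yts]] : exists y, [/\ I y, ~ ann t y & forall u, u \in ts -> ann u y].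
  elim: ts {IHts} tsm xts => [|u ts IHts] tsm xts.
    by have [a Ia aJ] := It t tm.1; exists a.
  have [||y [Iy ty yts]] := IHts.
  - move=> v vts; apply: tsm; move: vts; rewrite !inE => /orP[->|->] //.
    by rewrite !orbT.
  - by move=> v vts; apply: xts; rewrite inE vts orbT.
  have um : max_ann u by apply: tsm; rewrite !inE eqxx orbT.
  have [b ub tb] : exists2 b, ann u b & ~ ann t b.
    apply: contrapT => nb; apply: (xts u (mem_head _ _)).
    apply: (um.2 t tm.1) tx => a ua; apply: contrapT => na; apply: nb.
    by exists a.
  exists (b * y); split.
  - exact: idealMl.
  - exact: primeM.
  - move=> v; rewrite inE => /orP[/eqP->|/yts vy].
      exact: (idealMr (ann_ideal u)).
    exact: (idealMl (ann_ideal v)).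
exists (x + y); first exact: idealD.
move=> u; rewrite inE => /orP[/eqP->|uts] xy.
  by apply: ty; rewrite -[y](addKr x) addrC; exact: (idealB (ann_ideal t)).
apply: (xts u uts); rewrite -[x](addrK y).
by apply: (idealB (ann_ideal u)) => //; exact: yts.
Qed.

End Avoidance.
End NoetherianIdeals.

(** * Regular sequences and complexes of free modules *)

Section Complexes.
Variable R : comPzRingType.
Implicit Types J : R -> Prop.
Variables (r : nat -> nat) (D : forall k, 'M[R]_(r k.+1, r k)).
Hypothesis DD : forall k, D k.+1 *m D k = 0.

Definition exact_mod J k : Prop := forall z : 'rV_(r k.+1),
  mx_in J (z *m D k) -> exists w, mx_in J (z - w *m D k.+1).

(** [a] annihilates the cohomology in degree [k + 1] of the dual complex
    modulo [J]. *)
Definition kills J k a : Prop := forall c : 'cV_(r k.+1),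
  mx_in J (D k.+1 *m c) -> exists b : 'cV_(r k), mx_in J (a *: c - D k *m b).

Lemma kills_ideal J k : is_ideal J -> is_ideal (kills J k).
Proof.
move=> Ji; split=> [c _|a b aJ bJ c cJ|a b bJ c cJ].
- by exists 0; rewrite scale0r mulmx0 subr0; exact: mx_in0.
- have [x xJ] := aJ c cJ; have [y yJ] := bJ c cJ; exists (x + y).
  by rewrite scalerDl mulmxDr opprD addrACA; exact: mx_inD.
- have [y yJ] := bJ c cJ; exists (a *: y).
  by rewrite -scalemxAr -scalerA -scalerBr; exact: mx_inZ.
Qed.

Section Local.
Variables (J : R -> Prop) (Ji : is_ideal J) (t : R).
Let p := ann J t.
Hypothesis pp : is_prime p.

Let pi : is_ideal p. Proof. by case: pp. Qed.

(** After inverting [s], [h] is a generalized inverse of [D k]: the image of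
    [D k] becomes a direct summand. *)
Definition splits k : Prop := exists2 s, ~ p s &
  exists h : 'M_(r k, r k.+1), D k *m (s%:M - h *m D k) = 0.

(** Put [e = s - h D_(k+1)].  It satisfies [e e = s e] and [e D_k = s D_k], so
    it is, up to [s], a projection with the kernel of [D_k].  A row [z] with
    [z D_k] in [p] satisfies [t z D_k] in [J]; by exactness [t z] is in the
    row space of [D_(k+1)] modulo [J], which [e] annihilates, so [z e] is in
    [p].  By [prime_factor], [s' e] is [D_k G] up to an error [u] with entries
    in [p].  With [N = s s' - u] one has [e N = s D_k G] exactly, and [det N]
    is a power of [s s'] modulo [p], so the adjugate of [N] removes the
    error. *)
Lemma local_homotopy k s (h : 'M_(r k.+1, r k.+2)) : ~ p s -> exact_mod J k ->
  D k.+1 *m (s%:M - h *m D k.+1) = 0 ->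
  exists2 d, ~ p d & exists g : 'M_(r k, r k.+1),
    D k *m g = d *: (s%:M - h *m D k.+1).
Proof.
move=> ns ex De; set e := s%:M - h *m D k.+1 in De *.
have [z zD|s' ns' [G GE]] := prime_factor pp (D := D k) (E := e).
  have [|w wE] := ex (t *: z).
    by move=> i j; rewrite -scalemxAl mxE mulrC; exact: zD.
  have := mx_inMr Ji e wE; rewrite mulmxBl -mulmxA De mulmx0 subr0 -scalemxAl.
  by move=> zJ i j; have := zJ i j; rewrite mxE mulrC.
set u := s' *: e - D k *m G in GE.
have eD : e *m D k = s *: D k.
  by rewrite mulmxBl mul_scalar_mx -mulmxA DD mulmx0 subr0.
have ee : e *m e = s *: e.
  by rewrite {1}/e mulmxBl mul_scalar_mx -mulmxA De mulmx0 subr0.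
pose N := (s * s')%:M - u.
have eN : e *m N = s *: (D k *m G).
  rewrite /N /u mulmxBr mulmxBr mul_mx_scalar -scalemxAr ee mulmxA eD.
  by rewrite -scalemxAl scalerA [s' * s]mulrC subKr.
exists (\det N).
  move=> pN; apply: (primeX pp (n := r k.+1) (primeM pp ns ns')).
  rewrite -det_scalar -[\det _](subrK (\det N)); apply: (idealD pi) => //.
  by apply: det_mod => //; rewrite /N subKr.
exists (s *: (G *m \adj N)).
by rewrite -scalemxAr mulmxA scalemxAl -eN -mulmxA mul_mx_adj mul_mx_scalar.
Qed.

Lemma splits_down k : exact_mod J k -> splits k.+1 -> splits k.
Proof.
move=> ex [s ns [h De]]; have [d nd [g gE]] := local_homotopy ns ex De.
exists (d * s); first exact: primeM.
exists g; rewrite mulmxBr mul_mx_scalar mulmxA gE -scalemxAl.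
by rewrite mulmxBl mul_scalar_mx -[_ *m _ *m D k]mulmxA DD mulmx0 subr0 scalerA subrr.
Qed.

(** On a cocycle [c] the term [h D_(k+1) c] vanishes modulo [J], so [d s c] is
    the coboundary of [g c]. *)
Lemma splits_kills k : exact_mod J k -> splits k.+1 ->
  exists2 a, ~ p a & kills J k a.
Proof.
move=> ex [s ns [h De]]; have [d nd [g gE]] := local_homotopy ns ex De.
exists (d * s); first exact: primeM.
move=> c cJ; exists (g *m c); rewrite mulmxA gE -scalemxAl mulmxBl mul_scalar_mx.
rewrite scalerBr scalerA opprB addrC subrK -mulmxA.
by apply: mx_inZ => //; exact: mx_inMl.
Qed.

Lemma local_kills n k : splits n -> (forall l, (k <= l)%N -> exact_mod J l) ->
  (k < n)%N -> exists2 a, ~ p a & kills J k a.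
Proof.
move=> sn ex kn; apply: splits_kills; first exact: ex.
suff S d m : (d + m = n)%N -> (k < m)%N -> splits m.
  by apply: (S (n - k.+1)%N) => //; rewrite subnK.
elim: d m => [|d IHd] m; first by rewrite add0n => ->.
rewrite addSnnS => dm km; apply: splits_down; first exact/ex/ltnW.
by apply: IHd dm _; exact: leqW.
Qed.

End Local.

Section Regular.
Hypothesis RN : left_noetherian R.
Variable n : nat.
Variable top : 'M[R]_(r n, r n.+1).
Hypothesis topE : D n *m (1%:M - top *m D n) = 0.

(** No associated prime of [R / J] contains the annihilator of the cohomology,
    because the complex splits there ([local_kills]); so [regular_element]
    applies. *)
Lemma kills_regular J k : is_ideal J ->
  (forall l, (k <= l)%N -> exact_mod J l) -> (k < n)%N ->
  exists2 x, kills J k x & forall a, J (x * a) -> J a.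
Proof.
move=> Ji ex kn; apply: (regular_element RN Ji (kills_ideal k Ji)) => t tJ.
have [t' [tm tt']] := max_ann_above RN Ji tJ; have tp := max_ann_prime Ji tm.
have [|a na aK] := local_kills Ji tp _ ex kn.
  by exists 1; [case: tp | exists top].
by exists a => // /tt'.
Qed.

Fixpoint regular_seq J (xs : seq R) : Prop :=
  if xs is x :: xs' then
    (forall a, J (x * a) -> J a) /\ regular_seq (adjoin_ideal J x) xs'
  else True.

(** Dividing by a regular element costs exactness in one degree, by the long
    exact sequence of multiplication by [x]. *)
Lemma exact_adjoin J x k : is_ideal J -> (forall a, J (x * a) -> J a) ->
  exact_mod J k -> exact_mod J k.+1 -> exact_mod (adjoin_ideal J x) k.+1.
Proof.
move=> Ji xr ex ex' z /(mx_in_adjoin x _ Ji)[w wE].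
have [|w' w'E] := ex w.
  move=> i j; apply: xr; have := mx_inMr Ji (D k) wE i j.
  rewrite mulmxBl -mulmxA DD mulmx0 sub0r -scalemxAl 2!mxE => /(idealN Ji).
  by rewrite opprK.
have [|w'' w''E] := ex' (z - x *: w').
  have -> : (z - x *: w') *m D k.+1 =
      (z *m D k.+1 - x *: w) + x *: (w - w' *m D k.+1).
    by rewrite mulmxBl scalerBr -scalemxAl addrA subrK.
  by apply: (mx_inD Ji) => //; exact: mx_inZ.
exists w''; apply/(mx_in_adjoin x _ Ji); exists w'.
by rewrite addrAC.
Qed.

(** If [a c] is a coboundary up to [x c'], then [c'] is a cocycle because [x]
    is regular, and [x c'] is a coboundary because [x] kills the
    cohomology. *)
Lemma kills_adjoin J x k a : is_ideal J -> (forall b, J (x * b) -> J b) ->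
  kills J k x -> kills (adjoin_ideal J x) k a -> kills J k a.
Proof.
move=> Ji xr xk ak c cJ.
have [|b /(mx_in_adjoin x _ Ji)[c' bE]] := ak c.
  by move=> i j; apply: adjoin_sub => //; exact: cJ.
have [|b' b'E] := xk c'.
  move=> i j; apply: xr; have := mx_inMl Ji (D k.+1) bE.
  rewrite 2!mulmxBr mulmxA DD mul0mx subr0 -!scalemxAr => h.
  have := mx_inB Ji (mx_inZ Ji a cJ) h => /(_ i j).
  by rewrite opprB addrC subrK mxE.
exists (b + b').
have -> : a *: c - D k *m (b + b') =
    (a *: c - D k *m b - x *: c') + (x *: c' - D k *m b').
  by rewrite addrA subrK mulmxDr opprD addrA.
exact: mx_inD.
Qed.

(** Regular elements are taken from the annihilator one at a time.  After [c]
    of them the complex is still exact in degrees at least [c], so the process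
    can go on while [c <= k]. *)
Lemma kills_regular_seq m k c J : is_ideal J -> (c + m = k.+1)%N -> (k < n)%N ->
  (forall l, (c <= l)%N -> exact_mod J l) ->
  exists xs, [/\ size xs = m, regular_seq J xs & forall x, x \in xs -> kills J k x].
Proof.
elim: m c J => [|m IHm] c J Ji cm kn ex; first by exists [::].
have ck : (c <= k)%N by rewrite -ltnS -cm addnS ltnS leq_addr.
have [|x xk xr] := kills_regular Ji (k := k) _ kn.
  by move=> l kl; apply: ex; exact: leq_trans kl.
have [||||xs [xsm xsr xsk]] := IHm c.+1 (adjoin_ideal J x).
- exact: adjoin_is_ideal.
- by rewrite addSnnS.
- by [].
- by move=> [//|l] cl; apply: exact_adjoin => //; apply: ex => //; exact: leqW.
exists (x :: xs); split=> //=; first by rewrite xsm.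
by move=> y; rewrite inE => /orP[/eqP->//|/xsk]; exact: kills_adjoin.
Qed.

End Regular.

Section Vanishing.
Hypothesis ex0 : forall k (z : 'rV_(r k.+1)), z *m D k = 0 ->
  exists w, z = w *m D k.+1.

Lemma exact_mx m k (M : 'M_(m, r k.+1)) : M *m D k = 0 ->
  exists N, M = N *m D k.+1.
Proof.
move=> MD; have /choice[f fE] : forall i, exists w, row i M = w *m D k.+1.
  by move=> i; apply: ex0; rewrite -row_mul MD row0.
exists (\matrix_i f i); apply/row_matrixP => i.
by rewrite row_mul rowK fE.
Qed.

(** Multiplication by [x] is zero on the module presented by [D 0]. *)
Definition null_homotopic x : Prop := exists h : 'M_(r 0, r 1), h *m D 0 = x%:M.

(** The homotopy is built upwards: if [D_k h D_k = x D_k], then [x - D_k h] is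
    killed by [D_k], so it factors through [D_(k+1)]. *)
Lemma null_homotopy x k : null_homotopic x ->
  exists (h : 'M_(r k, r k.+1)) (h' : 'M_(r k.+1, r k.+2)),
    x%:M = D k *m h + h' *m D k.+1.
Proof.
move=> [h0 h0E].
suff [h hE] : exists h : 'M_(r k, r k.+1), D k *m h *m D k = x *: D k.
  have [|h' h'E] := @exact_mx _ k (x%:M - D k *m h).
    by rewrite mulmxBl mul_scalar_mx hE subrr.
  by exists h, h'; rewrite -h'E addrC subrK.
elim: k => [|k [h hE]]; first by exists h0; rewrite -mulmxA h0E mul_mx_scalar.
have [|h' h'E] := @exact_mx _ k (x%:M - D k *m h).
  by rewrite mulmxBl mul_scalar_mx hE subrr.
exists h'; rewrite -mulmxA -h'E mulmxBr mulmxA DD mul0mx subr0.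
by rewrite mul_mx_scalar.
Qed.

Definition coboundary_mod J j : 'cV[R]_(r j) -> Prop :=
  match j with
  | 0 => fun c => mx_in J c
  | j'.+1 => fun c => exists b : 'cV_(r j'), mx_in J (c - D j' *m b)
  end.

(** Vanishing of Ext^j with values in [R / J], by induction on the sequence.
    By the homotopy [x c] is the coboundary of [b = h c] modulo [J]; thus [b]
    is a cocycle modulo [(J, x)], hence a coboundary there by induction, and
    its coboundary is [x] times a coboundary.  Cancel the regular element
    [x]. *)
Lemma regular_seq_vanish xs J j (c : 'cV_(r j)) : is_ideal J ->
  regular_seq J xs -> (forall x, x \in xs -> null_homotopic x) ->
  (j < size xs)%N -> mx_in J (D j *m c) -> coboundary_mod J c.
Proof.
elim: xs J j c => [|x xs IHxs] //= J j c Ji [xr xsr] xh jx cJ.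
have xh0 : null_homotopic x by apply: xh; rewrite mem_head.
case: j c jx cJ => [|j] c jx cJ /=.
  have [h hE] := xh0; move=> i l; apply: xr.
  have := mx_inMl Ji h cJ; rewrite mulmxA hE mul_scalar_mx => /(_ i l).
  by rewrite mxE.
have [h [h' hE]] := null_homotopy j xh0.
pose b := h *m c.
have bE : mx_in J (x *: c - D j *m b).
  rewrite -mul_scalar_mx hE mulmxDl /b mulmxA addrC addKr -mulmxA.
  exact: mx_inMl.
have bc : coboundary_mod (adjoin_ideal J x) b.
  apply: IHxs => //; first exact: adjoin_is_ideal.
    by move=> y yxs; apply: xh; rewrite inE yxs orbT.
  apply/(mx_in_adjoin x _ Ji); exists c.
  by move=> i l; have := idealN Ji (bE i l); rewrite !mxE opprB.
have [b' b'E] : exists b', mx_in J (D j *m b - x *: (D j *m b')).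
  case: j h h' {hE cJ jx} c @b bE bc => [|j] h h' c b bE /=.
    move=> /(mx_in_adjoin x _ Ji)[b' b'E]; exists b'.
    by have := mx_inMl Ji (D 0) b'E; rewrite mulmxBr -scalemxAr.
  move=> [a /(mx_in_adjoin x _ Ji)[b' b'E]]; exists b'.
  have := mx_inMl Ji (D j.+1) b'E.
  by rewrite 2!mulmxBr (mulmxA (D j.+1) (D j) a) DD mul0mx subr0 -scalemxAr.
exists b' => i l; apply: xr.
have := mx_inD Ji bE b'E i l.
by rewrite addrA subrK -scalerBr mxE.
Qed.

End Vanishing.

End Complexes.

(** * Ext in terms of matrices *)

Section RowMaps.
Variable S : pzRingType.

Lemma row_functional_col m (f : {linear 'rV[S]_m -> S^o}) :
  exists c : 'cV[S]_m, forall z, f z = (z *m c) 0 0.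
Proof.
exists (\col_i (f 'e_i : S)) => z; rewrite mxE [z in LHS]row_sum_delta linear_sum.
by apply: eq_bigr => i _; rewrite linearZ mxE.
Qed.

Lemma col_row_functional m (c : 'cV[S]_m) :
  exists f : {linear 'rV[S]_m -> S^o}, forall z, f z = (z *m c) 0 0.
Proof.
by apply: ex_linear => a x y; rewrite mulmxDl -scalemxAl mxE [X in X + _]mxE.
Qed.

Definition pres_mx (W : lmodType S) : 'M[S]_(size (gens (syz W)), size (gens W)) :=
  lin1_mx (pres_map W : {linear 'rV[S]_(size (gens (syz W))) -> 'rV[S]_(size (gens W))}).

Lemma pres_mxE (W : lmodType S) (z : 'rV[S]_(size (gens (syz W)))) :
  pres_map W z = z *m pres_mx W :> 'rV[S]_(size (gens W)).
Proof. by rewrite /pres_mx mul_rV_lin1. Qed.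

Lemma functional_mx (W : lmodType S) (f : {linear freecover W -> S^o}) :
  exists c : 'cV[S]_(size (gens W)),
    (forall z : 'rV[S]_(size (gens W)), f z = (z *m c) 0 0) /\
    ((forall y, f (pres_map W y) = 0) -> pres_mx W *m c = 0).
Proof.
have [c cE] := row_functional_col (f : {linear 'rV[S]_(size (gens W)) -> S^o}).
exists c; split=> // f0; apply/row_matrixP => i; rewrite row_mul row0.
apply/matrixP => a b; rewrite (ord1 a) (ord1 b) [RHS]mxE -[RHS](f0 (delta_mx 0 i : 'rV[S]_(size (gens (syz W))))).
by rewrite pres_mxE cE rowE.
Qed.

Lemma mx_functional (W : lmodType S) (c : 'cV[S]_(size (gens W))) :
  exists f : {linear freecover W -> S^o},
    (forall z : 'rV[S]_(size (gens W)), f z = (z *m c) 0 0) /\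
    forall y : 'rV[S]_(size (gens (syz W))),
      f (pres_map W y) = (y *m (pres_mx W *m c)) 0 0.
Proof.
have [f fE] := col_row_functional c.
by exists f; split=> // y; rewrite pres_mxE fE mulmxA.
Qed.

End RowMaps.

Lemma mulmx_conv (R : comPzRingType) m n q (M : 'M[R]_(m, n)) (N : 'M[R]_(n, q)) :
  @mulmx R^c m n q M N = @mulmx R m n q M N.
Proof.
by apply/matrixP => i j; rewrite !mxE; apply: eq_bigr => k _; exact: mulrC.
Qed.

Section Cochains.
Variables (A B : pzRingType) (o : antiiso B A).
Implicit Types W : lmodType A.

Lemma linker_dual (M N : lmodType A) (f : {linear M -> N})
    (z : submod (linker (dualmap o f))) y : (subincl z : dual o N) (f y) = 0.
Proof. exact: (congr1 (fun w : dual o M => w y) (eqP (subincl_mem z))). Qed.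

Definition is_coboundary W (j : nat) : {linear freecover (syzn j W) -> A^o} -> Prop :=
  match j with
  | 0 => fun f => forall y, f y = 0
  | j'.+1 => fun f => exists g : {linear freecover (syzn j' W) -> A^o},
      forall y, f y = g (pres_map (syzn j' W) y)
  end.

Lemma coboundary_mem j W (f : cochain o j W) :
  is_coboundary f -> f \in coboundary o j W.
Proof.
case: j f => [|j] f fb; apply/mem_linimg.
  by exists 0; apply: dual_ext => y; exact/esym/fb.
by have [g gE] := fb; exists g; apply: dual_ext => y; exact: esym (gE y).
Qed.

Lemma ext_zero_cochain j W :
  (forall f : {linear freecover (syzn j W) -> A^o},
    (forall y, f (pres_map (syzn j W) y) = 0) -> is_coboundary f) ->
  ext_zero o j W.
Proof.
move=> fW x; case: (quotprojP x) => z ->; apply/quotproj0.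
have z0 y : (subincl z : cochain o j W) (pres_map (syzn j W) y) = 0.
  exact: (@linker_dual _ _ (pres_map (syzn j W)) z y).
exact: coboundary_mem (fW (subincl z : cochain o j W) z0).
Qed.

Lemma subquot_scale0 (V : lmodType B) (D E : submodClosed V) b (z : submod D) :
  b *: subincl z \in E -> b *: quotproj (preim_sub (@subincl _ _ D) E) z = 0.
Proof. by move=> zE; rewrite -linearZ; apply/quotproj0; rewrite inE linearZ. Qed.

Lemma ext_killed j W b :
  (forall f : {linear freecover (syzn j W) -> A^o},
    (forall y, f (pres_map (syzn j W) y) = 0) ->
    exists2 g : {linear freecover (syzn j W) -> A^o},
      is_coboundary g & forall y, g y = (f y : A) * o b) ->
  forall x : ext o j W, b *: x = 0.
Proof.
move=> fW x; case: (quotprojP x) => z ->.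
apply: subquot_scale0.
have z0 y : (subincl z : cochain o j W) (pres_map (syzn j W) y) = 0.
  exact: (@linker_dual _ _ (pres_map (syzn j W)) z y).
have [g gb gE] := fW (subincl z : cochain o j W) z0.
have <- : (g : cochain o j W) = b *: subincl z by apply: dual_ext => y; exact: gE.
exact: coboundary_mem gb.
Qed.

Lemma ext_killed_mx j W b :
  (forall c : 'cV[A]_(size (gens (syzn j.+1 W))), pres_mx (syzn j.+1 W) *m c = 0 ->
    exists d : 'cV[A]_(size (gens (syzn j W))),
      pres_mx (syzn j W) *m d = \col_i (c i 0 * o b)) ->
  forall x : ext o j.+1 W, b *: x = 0.
Proof.
move=> cW; apply: ext_killed => f f0.
have [c [fE c0]] := functional_mx f; have [d dE] := cW c (c0 f0).
have [g [_ gE]] := mx_functional d.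
have [h [hE _]] := @mx_functional _ (syzn j.+1 W) (\col_i (c i 0 * o b)).
exists h => [|y]; first by exists g => y; rewrite hE -dE; exact/esym/gE.
rewrite hE fE !mxE mulr_suml; apply: eq_bigr => i _.
by rewrite mxE mulrA.
Qed.

Lemma ext0_zero_mx W :
  (forall c : 'cV[A]_(size (gens W)), pres_mx W *m c = 0 -> c = 0) ->
  ext_zero o 0 W.
Proof.
move=> cW; apply: ext_zero_cochain => f f0 y.
by have [c [fE /(_ f0)/cW c0]] := functional_mx f; rewrite fE c0 mulmx0 mxE.
Qed.

Lemma extS_zero_mx j W :
  (forall c : 'cV[A]_(size (gens (syzn j.+1 W))), pres_mx (syzn j.+1 W) *m c = 0 ->
    exists d : 'cV[A]_(size (gens (syzn j W))), c = pres_mx (syzn j W) *m d) ->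
  ext_zero o j.+1 W.
Proof.
move=> cW; apply: ext_zero_cochain => f f0.
have [c [fE c0]] := functional_mx f; have [d dE] := cW c (c0 f0).
have [g [_ gE]] := mx_functional d.
by exists g => y; rewrite fE dE; exact/esym/gE.
Qed.

End Cochains.

Section Resolution.
Variables (A B : pzRingType) (o : antiiso B A) (o' : antiiso A B).
Hypothesis H : noeth_duality o o'.
Variable V : lmodType A.

Let AN : left_noetherian A. Proof. by case: H. Qed.

Lemma pres_mx_exact (z : 'rV[A]_(size (gens (syz V)))) : fg V ->
  z *m pres_mx V = 0 <-> exists w, w *m pres_mx (syz V) = z.
Proof.
move=> Vfg; have [iI _ _] := ses_syz Vfg.
rewrite -pres_mxE; split=> [z0|[w <-]].
  have /(rex_pres H (fg_syz V AN)).1[w wE] : cover (syz V) z = 0.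
    by apply: iI; rewrite linear0 -pres_mapE.
  by exists w; rewrite -pres_mxE.
rewrite -pres_mxE pres_mapE (_ : cover _ _ = 0) ?linear0//.
by apply/(rex_pres H (fg_syz V AN)).1; exists w.
Qed.

Lemma pres_mx_complex : fg V -> pres_mx (syz V) *m pres_mx V = 0.
Proof.
move=> Vfg; apply/row_matrixP => i; rewrite row_mul row0.
by apply/pres_mx_exact => //; exists (delta_mx 0 i); rewrite -rowE.
Qed.

Lemma pres_mx_top : fgproj V -> exists h, pres_mx V *m h *m pres_mx V = pres_mx V.
Proof.
move=> Vp; have [Vfg _] := Vp; have rp := rex_pres H Vfg.
have [s sE] := proj_lift idfun Vp rp.2.
have [|h hE] := lift_rex (fgproj_freecover _) rp (f := idfun \- (s \o cover V)).
  by move=> x; rewrite linearB /= sE subrr.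
have [m mE] : exists m : 'M[A]_(size (gens V), size (gens (syz V))),
    forall z : 'rV[A]_(size (gens V)), z *m m = h z.
  exists (lin1_mx (h : {linear 'rV[A]_(size (gens V)) -> 'rV[A]_(size (gens (syz V)))})).
  by move=> z; rewrite mul_rV_lin1.
have hK y : pres_map V (h (pres_map V y)) = pres_map V y.
  apply: etrans (hE _) _; set z := pres_map V y.
  by rewrite -[LHS]/(z - s (cover V z)) (rex0 rp) linear0 subr0.
exists m; apply/row_matrixP => i; rewrite !rowE !mulmxA.
have e := pres_mxE (delta_mx 0 i : 'rV[A]_(size (gens (syz V)))).
rewrite -e mE; apply: etrans (esym (pres_mxE _)) _; exact: hK.
Qed.

End Resolution.

(** * The star condition over a commutative ring *)

Section Commutative.
Variable R : comPzRingType.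
Hypotheses (RN : left_noetherian R) (RcN : left_noetherian R^c).

Let H : noeth_duality (anti_right R) (anti_left R).
Proof. by split. Qed.
Let H' : noeth_duality (anti_left R) (anti_right R).
Proof. exact: noeth_duality_sym. Qed.

Definition zero_ideal (a : R) : Prop := a = 0.

Lemma zero_ideal_ideal : is_ideal zero_ideal.
Proof.
by split=> [//|a b -> ->|a b ->]; rewrite /zero_ideal ?addr0 ?mulr0.
Qed.

Lemma mx_in_zero m n (M : 'M[R]_(m, n)) : mx_in zero_ideal M <-> M = 0.
Proof.
by split=> [M0|-> i j]; [apply/matrixP => i j; rewrite mxE; exact: M0 | rewrite /zero_ideal mxE].
Qed.

(** The resolution of [Z] splits in degree [n], because [syzn n Z] is
    projective; this starts the descent to the associated primes in
    [kills_regular_seq]. *)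
Lemma ext_regular_seq (Z : lmodType R^c) n k : fg Z -> pd_le n Z -> (k < n)%N ->
  exists xs : seq R, [/\ size xs = k.+1, regular_seq zero_ideal xs
    & forall x, x \in xs -> forall e : ext (anti_right R) k.+1 Z, x *: e = 0].
Proof.
move=> Zfg Zn kn; have Zq q : fg (syzn q Z) by exact: fg_syzn.
pose r q := size (gens (syzn q Z)).
pose D q : 'M[R]_(r q.+1, r q) := pres_mx (syzn q Z).
have ex q (z : 'rV[R]_(r q.+1)) : z *m D q = 0 -> exists w, w *m D q.+1 = z.
  rewrite -mulmx_conv => /(pres_mx_exact H z (Zq q)).1[w <-]; exists w.
  by rewrite -mulmx_conv.
have DD q : D q.+1 *m D q = 0.
  by rewrite -mulmx_conv; exact (pres_mx_complex H (Zq q)).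
have [top htop] := pres_mx_top H (pd_syzn H Zfg Zn).
have topE : D n *m (1%:M - (top : 'M[R]_(r n, r n.+1)) *m D n) = 0.
  rewrite mulmxBr mulmx1 mulmxA -(mulmx_conv (D n)) -mulmx_conv.
  by apply/eqP; rewrite subr_eq0; apply/eqP/esym.
have zi := zero_ideal_ideal.
have [|xs [xsk xsr xsK]] := kills_regular_seq DD RN topE zi (erefl (0 + k.+1)%N) kn.
  move=> q _ z /mx_in_zero/ex[w <-]; exists w; rewrite subrr.
  exact: mx_in0 zi _ _.
exists xs; split=> // x xxs; apply: ext_killed_mx => c c0.
have [|b bE] := xsK x xxs (c : 'cV[R]_(r k.+1)).
  by apply/mx_in_zero; rewrite -mulmx_conv.
have {}bE : x *: (c : 'cV[R]_(r k.+1)) = D k *m b by apply/subr0_eq/mx_in_zero.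
exists b; apply: (etrans (mulmx_conv (D k) b)); rewrite -bE.
by apply/matrixP => i l; rewrite !mxE (ord1 l).
Qed.

(** Multiplication by each [x] is zero on [E], so it is null-homotopic on the
    resolution of [E], and [regular_seq_vanish] applies. *)
Lemma killed_ext_zero (E : lmodType R) xs j : fg E ->
  regular_seq zero_ideal xs ->
  (forall x, x \in xs -> forall e : E, x *: e = 0) ->
  (j < size xs)%N -> ext_zero (anti_left R) j E.
Proof.
move=> Efg xsr xsE jx; have Eq q : fg (syzn q E) by exact: fg_syzn.
pose r q := size (gens (syzn q E)).
pose D q : 'M[R]_(r q.+1, r q) := pres_mx (syzn q E).
have ex q (z : 'rV[R]_(r q.+1)) : z *m D q = 0 -> exists w, z = w *m D q.+1.
  by move=> /(pres_mx_exact H' z (Eq q)).1[w <-]; exists w.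
have DD q : D q.+1 *m D q = 0 by exact (pres_mx_complex H' (Eq q)).
have xh x : x \in xs -> null_homotopic D x.
  move=> xxs; have /choice[f fE] : forall i, exists w : 'rV[R]_(r 1), w *m D 0 = x *: 'e_i.
    move=> i; have /((rex_pres H' Efg).1)[w wE] : cover E (x *: 'e_i : freecover E) = 0.
      by rewrite linearZ; exact: xsE.
    by exists w; rewrite -wE; exact/esym/pres_mxE.
  exists (\matrix_i f i); apply/row_matrixP => i.
  by rewrite row_mul rowK fE rowE mul_mx_scalar.
have van (c : 'cV[R]_(r j)) (c0 : D j *m c = 0) :=
  regular_seq_vanish DD ex zero_ideal_ideal xsr xh jx ((mx_in_zero _).2 c0).
case: j jx van => [|j] jx van.
  by apply: ext0_zero_mx => c /van/mx_in_zero.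
apply: extS_zero_mx => c /van[d /mx_in_zero/subr0_eq dE].
by exists d.
Qed.

Lemma commutative_star n : star_condition (anti_right R) (anti_left R) n.
Proof.
move=> Z Zfg Zn [//|k] kn; apply: grade_geP => j jk.
have [xs [xsk xsr xsE]] := ext_regular_seq Zfg Zn kn.
by apply: (killed_ext_zero (ext_fg H k.+1 Zfg) xsr xsE); rewrite xsk.
Qed.

End Commutative.

(** The commutative structure is built on [L] itself, so that the two rings
    can be substituted for each other, together with their modules. *)
Lemma comm_ring_ex (L : pzRingType) : (forall x y : L, x * y = y * x) ->
  exists R : comPzRingType, (R : pzRingType) = L.
Proof.
case: L => T c mC; pose L := GRing.PzRing.Pack c.
pose R : comPzRingType := HB.pack T c (GRing.PzSemiRing_hasCommutativeMul.Build L mC).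
exists R; rewrite /R; by case: c @L mC @R.
Qed.

Theorem theorem3p6 (L : pzRingType) (hl : left_noetherian L)
    (hr : left_noetherian L^c) (M : lmodType L^c) (hM : fg M) (n : nat) :
  let r := anti_right L in
  let l := anti_left L in
  [/\ (cond1 r l n M <-> cond2 r l n M) /\ (cond2 r l n M <-> cond3 r n M),
      cond3 r n M -> cond4 r n M,
      (cond4 r n M <-> cond5 r n M) /\ (cond5 r n M <-> cond6 r n M),
      cond4 r n M ->
        forall (Z X : lmodType L^c) (g : {linear Z -> X}) (f : {linear X -> M}),
          AB_approx r n g f -> rep_by_monos f ->
        forall (P : lmodType L^c) (s : {linear X -> P}), left_proj_approx s ->
          injective (pair_map f s) /\
          origin_ext r n (pair_map f s) (quotproj (linimg (pair_map f s)))
    & (star_condition r l n ->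
        [<-> cond1 r l n M; cond2 r l n M; cond3 r n M; cond4 r n M;
             cond5 r n M; cond6 r n M]) /\
      ((forall x y : L, x * y = y * x) ->
        [<-> cond1 r l n M; cond2 r l n M; cond3 r n M; cond4 r n M;
             cond5 r n M; cond6 r n M])].
Proof.
move=> r l; have H : noeth_duality r l by split.
have [c123 c34 c456 cstar] := conditions_equivalent H n hM.
split=> //; first by move=> _ Z X g f gf fm P s sA; exact: (origin_of_approx gf fm sA).
split=> // /comm_ring_ex[R RL]; apply: cstar.
rewrite /r /l; case: L / RL hl hr {M hM H r l c123 c34 c456} => hl hr.
exact: commutative_star.
Qed.
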